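(* The measurable transverse dynamics of the Ghys–Kenyon lamination $(\boldsymbol{M},\boldsymbol{\mathcal{L}})$ is represented by a binary adding machine, and the lamination is uniquely ergodic. Explicitly: the equivalence relation $\mathcal{R}$ induced by $\boldsymbol{\mathcal{L}}$ on its complete transversal $X=\overline{\mathcal{R}[T_\infty]}$ admits exactly one invariant Borel probability measure $\mu$, and $(\mathcal{R},X,\mu)$ is stably orbit equivalent to the orbit equivalence relation of the transformation $S(x)=x+1$ on the ring $\mathbb{Z}_2$ of $2$-adic integers (identified with $\{0,1\}^{\mathbb{N}}$), endowed with its Haar probability measure.
   Context: Ambient space. $\mathcal{Z}^2$ is the Cayley graph of $\mathbb{Z}^2$ for the generators $(\pm1,0),(0,\pm1)$ (vertices $\mathbb{Z}^2$, edges of length 1). $\mathcal{T}$ is the set of infinite connected subgraphs of $\mathcal{Z}^2$ containing $0$. For $T\in\mathcal{T}$, $B_T(0,N)$ is the open ball of centre $0$ and radius $N$ for the path metric of $T$. For $T,T'\in\mathcal{T}$ let $R(T,T')=\sup\{N\geq1: B_T(0,N)=B_{T'}(0,N)\}$ ($0$ if this set is empty) and $d(T,T')=e^{-R(T,T')}$; $(\mathcal{T},d)$ is compact. $\mathcal{R}$ identifies $T$ and $T'$ iff $T'=T-v$ for some vertex $v$ of $T$; $\mathcal{R}[T]$ is the class of $T$. Kenyon tree. $T_1$ is the tree made of the segments $[-1,1]\times\{0\}$ and $\{0\}\times[-2,2]$. Given $T_n$, take the union of the images of $T_n+(0,2^n)$ under the rotations about $0$ of angles $0,\pi/2,\pi,3\pi/2$,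 and remove the two terminal edges (with their terminal vertices) contained in the horizontal axis; the result is $T_{n+1}$. The $T_n$ are increasing and $T_\infty=\bigcup_{n\geq1}T_n$. $X=\overline{\mathcal{R}[T_\infty]}$ (closure in $\mathcal{T}$) is the Ghys–Kenyon minimal set; $\mathcal{R}$ also denotes its restriction to $X$. Lamination. The Ghys–Kenyon lamination $(\boldsymbol{M},\boldsymbol{\mathcal{L}})$ is a compact lamination by Riemann surfaces having $X$ as a complete transversal, whose holonomy pseudogroup reduced to $X$ is generated by the partial translations $T\mapsto T-v$, defined on $\{T\in X: v\in T\}$, $v\in\mathbb{Z}^2$; thus the equivalence relation induced on $X$ is $\mathcal{R}$, and the measurable transverse dynamics is that of $\mathcal{R}$ on $X$ up to stable orbit equivalence. Transverse invariant measures correspond to $\mathcal{R}$-invariant measures on $X$; unique ergodicity means uniqueness up to scaling. Measured relations. A partial transformation of $\mathcal{R}$ is a Borel isomorphism $\varphi:A\to B$ between Borel subsets of $X$ with graph contained in $\mathcal{R}$; a Borel measure is invariant for $\mathcal{R}$ if it is preserved by all partial transformations. $(\mathcal{R},X,\mu)$ and $(\mathcal{R}',X',\mu')$ are orbit equivalent if there are saturated Borel sets $Z\subset X$, $Z'\subset X'$ of full measure and a Borel isomorphism $\varphi:Z\to Z'$ with $\varphi(\mathcal{R}[x])=\mathcal{R}'[\varphi(x)]$ for $\mu$-almost every $x\in Z$ and $\varphi_*\mu\sim\mu'$ (same null sets). They are stably orbit equivalent (represent the same measurable dynamics) if there are Borel sets $Z\subset X$, $Z'\subset X'$ whose saturations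 have full measure such that the induced relations $\mathcal{R}|_Z$, $\mathcal{R}'|_{Z'}$ are orbit equivalent. *)

(* Defs.v *)
From HB Require Import structures.
From mathcomp Require Import all_boot all_order all_algebra.
From mathcomp Require Import all_classical all_reals all_analysis.

Set Implicit Arguments.
Unset Strict Implicit.
Unset Printing Implicit Defensive.

Import Order.TTheory GRing.Theory Num.Theory.
Import numFieldTopology.Exports.

Local Open Scope classical_set_scope.
Local Open Scope ring_scope.

(** * Graphs drawn in the Cayley graph of [int * int] *)

Definition vertex := (int * int)%type.

(* [edges G u v] means that the edge between [u] and [v] belongs to [G];
   well-formedness is the separate predicate [is_subgraph]. *)
Record graph := Graph {
  vertices : set vertex ;
  edges : vertex -> vertex -> Prop }.

Definition cayley_adj (u v : vertex) : Prop :=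
  v - u \in [:: (1, 0); (-1, 0); (0, 1); (0, -1)].

Definition is_subgraph (G : graph) : Prop :=
  forall u v, edges G u v -> [/\ cayley_adj u v, edges G v u & vertices G u].

Inductive walk (G : graph) : nat -> vertex -> vertex -> Prop :=
| walk0 u : vertices G u -> walk G 0 u u
| walkS n u v w : edges G u v -> walk G n v w -> walk G n.+1 u w.

Definition connected_graph (G : graph) : Prop :=
  forall u v, vertices G u -> vertices G v -> exists n, walk G n u v.

Definition induced_graph (A : set vertex) : graph :=
  Graph A (fun u v => [/\ A u, A v & cayley_adj u v]).

Definition gmap (f : vertex -> vertex) (G : graph) : graph :=
  Graph (f @` vertices G)
    (fun u v => exists a b, [/\ edges G a b, f a = u & f b = v]).

Definition gbigcup (I : Type) (F : I -> graph) : graph :=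
  Graph (\bigcup_i vertices (F i)) (fun u v => exists i, edges (F i) u v).

Definition gsub (G : graph) (v : vertex) : graph := gmap (fun u => u - v) G.

(** * Open balls and the metric space of infinite connected subgraphs *)

Definition path_dist (R : realType) (G : graph) (u v : vertex) : \bar R :=
  ereal_inf [set n%:R%:E | n in [set n | walk G n u v]].

(* Edges have length 1, so the open ball of integer radius [N] in the metric
   graph [G] consists of the vertices at distance [< N] and of the interiors of
   the edges having such a vertex as an endpoint. The result records these
   vertices and these edges (the latter possibly without their far endpoint, so
   that it need not be a subgraph). *)
Definition open_ball (R : realType) (G : graph) (u : vertex) (N : nat) : graph :=
  let B := [set v | (path_dist R G u v < N%:R%:E)%E] in
  Graph B (fun v w => edges G v w /\ (B v \/ B w)).

Definition pointed_subgraph (G : graph) : Prop :=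
  [/\ is_subgraph G, connected_graph G, infinite_set (vertices G)
    & vertices G 0].

(* [R] is the field in which the distance takes its values. *)
Definition tspace (R : realType) : Type := {G : graph | pointed_subgraph G}.

Definition tgraph (R : realType) (T : tspace R) : graph := sval T.

Definition agreement (R : realType) (T T' : tspace R) : \bar R :=
  let S : set (\bar R) := [set N%:R%:E | N in
    [set N | (1 <= N)%N /\
       open_ball R (tgraph T) 0 N = open_ball R (tgraph T') 0 N]] in
  if `[< S !=set0 >] then ereal_sup S else 0%E.

Definition tdist (R : realType) (T T' : tspace R) : R :=
  fine (expeR (- agreement T T')%E).

Section metric.
Variable R : realType.
Implicit Types (T : tspace R) (G : graph).

Local Notation agree N T T' :=
  (open_ball R (tgraph T) 0 N = open_ball R (tgraph T') 0 N).

Lemma open_ballP G u N v :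
  (path_dist R G u v < N%:R%:E)%E <-> exists2 n, (n < N)%N & walk G n u v.
Proof.
split=> [/ereal_inf_lt[_ [n /= w <-]]|[n nN w]].
  by rewrite lte_fin ltr_nat => nN; exists n.
apply: (@le_lt_trans _ _ (n%:R%:E)); last by rewrite lte_fin ltr_nat.
by apply: ereal_inf_lbound; exists n.
Qed.

Lemma walk_rcons G n u v w :
  is_subgraph G -> walk G n u v -> edges G v w -> walk G n.+1 u w.
Proof.
move=> sG; elim=> {n u v} [u Gu e|n u v x e _ IH e'].
  by have [_ /sG[]] := sG _ _ e => *; apply: walkS (e) _; exact: walk0.
exact: walkS e (IH e').
Qed.

Lemma walk_last G n u v : walk G n u v -> vertices G v.
Proof. by elim. Qed.

Lemma walk_cat G m n u v w : walk G m u v -> walk G n v w -> walk G (m + n) u w.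
Proof. by elim=> // {m u v} m u v x e _ IH /IH; exact: walkS. Qed.

Lemma walk_rev G n u v : is_subgraph G -> walk G n u v -> walk G n v u.
Proof.
move=> sG; elim=> {n u v} [u Gu|n u v w e _ IH]; first exact: walk0.
by apply: walk_rcons IH _ => //; have [] := sG _ _ e.
Qed.

Lemma walk_split G n u v : is_subgraph G -> walk G n.+1 u v ->
  exists2 w, walk G n u w & edges G w v.
Proof.
move=> sG /(walk_rev sG) w; inversion w as [|n' a b c e w']; subst.
by exists b; [exact: walk_rev | have [] := sG _ _ e].
Qed.

Lemma open_ball_walk T T' N n v : agree N T T' ->
  walk (tgraph T) n 0 v -> (n < N)%N -> walk (tgraph T') n 0 v.
Proof.
move=> TT'; have [sT _ _ _] := svalP T; have [sT' _ _ T'0] := svalP T'.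
elim: n v => [v w _|n IH v].
  by inversion w; subst; exact: walk0.
move=> /(walk_split sT)[u wu e] nN.
apply: (walk_rcons sT' (IH _ wu (ltnW nN))).
have : edges (open_ball R (tgraph T) 0 N) u v.
  by split=> //; left; apply/open_ballP; exists n => //; exact: ltnW.
by rewrite TT' => -[].
Qed.

Lemma agree_le T T' M N : (M <= N)%N -> agree N T T' -> agree M T T'.
Proof.
move=> MN TT'.
have BE v : (path_dist R (tgraph T) 0%R v < M%:R%:E)%E =
            (path_dist R (tgraph T') 0%R v < M%:R%:E)%E :> Prop.
  apply/propext; split=> /open_ballP[n nM w]; apply/open_ballP; exists n => //.
    exact: open_ball_walk TT' w (leq_trans nM MN).
  exact: open_ball_walk (esym TT') w (leq_trans nM MN).
have EE u v :
    (edges (tgraph T) u v /\ ((path_dist R (tgraph T) 0%R u < M%:R%:E)%E \/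
                             (path_dist R (tgraph T) 0%R v < M%:R%:E)%E)) =
    (edges (tgraph T') u v /\ ((path_dist R (tgraph T') 0%R u < M%:R%:E)%E \/
                             (path_dist R (tgraph T') 0%R v < M%:R%:E)%E)) :> Prop.
  have lift (S : tspace R) x : (path_dist R (tgraph S) 0%R x < M%:R%:E)%E ->
      (path_dist R (tgraph S) 0%R x < N%:R%:E)%E.
    by move=> /lt_le_trans; apply; rewrite lee_fin ler_nat.
  apply/propext; split=> -[e uv]; split.
  - have : edges (open_ball R (tgraph T) 0 N) u v.
      by split=> //; case: uv => /lift; [left|right].
    by rewrite TT' => -[].
  - by rewrite -!BE.
  - have : edges (open_ball R (tgraph T') 0 N) u v.
      by split=> //; case: uv => /lift; [left|right].
    by rewrite -TT' => -[].
  - by rewrite !BE.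
rewrite /open_ball; congr Graph; first exact/funext.
by apply/funext => u; apply/funext => v; exact: EE.
Qed.

Lemma agreement_ge T T' N : agree N T T' -> (N%:R%:E <= agreement T T')%E.
Proof.
case: N => [_|N TT'].
  rewrite /agreement; case: asboolP => // -[_ [n [n1 nTT'] _]].
  apply: (@le_trans _ _ n%:R%:E); first by rewrite lee_fin.
  by apply: ereal_sup_ubound; exists n.
rewrite /agreement; case: asboolP => [_|[]].
  by apply: ereal_sup_ubound; exists N.+1.
by exists N.+1%:R%:E; exists N.+1.
Qed.

Lemma agreement_ge0 T T' : (0 <= agreement T T')%E.
Proof.
rewrite /agreement; case: asboolP => // -[_ [n [n1 nTT'] _]].
apply: (@le_trans _ _ n%:R%:E); first by rewrite lee_fin.
by apply: ereal_sup_ubound; exists n.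
Qed.

Lemma agreement_gt T T' N : (N%:R%:E < agreement T T')%E -> agree N T T'.
Proof.
rewrite /agreement; case: asboolP => [_|_]; last first.
  by rewrite lte_fin ltNge ler0n.
move=> /ereal_sup_gt[_ [n [n1 nTT'] <-]]; rewrite lte_fin ltr_nat => /ltnW.
by move=> /agree_le; apply.
Qed.

Lemma agree_eq T T' : (forall N, agree N T T') -> T = T'.
Proof.
have sub (S S' : tspace R) : (forall N, agree N S S') ->
    (forall u, vertices (tgraph S) u -> vertices (tgraph S') u) /\
    (forall u v, edges (tgraph S) u v -> edges (tgraph S') u v).
  move=> SS'; have [sS cS _ S0] := svalP S.
  have wS u : vertices (tgraph S) u -> exists n, walk (tgraph S) n 0 u.
    exact: cS.
  split=> [u /wS[n w]|u v e].
    exact: walk_last (open_ball_walk (SS' n.+1) w (ltnSn n)).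
  have [_ _ /wS[n w]] := sS _ _ e.
  have : edges (open_ball R (tgraph S) 0 n.+1) u v.
    by split=> //; left; apply/open_ballP; exists n.
  by rewrite SS' => -[].
move=> TT'; have [v1 e1] := sub _ _ TT'.
have [v2 e2] := sub _ _ (fun N => esym (TT' N)).
case: T T' {TT' sub} v1 e1 v2 e2 => [[V E] P] [[V' E'] P'] /= v1 e1 v2 e2.
have VV' : V = V' by apply/seteqP; split.
have EE' : E = E'.
  apply/funext => u; apply/funext => v; apply/propext; split; [exact: e1|exact: e2].
by subst; congr exist; exact: Prop_irrelevance.
Qed.

Lemma tdistxx T : tdist T T = 0.
Proof.
rewrite /tdist; suff -> : agreement T T = +oo%E by [].
apply/eqyP => x x0; have [n xn] : exists n : nat, x <= n%:R.
  exists (Num.truncn x).+1; apply/ltW.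
  exact: truncnS_gt.
by apply: (@le_trans _ _ n%:R%:E); [rewrite lee_fin | exact: agreement_ge].
Qed.

Lemma tdist_sym T T' : tdist T T' = tdist T' T.
Proof.
rewrite /tdist /agreement.
suff -> : [set N | (1 <= N)%N /\ agree N T T'] =
          [set N | (1 <= N)%N /\ agree N T' T] by [].
by apply/seteqP; split=> N [].
Qed.

Lemma tdist_eq0 T T' : tdist T T' = 0 -> T = T'.
Proof.
move=> d0; apply: agree_eq => N; apply: agreement_gt.
move: d0 (agreement_ge0 T T'); rewrite /tdist.
case: (agreement T T') => [r| |] //=.
- by move=> r0; have := expR_gt0 (- r); rewrite r0 ltxx.
- by rewrite ltry.
Qed.

Lemma tdist_ge0 T T' : 0 <= tdist T T'.
Proof. by rewrite /tdist fine_ge0 // expeR_ge0. Qed.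

Lemma agreement_min T T' T'' :
  (mine (agreement T T') (agreement T' T'') <= agreement T T'')%E.
Proof.
have gtP S S' : (agreement T T'' < agreement S S')%E ->
    exists2 N, agree N S S' & (agreement T T'' < N%:R%:E)%E.
  rewrite [agreement S S']/agreement; case: asboolP => [_|_]; last first.
    by rewrite ltNge agreement_ge0.
  by move=> /ereal_sup_gt[_ [n [_ nS] <-] nlt]; exists n.
rewrite leNgt; apply/negP; rewrite lt_min => /andP[/gtP[m mT mlt] /gtP[n nT nlt]].
have T1 : agree (minn m n) T T' by apply: agree_le mT; rewrite geq_minl.
have T2 : agree (minn m n) T' T'' by apply: agree_le nT; rewrite geq_minr.
have := agreement_ge (etrans T1 T2); rewrite leNgt => /negP; apply.
by rewrite /minn; case: ifP.
Qed.

Lemma tdist_le T1 T1' T2 T2' :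
  (agreement T2 T2' <= agreement T1 T1')%E -> tdist T1 T1' <= tdist T2 T2'.
Proof.
move: (agreement_ge0 T1 T1') (agreement_ge0 T2 T2'); rewrite /tdist.
case: (agreement T1 T1') => [r| |] //; case: (agreement T2 T2') => [s| |] //=.
- by rewrite lee_fin ler_expR lerN2.
Qed.

Lemma tdist_triangle T' T T'' : tdist T T'' <= tdist T T' + tdist T' T''.
Proof.
have := agreement_min T T' T''; rewrite ge_min => /orP[] /tdist_le h.
- by apply: le_trans h _; rewrite lerDl tdist_ge0.
- by apply: le_trans h _; rewrite lerDr tdist_ge0.
Qed.

Definition cayley_graph : graph := induced_graph setT.

Lemma cayley_graph_walk (v : vertex) : exists n, walk cayley_graph n 0 v.
Proof.
have sG : is_subgraph cayley_graph.
  move=> u w [_ _ uw]; split=> //; split=> //; move: uw.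
  by rewrite /cayley_adj -[u - w]opprB !inE => /or4P[] /eqP ->.
have step (a d : vertex) (k : nat) :
    d \in [:: (1, 0); (-1, 0); (0, 1); (0, -1)] ->
    walk cayley_graph k a (a + d *+ k).
  move=> dE; elim: k => [|k IH]; first by rewrite mulr0n addr0; exact: walk0.
  apply: walk_rcons IH _ => //; split=> //.
  by rewrite /cayley_adj mulrSr addrA [_ + d]addrC addrK.
have walkZ (a d : vertex) (z : int) :
    d \in [:: (1, 0); (-1, 0); (0, 1); (0, -1)] ->
    exists n, walk cayley_graph n a (a + d *~ z).
  move=> dE; case: z => k; first by exists k; exact: step.
  exists k.+1; rewrite NegzE mulrNz -mulNrz; apply: step.
  by move: dE; rewrite !inE => /or4P[] /eqP ->.
have [m wm] := walkZ 0 (1, 0) v.1 isT.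
have [n wn] := walkZ (0 + (1, 0) *~ v.1) (0, 1) v.2 isT.
exists (m + n)%N; have := walk_cat wm wn.
suff -> : 0 + (1, 0) *~ v.1 + (0, 1) *~ v.2 = v by [].
have pairZ (x y z : int) : (x, y) *~ z = (x *~ z, y *~ z).
  rewrite [LHS]surjective_pairing; congr pair.
    exact: (raddfMz (@fst int int) z (x, y)).
  exact: (raddfMz (@snd int int) z (x, y)).
case: v {m n wm wn} => x y.
rewrite !pairZ /= !intz !mul0rz add0r.
have -> : (x, 0) + (0, y) = (x + 0, 0 + y) :> vertex by [].
by rewrite addr0 add0r.
Qed.

Lemma cayley_graph_pointed : pointed_subgraph cayley_graph.
Proof.
have sG : is_subgraph cayley_graph.
  move=> u w [_ _ uw]; split=> //; split=> //; move: uw.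
  by rewrite /cayley_adj -[u - w]opprB !inE => /or4P[] /eqP ->.
split=> // [u v _ _|].
  have [m wm] := cayley_graph_walk u; have [n wn] := cayley_graph_walk v.
  by exists (m + n)%N; exact: walk_cat (walk_rev sG wm) wn.
have inj : {in (fun n : nat => (n%:Z, 0) : vertex) @^-1` setT &,
    injective (fun n : nat => (n%:Z, 0) : vertex)} by move=> m n _ _ [].
by move=> /(finite_preimage inj); rewrite preimage_setT; exact: infinite_nat.
Qed.

HB.instance Definition _ := gen_eqMixin (tspace R).
HB.instance Definition _ := gen_choiceMixin (tspace R).
HB.instance Definition _ := isPointed.Build (tspace R)
  (exist _ cayley_graph cayley_graph_pointed).
HB.instance Definition _ := @isMetric.Build R (tspace R) (@tdist R)
  tdistxx tdist_eq0 tdist_sym tdist_triangle.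

End metric.

(** * The Kenyon tree and the Ghys-Kenyon minimal set *)

Definition rot90 (v : vertex) : vertex := (- v.2, v.1).

Definition haxis_end (G : graph) (v : vertex) : Prop :=
  exists w, [/\ edges G v w, forall w', edges G v w' -> w' = w,
                v.2 = 0 & w.2 = 0].

Definition prune_haxis (G : graph) : graph :=
  Graph [set v | vertices G v /\ ~ haxis_end G v]
        (fun u v => [/\ edges G u v, ~ haxis_end G u & ~ haxis_end G v]).

Definition kenyon_cross : graph :=
  gbigcup (fun b : bool =>
    if b then induced_graph [set v | `|v.1| <= 1 /\ v.2 = 0]
    else induced_graph [set v | v.1 = 0 /\ `|v.2| <= 2]).

(* The sequence starts at [T_1]: [kenyon n] is the tree $T_{n+1}$. *)
Fixpoint kenyon (n : nat) : graph :=
  if n is m.+1 then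
    prune_haxis (gbigcup (fun k : 'I_4 =>
      gmap (iter k rot90) (gmap (fun v => v + (0, 2 ^+ m.+1)) (kenyon m))))
  else kenyon_cross.

Definition kenyon_tree : graph := gbigcup kenyon.

(* For [G] an infinite connected subgraph containing 0, this is its class: all
   the graphs [G - v] with [v] a vertex of [G]. *)
Definition translates (R : realType) (G : graph) : set (tspace R) :=
  [set T | exists2 v, vertices G v & tgraph T = gsub G v].

Arguments translates R G : clear implicits.

Definition trel (R : realType) (T T' : tspace R) : Prop :=
  translates R (tgraph T) T'.

Definition ghys_kenyon (R : realType) : set (tspace R) :=
  closure (translates R kenyon_tree).

Arguments ghys_kenyon R : clear implicits.

(** * Measured relations *)

Notation borel T := (g_sigma_algebraType (@open T)).

(* The underlying space of a measured relation is given as a Borel subset [X] of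
   an ambient measurable space [T]; only the restriction to [X] of the relation
   [E] on [T] and of the measure on [T] matters. Inducing on a Borel subset
   [Z] of [X] thus amounts to replacing [X] by [Z]. *)

(* Only the values of [f] on [A] matter. *)
Definition borel_iso d d' (T : measurableType d) (T' : measurableType d')
    (A : set T) (B : set T') (f : T -> T') : Prop :=
  [/\ measurable A, measurable B, set_bij A B f, measurable_fun A f
    & forall C, measurable C -> C `<=` A -> measurable (f @` C)].

Definition class_in (T : Type) (E : T -> T -> Prop) (X : set T) (x : T) : set T :=
  [set y | X y /\ E x y].

Definition saturation (T : Type) (E : T -> T -> Prop) (X Z : set T) : set T :=
  [set y | X y /\ exists2 x, Z x & E x y].

Definition partial_transformation d (T : measurableType d) (E : T -> T -> Prop)
    (X A B : set T) (f : T -> T) : Prop :=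
  [/\ A `<=` X, B `<=` X, borel_iso A B f & forall x, A x -> E x (f x)].

Definition invariant_measure (R : realType) d (T : measurableType d)
    (mu : {measure set T -> \bar R}) (E : T -> T -> Prop) (X : set T) : Prop :=
  forall A B f, partial_transformation E X A B f ->
  forall C, measurable C -> C `<=` B -> mu (A `&` f @^-1` C) = mu C.

Definition invariant_probability (R : realType) d (T : measurableType d)
    (mu : probability T R) (E : T -> T -> Prop) (X : set T) : Prop :=
  mu X = 1%E /\ invariant_measure mu E X.

Definition orbit_equivalent (R : realType) d d'
    (T : measurableType d) (T' : measurableType d')
    (mu : {measure set T -> \bar R}) (E : T -> T -> Prop) (X : set T)
    (mu' : {measure set T' -> \bar R}) (E' : T' -> T' -> Prop) (X' : set T')
    : Prop :=
  exists (Z : set T) (Z' : set T') (f : T -> T'),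
    [/\ Z `<=` X /\ Z' `<=` X',
        saturation E X Z = Z /\ saturation E' X' Z' = Z',
        mu.-negligible (X `\` Z) /\ mu'.-negligible (X' `\` Z'),
        borel_iso Z Z' f &
        {ae mu, forall x, Z x -> f @` class_in E X x = class_in E' X' (f x)} /\
        (forall C, measurable C -> C `<=` Z' ->
           mu (Z `&` f @^-1` C) = 0%E <-> mu' C = 0%E)].

Definition stably_orbit_equivalent (R : realType) d d'
    (T : measurableType d) (T' : measurableType d')
    (mu : {measure set T -> \bar R}) (E : T -> T -> Prop) (X : set T)
    (mu' : {measure set T' -> \bar R}) (E' : T' -> T' -> Prop) (X' : set T')
    : Prop :=
  exists (Z : set T) (Z' : set T'),
    [/\ measurable Z /\ measurable Z',
        Z `<=` X /\ Z' `<=` X',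
        mu.-negligible (X `\` saturation E X Z),
        mu'.-negligible (X' `\` saturation E' X' Z') &
        orbit_equivalent mu E Z mu' E' Z'].

(** * The binary adding machine *)

(* A point [x] of [cantor_space] stands for the 2-adic integer
   $\sum_n x_n 2^n$; the sum of 2-adic integers is addition with carry. *)
Fixpoint dyadic_carry (x y : cantor_space) (n : nat) : bool :=
  if n is m.+1 then
    (x m && y m) || (dyadic_carry x y m && (x m || y m))
  else false.

Definition dyadic_add (x y : cantor_space) : cantor_space :=
  fun n => x n (+) y n (+) dyadic_carry x y n.

Definition dyadic_one : cantor_space := fun n => n == 0%N.

Definition adding_machine (x : cantor_space) : cantor_space :=
  dyadic_add x dyadic_one.

(* For a bijection [f], this is the orbit relation of the action of the integers
   generated by [f]. *)
Definition orbit_rel (T : Type) (f : T -> T) (x y : T) : Prop :=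
  exists n, iter n f x = y \/ iter n f y = x.

(* A translation-invariant Borel probability on a compact group is the Haar one. *)
Definition haar_probability (R : realType)
    (lambda : probability (borel cantor_space) R) : Prop :=
  forall (a : cantor_space) (C : set (borel cantor_space)), measurable C ->
    lambda [set x | C (dyadic_add a x)] = lambda C.

(* Main.v *)
Require Import Defs.
From HB Require Import structures.
From mathcomp Require Import all_boot all_order all_algebra.
From mathcomp Require Import all_classical all_reals all_analysis.
From mathcomp Require Import zify ring lra.

(** In the coordinates [co false w = w.1 + w.2] and [co true w = w.1 - w.2], the
    Kenyon tree is the subgraph induced on the vertices both of whose coordinates
    have the same 2-adic valuation. A point of the minimal set thus determines a
    pair of 2-adic integers (its phase), which a finite ball determines modulo
    any power of 2, and it is determined by its phase as soon as neither
    coordinate is an integer. On these generic trees the relation is the action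
    of pairs of integers by translation on pairs of 2-adic integers, i.e. tail
    equivalence of the digits, and so is the orbit relation of the adding
    machine on the interleaved digits. An invariant probability does not charge
    the non-generic trees: for [k > 0] odd, those at distance [k] from a boundary
    line are moved injectively onto those at distance [k + 2], which gives
    infinitely many disjoint sets of equal measure. On the generic trees whose
    origin has odd coordinates it is invariant under all the translations by even
    vectors, hence a multiple of the Haar measure, and the other generic trees are
    carried into these by a unit translation. *)

Set Implicit Arguments.
Unset Strict Implicit.
Unset Printing Implicit Defensive.

Import Order.TTheory GRing.Theory Num.Theory.

Local Open Scope classical_set_scope.
Local Open Scope ring_scope.

(** The lines on which a coordinate is divisible by [2 ^ n] cut the plane into self-similar squares,
    and short walks join the members of a square to its centre. These walks are what lets a finite
    ball read the phase. The first obstacle is that the graph [gph r] of a phase may be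
    disconnected. If one 2-adic coordinate is an integer, the line where the shifted coordinate
    vanishes carries at most one member, while edges change the coordinate by one: the line can cut
    the graph. For such phases membership gives vertices of the tree only inside a square around the
    origin. The second obstacle is that a translation acts on a tree only if its vector is a vertex
    of that tree. Vertices with odd shifted coordinates are always members, so an odd origin can be
    moved by every even vector; hence the special part played by odd trees. Finally, the two
    coordinates of a vertex have the same parity and the origin must be a member, so generic trees
    code only part of the Cantor space. That part meets every generic orbit of the adding machine,
    whence a stable orbit equivalence. *)

(** * Divisibility by powers of 2 *)

Definition pdvd (n : nat) (z : int) : bool := (2%:Z ^+ n %| z)%Z.

Lemma pdvdP n z : reflect (exists q, z = q * 2%:Z ^+ n) (pdvd n z).
Proof. exact: dvdzP. Qed.

Lemma pdvdD n y z : pdvd n y -> pdvd n z -> pdvd n (y + z).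
Proof. by move=> /pdvdP[p ->] /pdvdP[q ->]; apply/pdvdP; exists (p + q); lia. Qed.

Lemma pdvdN n z : pdvd n (- z) = pdvd n z.
Proof. by rewrite /pdvd !dvdzE abszN. Qed.

Lemma pdvdB n y z : pdvd n y -> pdvd n z -> pdvd n (y - z).
Proof. by move=> hy hz; apply: pdvdD => //; rewrite pdvdN. Qed.

Lemma pdvd_opp n y z : pdvd n (y - z) = pdvd n (z - y).
Proof. by rewrite -pdvdN opprB. Qed.

Lemma pdvd_trans n x y z : pdvd n (x - y) -> pdvd n (y - z) -> pdvd n (x - z).
Proof. by move=> h1 h2; have := pdvdD h1 h2; rewrite addrA subrK. Qed.

Lemma pdvd_eqr n y z : pdvd n (y - z) -> pdvd n y = pdvd n z.
Proof.
move=> h; apply/idP/idP => h'; first by have := pdvdB h' h; rewrite subKr.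
by have := pdvdD h h'; rewrite subrK.
Qed.

Lemma pdvd0 n : pdvd n 0. Proof. exact: dvdz0. Qed.

Lemma pdvd_0 z : pdvd 0 z. Proof. by apply/pdvdP; exists z; rewrite mulr1. Qed.

Lemma pdvd_le m n z : (m <= n)%N -> pdvd n z -> pdvd m z.
Proof.
move=> mn /pdvdP[q ->]; apply/pdvdP; exists (q * 2%:Z ^+ (n - m)).
by rewrite -mulrA -exprD subnK.
Qed.

Lemma pow2E n : 2%:Z ^+ n = (2 ^ n)%N%:Z.
Proof. by elim: n => // n IH; rewrite exprS IH expnS PoszM. Qed.

Lemma pow2_gt0 n : 0 < 2%:Z ^+ n. Proof. by rewrite exprn_gt0. Qed.

Lemma pdvd_small n z : pdvd n z -> `|z| < 2%:Z ^+ n -> z = 0.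
Proof.
move=> /pdvdP[q ->]; have := pow2_gt0 n; set N := 2%:Z ^+ n => N0 h.
have [->|q0] := eqVneq q 0; first by rewrite mul0r.
by exfalso; move: h; rewrite normrM (gtr0_norm N0) -[X in _ < X]mul1r ltr_pM2r //; lia.
Qed.

Lemma pdvd_pow m n : (m <= n)%N -> pdvd m (2%:Z ^+ n).
Proof. by move=> mn; apply: (pdvd_le mn); apply/pdvdP; exists 1; rewrite mul1r. Qed.

Lemma pdvd1 z : pdvd 1 z = (2 %| z)%Z. Proof. by rewrite /pdvd expr1. Qed.

Lemma pdvdSn n z : pdvd n z -> ~~ pdvd n.+1 z -> pdvd n.+1 (z - 2%:Z ^+ n).
Proof.
move=> /pdvdP[q ->] h; apply/pdvdP.
have [k [qE|qE]] : exists k, q = k * 2 \/ q = k * 2 + 1.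
  by exists (q %/ 2)%Z; lia.
- by case/negP: h; apply/pdvdP; exists k; rewrite qE exprS; lia.
- by exists k; rewrite qE exprS; lia.
Qed.

Lemma pdvdSn2 n y z : pdvd n y -> ~~ pdvd n.+1 y -> pdvd n z -> ~~ pdvd n.+1 z ->
  pdvd n.+1 (y - z).
Proof.
move=> y1 y2 z1 z2; have := pdvdB (pdvdSn y1 y2) (pdvdSn z1 z2).
by rewrite opprB addrA subrK.
Qed.

Lemma pdvd_powS n : ~~ pdvd n.+1 (2%:Z ^+ n).
Proof.
apply/negP => /pdvd_small; rewrite exprS; have := pow2_gt0 n; lia.
Qed.

(** * The coordinates [x + y] and [x - y] *)

Definition co (b : bool) (w : vertex) : int := if b then w.1 - w.2 else w.1 + w.2.

Arguments co : simpl never.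

Lemma coD b u v : co b (u + v) = co b u + co b v.
Proof. by case: b; rewrite /co /=; ring. Qed.

Lemma coN b u : co b (- u) = - co b u.
Proof. by case: b; rewrite /co /=; ring. Qed.

Lemma coB b u v : co b (u - v) = co b u - co b v.
Proof. by rewrite coD coN. Qed.

Lemma co0 b : co b 0 = 0. Proof. by case: b. Qed.

Lemma coMn b u n : co b (u *+ n) = co b u *+ n.
Proof. by elim: n => [|n IH]; rewrite ?mulr0n ?co0 // !mulrS coD IH. Qed.

Lemma co_inj u v : (forall b, co b u = co b v) -> u = v.
Proof.
case: u v => a b [c d] h; have := h false; have := h true; rewrite /co /= => h1 h2.
by congr pair; lia.
Qed.

Lemma co_onto (s : bool -> int) : (2 %| s false - s true)%Z ->
  exists w, forall b, co b w = s b.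
Proof.
move=> /dvdzP[q h]; exists (s true + q, q).
by case; rewrite /co /=; lia.
Qed.

(** Every edge changes both coordinates by one, so the four unit vectors are the four sign patterns
    [p]; [p b = true] means that coordinate [b] decreases. *)
Definition sg (b : bool) : int := if b then -1 else 1.

Definition edir (p : bool -> bool) : vertex :=
  if p false then (if p true then (-1, 0) else (0, -1))
  else (if p true then (0, 1) else (1, 0)).

Lemma co_edir p b : co b (edir p) = sg (p b).
Proof. by rewrite /edir; case: b; case: (p true); case: (p false). Qed.

Lemma edir_adj p u : cayley_adj u (u + edir p).
Proof.
rewrite /cayley_adj [u + _]addrC addrK /edir.
by case: (p true); case: (p false); rewrite !inE.
Qed.

Lemma cayley_adj_edir u v : cayley_adj u v -> exists p, v = u + edir p.
Proof.
move=> uv; suff [p pE] : exists p, v - u = edir p by exists p; rewrite -pE addrC subrK.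
move: uv; rewrite /cayley_adj !inE => /or4P[] /eqP ->.
- by exists (fun _ => false).
- by exists (fun _ => true).
- by exists (fun b => b).
- by exists (fun b => ~~ b).
Qed.

Lemma cayley_adj_sym u v : cayley_adj u v -> cayley_adj v u.
Proof.
by rewrite /cayley_adj -[u - v]opprB !inE => /or4P[] /eqP ->.
Qed.

Lemma induced_subgraph A : is_subgraph (induced_graph A).
Proof. by move=> u w [Au Aw uw]; split=> //; split=> //; exact: cayley_adj_sym. Qed.

Lemma walk_line (A : set vertex) p u n :
  (forall j, (j <= n)%N -> A (u + edir p *+ j)) ->
  walk (induced_graph A) n u (u + edir p *+ n).
Proof.
elim: n => [|n IH] h; first by rewrite mulr0n addr0; apply: walk0; have := h 0 isT; rewrite mulr0n addr0.
apply: walk_rcons (IH _) _; first exact: induced_subgraph.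
  by move=> j jn; apply: h; exact: leqW.
split; [exact: h|exact: h|].
by rewrite mulrSr addrA; exact: edir_adj.
Qed.

(** * Phases *)

(* [r b n] is the residue modulo [2 ^ n] of the 2-adic coordinate [b] of the origin. *)
Definition phase := bool -> nat -> int.

(** The residues are not normalised: phases matter only through congruences modulo [2 ^ n], so that
    translating the origin is plain addition. *)
Definition coherent (r : phase) := forall b n, pdvd n (r b n.+1 - r b n).

(** The phase of the Kenyon tree seen from its vertex [v]. *)
Definition cst_phase (v : vertex) : phase := fun b _ => co b v.

Definition level_ge (r : phase) n w := forall b, pdvd n (co b w + r b n).

(** Such a [w] is the centre of one of the squares of side [2 ^ n.+1] cut out by the lines where a
    shifted coordinate is divisible by [2 ^ n.+1]. *)
Definition level_eq (r : phase) n w :=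
  forall b, pdvd n (co b w + r b n.+1) /\ ~~ pdvd n.+1 (co b w + r b n.+1).

(** Testing divisibility by every [2 ^ n] equates the two valuations without defining them, infinite
    ones included. *)
Definition member (r : phase) : set vertex :=
  [set w | forall n, pdvd n (co false w + r false n) = pdvd n (co true w + r true n)].

Definition gph r := induced_graph (member r).

Lemma cst_coherent v : coherent (cst_phase v).
Proof. by move=> b n; rewrite /cst_phase subrr pdvd0. Qed.

Section phase.
Variable r : phase.
Hypothesis cr : coherent r.

Lemma coherent_le b m n : (m <= n)%N -> pdvd m (r b n - r b m).
Proof.
elim: n => [|n IH]; first by rewrite leqn0 => /eqP ->; rewrite subrr pdvd0.
rewrite leq_eqVlt => /orP[/eqP ->|]; first by rewrite subrr pdvd0.
by rewrite ltnS => mn; apply: pdvd_trans (IH mn); apply: (pdvd_le mn).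
Qed.

Lemma coherentE b m n z : (m <= n)%N -> pdvd m (z + r b n) = pdvd m (z + r b m).
Proof.
move=> mn; apply: pdvd_eqr; rewrite opprD addrACA subrr add0r.
exact: coherent_le.
Qed.

Lemma coherent_dvd b m n z : (m <= n)%N -> pdvd n (z + r b n) -> pdvd m (z + r b m).
Proof. by move=> mn /(pdvd_le mn); rewrite coherentE. Qed.

Lemma level_ge_le m n w : (m <= n)%N -> level_ge r n w -> level_ge r m w.
Proof. by move=> mn h b; apply: coherent_dvd mn (h b). Qed.

Lemma level_eq_ge n w : level_eq r n w -> level_ge r n w.
Proof. by move=> h b; have [h1 _] := h b; rewrite -(@coherentE b n n.+1). Qed.

Lemma level_eq_member n w : level_eq r n w -> member r w.
Proof.
move=> h k; have hk b : pdvd k (co b w + r b k) = (k <= n)%N.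
  have [h1 h2] := h b; case: (leqP k n) => kn.
    by apply: coherent_dvd (kn) _; rewrite -(@coherentE b n n.+1).
  by apply/negbTE; apply: contra h2 => /(coherent_dvd kn).
by rewrite !hk.
Qed.

(** Since [0 < j < 2 ^ n], the valuation of [j] is below that of the shifted coordinate of [u],
    hence is the valuation of the sum. It depends neither on [b] nor on [p], so a straight segment
    leaving [u] consists of members. *)
Lemma pdvd_steps n p b j u : (0 < j < 2 ^ n)%N -> pdvd n (co b u + r b n) ->
  forall k, pdvd k (co b (u + edir p *+ j) + r b k) = pdvd k j%:Z && (k <= n)%N.
Proof.
move=> jn hn k; rewrite coD coMn co_edir.
have sj m : pdvd m (sg (p b) *+ j) = pdvd m j%:Z.
  by case: (p b); rewrite /sg ?mulNrn ?pdvdN natz.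
case: (leqP k n) => kn; rewrite ?andbT ?andbF.
  rewrite -sj; apply: pdvd_eqr; rewrite addrAC addrK.
  by apply: coherent_dvd kn hn.
apply/negP => /(coherent_dvd (ltnW kn)); rewrite addrAC => h.
have := pdvdB h hn; rewrite [_ + sg _ *+ _]addrC addrK sj => /pdvd_small.
case/andP: jn => j0 jn.
have -> : `|j%:Z| < 2%:Z ^+ n by rewrite pow2E ger0_norm.
by move=> /(_ isT); lia.
Qed.

Lemma straight_walk n u p : member r u -> level_ge r n u ->
  member r (u + edir p *+ (2 ^ n)) ->
  walk (gph r) (2 ^ n) u (u + edir p *+ (2 ^ n)).
Proof.
move=> mu lu mv; apply: walk_line => j; rewrite leq_eqVlt => /orP[/eqP -> //|jn].
case: j jn => [_|j jn]; first by rewrite mulr0n addr0.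
by move=> k; rewrite !(@pdvd_steps n).
Qed.

(** Induction on squares: a straight segment leads from the centre [u] to the centre of the quadrant
    containing [w], where the argument is repeated at half the scale. The lengths form a geometric
    series. *)
Lemma walk_in_box n u w : member r u -> level_ge r n u -> member r w ->
  (forall b, `|co b w - co b u| < 2%:Z ^+ n) ->
  exists2 k, (k <= 2 ^ n)%N & walk (gph r) k w u.
Proof.
have eqwu m u' w' : level_ge r m u' -> level_ge r m w' ->
    (forall b, `|co b w' - co b u'| < 2%:Z ^+ m) -> w' = u'.
  move=> lu lw h; apply: co_inj => b; apply/eqP; rewrite -subr_eq0; apply/eqP.
  apply: pdvd_small (h b); have := pdvdB (lw b) (lu b).
  by rewrite opprD addrACA subrr addr0.
elim: n u w => [|n IH] u w mu lu mw h.
  exists 0%N => //; have <- : w = u by apply: (@eqwu 0%N) => // b; exact: pdvd_0.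
  exact: walk0.
case: (boolP (pdvd n.+1 (co false w + r false n.+1))) => lw.
  exists 0%N => //; have <- : w = u; last exact: walk0.
  by apply: eqwu (lu) _ h => -[] //; rewrite -mw.
have lw' b : ~~ pdvd n.+1 (co b w + r b n.+1) by case: b; rewrite // -mw.
(* No shifted coordinate of [w] is divisible by [2 ^ n.+1], so [w] lies in an open quadrant at [u];
   [p] names this quadrant and [u'] is its centre. *)
pose p b := co b w < co b u.
pose u' := u + edir p *+ (2 ^ n).
have cu b : co b u' = co b u + sg (p b) * 2%:Z ^+ n.
  by rewrite coD coMn co_edir -mulr_natr pow2E natz.
have lu' : level_eq r n u'.
  move=> b; rewrite cu addrAC; have /pdvdP[q ->] := lu b.
  have -> : q * 2%:Z ^+ n.+1 + sg (p b) * 2%:Z ^+ n = (q * 2 + sg (p b)) * 2%:Z ^+ n.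
    by rewrite exprS; ring.
  split; first by apply/pdvdP; exists (q * 2 + sg (p b)).
  apply/negP => /pdvdP[q']; rewrite exprS mulrA => /mulIf.
  have n0 : 2%:Z ^+ n != 0 by rewrite expf_neq0.
  by move=> /(_ n0); rewrite /sg; case: (p b); lia.
have [|||b|k kn wk] := IH u' w.
- exact: level_eq_member lu'.
- exact: level_eq_ge.
- by [].
- have ne : co b w != co b u.
    by apply: contraNneq (lw' b) => ->; exact: lu.
  rewrite cu; move: (h b) ne; rewrite /p /sg exprS.
  by move: (2%:Z ^+ n) (co b w) (co b u) => N x y; case: ifP => ? ? ?; rewrite ?mulN1r ?mul1r; lia.
exists (k + 2 ^ n)%N; first by rewrite expnS mul2n -addnn leq_add2r.
apply: (walk_cat wk); apply: walk_rev; first exact: induced_subgraph.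
apply: straight_walk => //; first by apply: level_ge_le lu.
exact: level_eq_member lu'.
Qed.

Lemma gph_connected :
  (forall w w', member r w -> member r w' -> exists n u,
     [/\ member r u, level_ge r n u, forall b, `|co b w - co b u| < 2%:Z ^+ n &
       forall b, `|co b w' - co b u| < 2%:Z ^+ n]) ->
  connected_graph (gph r).
Proof.
move=> h w w' mw mw'; have [n [u [mu lu hw hw']]] := h w w' mw mw'.
have [k _ wk] := walk_in_box mu lu mw hw.
have [k' _ wk'] := walk_in_box mu lu mw' hw'.
exists (k + k')%N; apply: walk_cat wk (walk_rev _ wk').
exact: induced_subgraph.
Qed.

(** Both valuations are 0, whatever the higher digits of the phase: odd vertices are members for
    every phase. *)
Lemma odd_member w : (forall b, ~~ pdvd 1 (co b w + r b 1)) -> member r w.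
Proof.
move=> h [|n]; first by rewrite !pdvd_0.
have hb b : pdvd n.+1 (co b w + r b n.+1) = false.
  by apply/negP => /(coherent_dvd (isT : 1 <= n.+1)%N); apply/negP.
by rewrite !hb.
Qed.

Lemma pdvd_co1 w a a' :
  pdvd 1 a = pdvd 1 a' -> pdvd 1 (co false w + a) = pdvd 1 (co true w + a').
Proof. by rewrite !pdvd1 /co => h; apply/idP/idP; lia. Qed.

Lemma gph_pointed : connected_graph (gph r) -> member r 0 -> pointed_subgraph (gph r).
Proof.
move=> cG m0; split=> //; first exact: induced_subgraph.
(* On the horizontal axis both coordinates equal the abscissa, whose parity is chosen to make the
   shifted coordinates odd. *)
pose f (n : nat) : vertex :=
  (if pdvd 1 (r false 1) then (2 * n%:Z + 1, 0) else (2 * n%:Z, 0)).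
have fm n : member r (f n).
  apply: odd_member; have := m0 1%N; rewrite !co0 !add0r => h01.
  have h : ~~ pdvd 1 (co false (f n) + r false 1).
    by rewrite /f; case: ifPn; rewrite !pdvd1 /co /=; lia.
  by case => //; rewrite -(pdvd_co1 _ h01).
have inj : injective f.
  by move=> m n; rewrite /f; case: ifP => _ [] ? ; lia.
move=> /(finite_preimage (f := f) (in2W inj)).
have -> : f @^-1` vertices (gph r) = setT by rewrite -subTset => n _; exact: fm.
exact: infinite_nat.
Qed.

End phase.

(** * Residues, squares and connectedness *)

Definition pmod (n : nat) (z : int) : int := (z %% 2%:Z ^+ n)%Z.

Lemma pmod_ge0 n z : 0 <= pmod n z.
Proof. by rewrite modz_ge0 // expf_neq0. Qed.

Lemma pmod_lt n z : pmod n z < 2%:Z ^+ n.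
Proof. exact: ltz_pmod (pow2_gt0 n). Qed.

Lemma pmodB n z : pdvd n (z - pmod n z).
Proof. by apply/pdvdP; exists (z %/ 2%:Z ^+ n)%Z; rewrite {1}(divz_eq z (2%:Z ^+ n)) addrK. Qed.

Lemma pmod_eq n y z : pdvd n (y - z) -> pmod n y = pmod n z.
Proof.
move=> h; apply/eqP; rewrite -subr_eq0; apply/eqP/(@pdvd_small n).
  have := pdvdB h (pmodB n y) ; have := pmodB n z => h1 h2.
  have := pdvdD h1 h2; congr (pdvd n _); ring.
have := pmod_ge0 n y; have := pmod_ge0 n z; have := pmod_lt n y; have := pmod_lt n z.
by move: (pmod n y) (pmod n z) => y' z'; lia.
Qed.

Lemma pmod_id n z : 0 <= z < 2%:Z ^+ n -> pmod n z = z.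
Proof. by move=> /andP[h1 h2]; rewrite /pmod modz_small // h1. Qed.

Lemma pmodE n y z : pdvd n (y - z) -> 0 <= z < 2%:Z ^+ n -> pmod n y = z.
Proof. by move=> /pmod_eq -> /pmod_id. Qed.

Lemma pmod_gt0 n z : ~~ pdvd n z -> 0 < pmod n z.
Proof.
rewrite lt_neqAle pmod_ge0 andbT; apply: contra => /eqP h.
by have := pmodB n z; rewrite -h subr0.
Qed.

Definition generic (r : phase) := forall b z, exists n, ~~ pdvd n (z + r b n).

Section box.
Variable r : phase.
Hypothesis cr : coherent r.

(* No line [co b = const] bounding a square of level [n + 1] separates [w] from the origin. *)
Definition same_tile n w := forall b,
  0 < pmod n.+1 (r b n.+1) /\
  0 < pmod n.+1 (r b n.+1) + co b w < 2%:Z ^+ n.+1.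

Lemma generic_window b (K : nat) : generic r ->
  exists n0, forall n, (n0 <= n)%N -> forall z, `|z| <= K%:Z -> ~~ pdvd n (z + r b n).
Proof.
move=> gr.
have one z : exists n0, forall n, (n0 <= n)%N -> ~~ pdvd n (z + r b n).
  have [n0 h] := gr b z; exists n0 => n n0n; apply: contra h; exact: coherent_dvd.
elim: K => [|K [n0 IH]].
  have [n0 h] := one 0; exists n0 => n n0n z; rewrite normr_le0 => /eqP ->.
  exact: h.
have [n1 h1] := one K.+1%:Z; have [n2 h2] := one (- K.+1%:Z).
exists (n0 + (n1 + n2))%N => n hn z hz.
have [->|z1] := eqVneq z K.+1%:Z; first by apply: h1; lia.
have [->|z2] := eqVneq z (- K.+1%:Z); first by apply: h2; lia.
by apply: IH; lia.
Qed.

(** A residue within [K] of either end of [[0, 2 ^ n]] would make the coordinate congruent modulo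
    [2 ^ n] to an integer of absolute value at most [K]; genericity excludes these finitely many
    integers once [n] is large. *)
Lemma generic_pmod b (K : nat) : generic r ->
  exists n0, forall n, (n0 <= n)%N -> forall z, `|z| <= K%:Z ->
    0 < pmod n (r b n) + z < 2%:Z ^+ n.
Proof.
move=> gr; have [n0 h] := generic_window b K gr; exists n0 => n n0n z zK.
have hz y : `|y| <= K%:Z -> pmod n (r b n) + y != 0 /\ pmod n (r b n) + y != 2%:Z ^+ n.
  move=> yK; have := h n n0n y yK; rewrite addrC => h1.
  have h2 : ~~ pdvd n (pmod n (r b n) + y).
    by rewrite -(pdvd_eqr (y := r b n + y)) // opprD addrACA subrr addr0 pmodB.
  by split; apply: contraNneq h2 => ->; rewrite ?pdvd0 ?pdvd_pow.
have x0 := pmod_ge0 n (r b n); have x1 := pmod_lt n (r b n).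
move: {h} hz x0 x1; set x := pmod _ _; set N := 2%:Z ^+ n => hz x0 x1.
apply/andP; split; rewrite ltNge; apply/negP => hc.
- by have [] := hz (- x) _; [lia|rewrite subrr eqxx].
- by have [] := hz (N - x) _; [lia|rewrite [x + _]addrC subrK eqxx].
Qed.

Lemma generic_same_tile (K : nat) : generic r -> exists n0, forall n, (n0 <= n)%N ->
  forall w, (forall b, `|co b w| <= K%:Z) -> same_tile n w.
Proof.
move=> gr; have [n0 h0] := generic_pmod false K gr; have [n1 h1] := generic_pmod true K gr.
exists (n0 + n1)%N => n hn w wK b.
have hb z : `|z| <= K%:Z -> 0 < pmod n.+1 (r b n.+1) + z < 2%:Z ^+ n.+1.
  by case: b; [apply: h1|apply: h0]; lia.
split; last exact: hb.
by have /andP[] : 0 < pmod n.+1 (r b n.+1) + 0 < 2%:Z ^+ n.+1;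
  [exact: hb | rewrite addr0].
Qed.

Hypothesis pr : pdvd 1 (r false 1) = pdvd 1 (r true 1).

(** Subtracting the residue leads to a corner of the square containing [w], and [2 ^ n] is half its
    side. The hypothesis [pr] gives the two target coordinates the same parity, so that they come
    from a vertex. *)
Lemma center n w : exists u, level_eq r n u /\
  forall b, co b u = co b w - pmod n.+1 (co b w + r b n.+1) + 2%:Z ^+ n.
Proof.
pose s b := co b w - pmod n.+1 (co b w + r b n.+1) + 2%:Z ^+ n.
have [u uE] : exists u, forall b, co b u = s b.
  apply: co_onto; rewrite -pdvd1.
  have h b : pdvd 1 (s b + r b n.+1 - 2%:Z ^+ n).
    have := pdvd_le (isT : 1 <= n.+1)%N (pmodB n.+1 (co b w + r b n.+1)).
    by congr pdvd; rewrite /s; ring.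
  have h1 b : pdvd 1 (s b + r b 1 - 2%:Z ^+ n).
    rewrite -(pdvd_eqr (y := s b + r b n.+1 - 2%:Z ^+ n)) //.
    by have := coherent_le cr b (isT : 1 <= n.+1)%N; congr pdvd; ring.
  have := pdvdB (h1 false) (h1 true).
  by move: pr; rewrite !pdvd1; lia.
exists u; split=> // b; rewrite uE.
have /pdvdP[q qE] := pmodB n.+1 (co b w + r b n.+1).
have -> : s b + r b n.+1 = (q * 2 + 1) * 2%:Z ^+ n.
  rewrite /s mulrDl mul1r -mulrA -exprS -qE; ring.
split; first by apply/pdvdP; exists (q * 2 + 1).
apply/negP => /pdvdP[q']; rewrite exprS mulrA => /mulIf.
have n0 : 2%:Z ^+ n != 0 by rewrite expf_neq0.
by move=> /(_ n0); lia.
Qed.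

Lemma center_box n w : (forall b, ~~ pdvd n.+1 (co b w + r b n.+1)) ->
  exists u, level_eq r n u /\ forall b, `|co b w - co b u| < 2%:Z ^+ n.
Proof.
move=> h; have [u [lu uE]] := center n w; exists u; split=> // b; rewrite uE.
have := pmod_lt n.+1 (co b w + r b n.+1); have := pmod_gt0 (h b).
by rewrite exprS; move: (co b w) (2%:Z ^+ n) (pmod _ _) => y N x; lia.
Qed.

Lemma same_tileP n w : same_tile n w -> exists u, [/\ level_eq r n u,
   forall b, `|co b 0 - co b u| < 2%:Z ^+ n & forall b, `|co b w - co b u| < 2%:Z ^+ n].
Proof.
move=> h; have [u [lu uE]] := center n 0; exists u.
split=> // b; rewrite uE co0 !add0r; have [h1 h2] := h b; move: h1 h2 (pmod_lt n.+1 (r b n.+1));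
by rewrite exprS; move: (co b w) (2%:Z ^+ n) (pmod _ _) => y N x; lia.
Qed.

Lemma generic_connected : generic r -> connected_graph (gph r).
Proof.
move=> gr; apply: gph_connected => // w w' mw mw'.
pose K := (`|co false w| + `|co true w| + (`|co false w'| + `|co true w'|))%N.
have wK b : `|co b w| <= K%:Z by rewrite /K; case: b; lia.
have wK' b : `|co b w'| <= K%:Z by rewrite /K; case: b; lia.
have [n h] := generic_same_tile K gr.
have {}h : forall w, (forall b, `|co b w| <= K%:Z) -> same_tile n w by exact: h.
have [u [lu uE]] := center n 0.
have hu x : (forall b, `|co b x| <= K%:Z) -> forall b, `|co b x - co b u| < 2%:Z ^+ n.
  move=> /h xt b; rewrite uE co0 !add0r; have [h1 h2] := xt b; move: h1 h2 (pmod_lt n.+1 (r b n.+1)).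
  by rewrite exprS; move: (co b x) (2%:Z ^+ n) (pmod _ _) => z N y; lia.
exists n, u; split; [exact: level_eq_member lu|exact: level_eq_ge|exact: hu|exact: hu].
Qed.

(** The origin lies in a square of side [2 ^ m.+2] around some [c]. That square exhausts the
    residues modulo [2 ^ m.+2] needed here, and [walk_in_box] joins both the origin and the wanted
    vertex to [c]. *)
Lemma reach m (a : bool -> int) : member r 0 ->
  (forall b, pdvd m (a b) /\ ~~ pdvd m.+1 (a b)) ->
  exists w, [/\ level_eq r m w, forall b, pdvd m.+2 (co b w + r b m.+2 - a b) &
    exists2 k, (k <= 2 ^ m.+2)%N & walk (gph r) k 0 w].
Proof.
move=> m0 ha.
have [c [mc lc hc]] : exists c, [/\ member r c, level_ge r m.+1 c &
    forall b, `|co b 0 - co b c| < 2%:Z ^+ m.+1].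
  (* If the origin lies on the dividing lines, it is interior to no square and serves itself as
     [c]. *)
  case: (boolP (pdvd m.+2 (r false m.+2))) => h.
    exists 0; split=> // b; last by rewrite subrr normr0 pow2_gt0.
    apply: (coherent_dvd cr (leqnSn m.+1)).
    by case: b; rewrite co0 add0r //; have := m0 m.+2; rewrite !co0 !add0r => <-.
  have [|c [lc hc]] := @center_box m.+1 0.
    by move=> [] //; rewrite co0 add0r //; have := m0 m.+2; rewrite !co0 !add0r => <-.
  exists c; split=> //; first exact: level_eq_member lc.
  exact: level_eq_ge.
pose D b := a b - (co b c + r b m.+2).
have hD b : pdvd m (D b) /\ ~~ pdvd m.+1 (D b).
  have [h1 h2] := ha b.
  have h3 : pdvd m.+1 (co b c + r b m.+2) by rewrite (coherentE cr) //; exact: lc.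
  split; first by apply: pdvdB => //; apply: pdvd_le h3.
  by apply: contra h2 => h4; have := pdvdD h4 h3; rewrite subrK.
pose N := 2%:Z ^+ m.+1.
(* This is the representative of [D b] in [[-N, N[]. The endpoint [-N] does not occur, since [D b]
   has valuation exactly [m]. *)
pose d b := pmod m.+2 (D b + N) - N.
have dD b : pdvd m.+2 (D b - d b).
  by have := pmodB m.+2 (D b + N); congr pdvd; rewrite /d; ring.
have dm b : pdvd m (d b) /\ ~~ pdvd m.+1 (d b).
  have [h1 h2] := hD b; rewrite -(pdvd_eqr (pdvd_le _ (dD b))); last by lia.
  by rewrite -(pdvd_eqr (pdvd_le _ (dD b))).
have dlt b : `|d b| < N.
  have [_ h2] := dm b.
  have : d b != - N by apply: contraNneq h2 => ->; rewrite pdvdN pdvd_pow.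
  have := pmod_ge0 m.+2 (D b + N); have := pmod_lt m.+2 (D b + N).
  by rewrite /d exprS -/N; move: (pmod _ _) => x; move: (N) => M; lia.
have [e eE] : exists e, forall b, co b e = d b.
  apply: co_onto; rewrite -pdvd1.
  have [h1 h2] := dm false; have [h3 h4] := dm true.
  by have := pdvdSn2 h1 h2 h3 h4; apply: pdvd_le.
pose w := c + e.
have wE b : co b w + r b m.+2 - a b = - (D b - d b).
  by rewrite /w coD eE /D; ring.
have wa b : pdvd m.+2 (co b w + r b m.+2 - a b) by rewrite wE pdvdN.
have lw : level_eq r m w.
  move=> b; have [h1 h2] := ha b.
  have e1 : pdvd m.+1 (co b w + r b m.+1 - a b).
    have := pdvdB (pdvd_le (leqnSn _) (wa b)) (cr b m.+1); congr pdvd; ring.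
  by rewrite (pdvd_eqr e1) (pdvd_eqr (pdvd_le (leqnSn m) e1)).
have mw := level_eq_member cr lw.
exists w; split=> //.
have [k1 k1m wk1] := walk_in_box cr mc lc m0 hc.
have [|k2 k2m wk2] := walk_in_box cr mc lc mw _.
  by move=> b; rewrite /w coD eE addrC addKr.
exists (k1 + k2)%N; first by rewrite expnS mul2n -addnn leq_add.
apply: walk_cat wk1 (walk_rev _ wk2); exact: induced_subgraph.
Qed.

End box.

Lemma member_parity r : member r 0 -> pdvd 1 (r false 1) = pdvd 1 (r true 1).
Proof. by move=> /(_ 1%N); rewrite !co0 !add0r. Qed.

Lemma cst_connected v : connected_graph (gph (cst_phase v)).
Proof.
apply: gph_connected (@cst_coherent v) _ => w w' _ _.
pose f b x : nat := absz (co b x + co b v).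
pose K := (f false w + f true w + (f false w' + f true w'))%N.
have KN : K%:Z < 2%:Z ^+ K by rewrite pow2E ltz_nat ltn_expl.
(* Seen from [v], the vertex [- v] is the centre of the whole Kenyon tree: its shifted coordinates
   are 0, so it has every level. *)
exists K, (- v); rewrite /cst_phase.
split=> [n||b|b]; rewrite ?coN ?opprK ?addNr //.
- by move=> b; rewrite coN addNr pdvd0.
- by apply: le_lt_trans KN; rewrite /K /f; case: b; lia.
- by apply: le_lt_trans KN; rewrite /K /f; case: b; lia.
Qed.

Lemma cst_pointed v : member (cst_phase v) 0 -> pointed_subgraph (gph (cst_phase v)).
Proof. apply: gph_pointed; [exact: cst_coherent|exact: cst_connected]. Qed.

(* If [2 ^ m] did not divide the coordinates of [v' - v], the translation by
   [v' - v] would map some vertex of the Kenyon tree close to [v] to a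
   non-vertex. *)
Lemma cst_phase_recognition m v v' :
  member (cst_phase v) 0 -> member (cst_phase v') 0 ->
  (forall k w, (k <= 2 ^ m.+1)%N -> walk (gph (cst_phase v)) k 0 w ->
     member (cst_phase v') w) ->
  forall b, pdvd m (co b v' - co b v).
Proof.
move=> mv mv'; elim: m => [|m IH] h b; first exact: pdvd_0.
have {}IH := IH (fun k w km => h k w (leq_trans km (leq_pexp2l _ (leqnSn _)))).
have {}IH : forall b, pdvd m (co b v' - co b v) by exact: IH.
pose d b := co b v' - co b v; rewrite -/(d b).
have reachP := reach (@cst_coherent v) (member_parity mv) mv.
(* Any [a] of exact valuation [m] is realised by a vertex of the first tree near its origin; as that
   vertex is also a member for [v'], the two entries of [a + d] must have the same divisibility up
   to [2 ^ m.+2]. *)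
have contra_a (a : bool -> int) : (forall b, pdvd m (a b) /\ ~~ pdvd m.+1 (a b)) ->
    (forall n, (n <= m.+2)%N -> pdvd n (a false + d false) = pdvd n (a true + d true)).
  move=> /reachP[w [_ wa [k km wk]]] n nm.
  have := h _ _ km wk n; rewrite /cst_phase.
  have e c : pdvd n (co c w + co c v') = pdvd n (a c + d c).
    apply: pdvd_eqr; apply: pdvd_le nm _; have := wa c; rewrite /cst_phase /d.
    by congr pdvd; ring.
  by rewrite !e.
case: (boolP (pdvd m.+1 (d false))) (boolP (pdvd m.+1 (d true))) => hf [] ht.
- by case: b.
(* Adding [2 ^ m] makes the entry of valuation [m] divisible by [2 ^ m.+1] and spoils the
   divisibility of the other one. *)
- exfalso; pose a (_ : bool) := 2%:Z ^+ m.
  have := contra_a a _ m.+1 (leqnSn _).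
  have am : pdvd m (2%:Z ^+ m) by rewrite pdvd_pow.
  have -> : pdvd m.+1 (a true + d true).
    have := pdvdSn (IH true) ht => h3.
    have := pdvdD h3 (pdvd_pow (leqnn m.+1)); congr pdvd.
    by rewrite /a /d exprS; ring.
  have -> : pdvd m.+1 (a false + d false) = false.
    apply/negP => h1; have := pdvdB h1 hf; rewrite addrK.
    by apply/negP; exact: pdvd_powS.
  by move=> /(_ (fun _ => conj am (pdvd_powS m))).
- exfalso; pose a (_ : bool) := 2%:Z ^+ m.
  have := contra_a a _ m.+1 (leqnSn _).
  have am : pdvd m (2%:Z ^+ m) by rewrite pdvd_pow.
  have -> : pdvd m.+1 (a false + d false).
    have := pdvdSn (IH false) hf => h3.
    have := pdvdD h3 (pdvd_pow (leqnn m.+1)); congr pdvd.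
    by rewrite /a /d exprS; ring.
  have -> : pdvd m.+1 (a true + d true) = false.
    apply/negP => h1; have := pdvdB h1 ht; rewrite addrK.
    by apply/negP; exact: pdvd_powS.
  by move=> /(_ (fun _ => conj am (pdvd_powS m))).
(* Both entries of [d] have valuation [m]; [a] is chosen so that the sums are [2 ^ m.+1] and [0],
   which only [2 ^ m.+2] tells apart. *)
- exfalso; pose a (c : bool) := (if c then 0 else 2%:Z ^+ m.+1) - d c.
  have am c : pdvd m (a c) /\ ~~ pdvd m.+1 (a c).
    have dc : pdvd m (d c) /\ ~~ pdvd m.+1 (d c) by case: c; split=> //; exact: IH.
    have e : pdvd m.+1 (a c - - d c).
      by rewrite /a opprK subrK; case: c {dc}; rewrite ?pdvd0 ?pdvd_pow.
    by rewrite (pdvd_eqr e) (pdvd_eqr (pdvd_le (leqnSn m) e)) !pdvdN.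
  have := contra_a a am m.+2 (leqnn _); rewrite /a !subrK pdvd0.
  by rewrite (negbTE (pdvd_powS m.+1)).
Qed.

(** * The Kenyon tree *)

Definition kenyon_vertex : set vertex :=
  [set w | forall n, pdvd n (co false w) = pdvd n (co true w)].

Lemma cst_memberE v w : member (cst_phase v) w = kenyon_vertex (w + v).
Proof.
rewrite /member /kenyon_vertex /cst_phase /=; apply/propext.
by split=> h n; have := h n; rewrite !coD.
Qed.

Lemma cayley_adj_co u v :
  cayley_adj u v <-> forall b, `|co b v - co b u| = 1.
Proof.
split=> [/cayley_adj_edir[p ->] b|h].
  by rewrite coD addrC addKr co_edir; case: (p b).
have [p pE] : exists p : bool -> bool, forall b, co b v = co b u + sg (p b).
  exists (fun b => co b v < co b u) => b; have := h b; rewrite /sg.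
  by case: ifP; lia.
have -> : v = u + edir p by apply: co_inj => b; rewrite coD co_edir.
exact: edir_adj.
Qed.

Lemma induced_ext (A B : set vertex) : A = B -> induced_graph A = induced_graph B.
Proof. by move=> ->. Qed.

Lemma graph_eq (G H : graph) : vertices G = vertices H ->
  (forall u v, edges G u v <-> edges H u v) -> G = H.
Proof.
case: G H => [V E] [V' E'] /= -> h; congr Graph.
by apply/funext => u; apply/funext => v; apply/propext.
Qed.

Lemma gmap_induced f A : injective f ->
  (forall u v, cayley_adj (f u) (f v) <-> cayley_adj u v) ->
  gmap f (induced_graph A) = induced_graph (f @` A).
Proof.
move=> fi fa; apply: graph_eq => //= u v; split.
  move=> [a [b [[Aa Ab ab] <- <-]]]; split; [by exists a|by exists b|exact/fa].
by move=> [[a Aa <-] [b Ab <-] /fa ab]; exists a, b.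
Qed.

Lemma co_rot90 b w : co b (rot90 w) = if b then - co false w else co true w.
Proof. by case: b; rewrite /co /rot90 /=; ring. Qed.

Lemma kenyon_vertex_edir p j : kenyon_vertex (edir p *+ j).
Proof.
move=> n; rewrite !coMn !co_edir.
have h b : pdvd n (sg (p b) *+ j) = pdvd n j%:Z.
  by case: (p b); rewrite /sg ?mulNrn ?pdvdN natz.
by rewrite !h.
Qed.

(** A zero coordinate has infinite valuation, hence so has the other one: the two lines through the
    origin carry no other vertex. *)
Lemma kenyon_vertex_co0 w b : kenyon_vertex w -> co b w = 0 -> w = 0.
Proof.
move=> kw cb; have h c n : pdvd n (co c w).
  by case: b cb => cb; case: c; rewrite ?cb ?pdvd0 //; [rewrite kw|rewrite -kw];
    rewrite cb pdvd0.
apply: co_inj => c; rewrite co0.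
apply: (@pdvd_small `|co c w|); first exact: h.
by rewrite pow2E -abszE ltz_nat ltn_expl.
Qed.

Definition tip (p : bool -> bool) (M : nat) : vertex := edir p *+ M.

(* In the paper's notation [petal m p] is the rotated copy of [T_m + (0, 2 ^ m)]
   whose axis has direction [edir p], [kenyon_part m] is [T_m], and [full_part m]
   is [T_m] before its two horizontal ends are removed. *)
Definition petal (m : nat) (p : bool -> bool) : set vertex :=
  [set w | [\/ kenyon_vertex w /\ forall b, 0 < sg (p b) * co b w < 2 ^+ m.+1, w = 0
             | w = tip p (2 ^ m.+1)]].

Definition kenyon_part (m : nat) : set vertex :=
  [set w | (kenyon_vertex w /\ forall b, `|co b w| < 2%:Z ^+ m) \/
           exists2 p, p false != p true & w = tip p (2 ^ m)].

Definition full_part (m : nat) : set vertex :=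
  [set w | (kenyon_vertex w /\ forall b, `|co b w| < 2%:Z ^+ m) \/
           exists p, w = tip p (2 ^ m)].

Lemma co_tip b p M : co b (tip p M) = sg (p b) * M%:Z.
Proof. by rewrite /tip coMn co_edir -mulr_natr natz. Qed.

Lemma edir_ext p q : p =1 q -> edir p = edir q.
Proof. by move=> h; rewrite /edir !h. Qed.

Lemma tip_ext p q M : p =1 q -> tip p M = tip q M.
Proof. by rewrite /tip => /edir_ext ->. Qed.

Lemma petal_ext m p q : p =1 q -> petal m p = petal m q.
Proof. by move=> h; have -> : p = q by apply/funext. Qed.

(** The only multiple of [2 ^ m] in this open interval is its midpoint, which is sent to [0]; every
    other point has valuation below [m] and keeps it. *)
Lemma pdvd_gap n m x : 0 < x < 2%:Z ^+ m.+1 ->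
  pdvd n (x - 2%:Z ^+ m) = if (n <= m)%N then pdvd n x else pdvd m x.
Proof.
move=> hx; case: leqP => nm.
  by apply: pdvd_eqr; rewrite addrAC subrr add0r pdvdN pdvd_pow.
apply/idP/idP.
  move=> /(pdvd_le (ltnW nm)); congr is_true; apply: pdvd_eqr.
  by rewrite addrAC subrr add0r pdvdN pdvd_pow.
move=> h; suff -> : x = 2 ^+ m by rewrite subrr pdvd0.
apply/eqP; rewrite -subr_eq0; apply/eqP/(@pdvd_small m).
  by apply: pdvdB => //; exact: pdvd_pow.
by move: hx; rewrite exprS; have := pow2_gt0 m; move: (2%:Z ^+ m) => N; lia.
Qed.

Lemma pdvd_sg n b x : pdvd n (sg b * x) = pdvd n x.
Proof. by case: b; rewrite /sg ?mulN1r ?pdvdN ?mul1r. Qed.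

Lemma pdvd_big n m x : 0 < x < 2%:Z ^+ m -> (m <= n)%N -> pdvd n x = false.
Proof.
move=> /andP[x0 xm] mn; apply/negP => /(pdvd_le mn) /pdvd_small.
by rewrite ger0_norm ?ltW // => /(_ xm) xE; rewrite xE ltxx in x0.
Qed.

Lemma kenyon_vertex_shift m p w : (forall b, 0 < sg (p b) * co b w < 2%:Z ^+ m.+1) ->
  kenyon_vertex (w - tip p (2 ^ m)) <-> kenyon_vertex w.
Proof.
move=> hw.
have e b n : pdvd n (co b (w - tip p (2 ^ m))) =
    if (n <= m)%N then pdvd n (co b w) else pdvd m (co b w).
  rewrite coB co_tip -pow2E -(pdvd_sg n (p b)) mulrBr mulrA.
  have -> : sg (p b) * sg (p b) = 1 by rewrite /sg; case: (p b).
  by rewrite mul1r pdvd_gap // !pdvd_sg.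
have e2 b n : (m < n)%N -> pdvd n (co b w) = false.
  by move=> nm; rewrite -(pdvd_sg n (p b)) (@pdvd_big _ m.+1).
split=> h n.
  case: (leqP n m) => nm; last by rewrite !e2.
  by have := h n; rewrite !e nm.
by rewrite !e; case: leqP => _; exact: h.
Qed.

(** The two vertical tips become the origin and the tip of the petal. The horizontal tips would land
    on the sides of the quadrant, where [kenyon_vertex_co0] leaves no vertex besides the origin:
    this is the effect of the pruning. *)
Lemma petal_shift m :
  (fun v : vertex => v + (0, 2 ^+ m)) @` kenyon_part m = petal m id.
Proof.
have tE : (0, 2 ^+ m) = tip id (2 ^ m).
  apply: co_inj => b; rewrite co_tip -pow2E.
  by case: b; rewrite /co /sg /=; ring.
have box b (w : vertex) : (`|co b (w - tip id (2 ^ m))| < 2%:Z ^+ m) =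
    (0 < sg b * co b w < 2%:Z ^+ m.+1).
  rewrite coB co_tip -pow2E exprS; move: (2%:Z ^+ m) (co b w) => N x.
  by case: b; rewrite /sg ?mulN1r ?mul1r; apply/idP/idP; lia.
apply/seteqP; split=> [_ [v hv <-]|w hw]; rewrite ?tE.
  case: hv => [[kv bv]|[p pp ->]].
    have h b : 0 < sg b * co b (v + tip id (2 ^ m)) < 2%:Z ^+ m.+1.
      by rewrite -box addrK.
    apply: Or31; split=> //.
    by apply/(@kenyon_vertex_shift m id) => //; rewrite addrK.
  have [p0|p0] := boolP (p false).
    apply: Or32; apply: co_inj => b; rewrite coD !co_tip co0.
    have -> : p b = ~~ b by case: b => //; move: pp; rewrite p0; case: (p true).
    by case: b; rewrite /sg /=; ring.
  apply: Or33; apply: co_inj => b; rewrite coD !co_tip.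
  have -> : p b = b by case: b; [move: pp p0; case: (p true) (p false) => -[] | case: (p false) p0].
  by rewrite expnS PoszM; ring.
exists (w - tip id (2 ^ m)); last by rewrite subrK.
case: hw => [[kw bw]|->|->].
- left; split; first exact/(@kenyon_vertex_shift m id).
  by move=> b; rewrite box; exact: bw.
- right; exists negb => //; apply: co_inj => b; rewrite coB co0 !co_tip.
  by case: b; rewrite /sg /=; ring.
- right; exists id => //; apply: co_inj => b; rewrite coB !co_tip expnS PoszM.
  by ring.
Qed.

Definition rotp (p : bool -> bool) : bool -> bool :=
  fun b => if b then ~~ p false else p true.

Lemma rot90_inj : injective rot90.
Proof. by move=> [a b] [c d] [] h ->; congr pair; lia. Qed.

Lemma rot90_adj u v : cayley_adj (rot90 u) (rot90 v) <-> cayley_adj u v.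
Proof.
rewrite !cayley_adj_co; split=> h.
  by move=> [|]; [have := h false|have := h true]; rewrite !co_rot90; lia.
by move=> [|]; rewrite !co_rot90; [have := h false|have := h true]; lia.
Qed.

Lemma rot90_tip p M : rot90 (tip p M) = tip (rotp p) M.
Proof.
apply: co_inj => -[]; rewrite co_rot90 !co_tip /rotp //=.
by rewrite /sg; case: (p false) => /=; ring.
Qed.

Lemma kenyon_vertex_rot90 w : kenyon_vertex (rot90 w) <-> kenyon_vertex w.
Proof. by split=> h n; have := h n; rewrite !co_rot90 /= pdvdN. Qed.

Lemma sg_rot90 p w b : sg (rotp p b) * co b (rot90 w) = sg (p (~~ b)) * co (~~ b) w.
Proof.
rewrite co_rot90 /rotp; case: b => //=.
by rewrite /sg; case: (p false) => /=; ring.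
Qed.

Lemma petal_rot90 m p : rot90 @` petal m p = petal m (rotp p).
Proof.
have rK w : rot90 (w.2, - w.1) = w by case: w => a b; rewrite /rot90 /= opprK.
apply/seteqP; split=> [_ [w hw <-]|w]; last first.
  rewrite -(rK w); move: (w.2, - w.1) => {}w hw; exists w => //.
  case: hw => [[/kenyon_vertex_rot90 kw bw]|h|h].
  - apply: Or31; split=> // b.
    by have := bw (~~ b); rewrite sg_rot90 negbK.
  - by apply: Or32; apply: rot90_inj; rewrite h.
  - by apply: Or33; apply: rot90_inj; rewrite h rot90_tip.
case: hw => [[kw bw]|->|->].
- apply: Or31; split; first exact/kenyon_vertex_rot90.
  by move=> b; rewrite sg_rot90.
- by apply: Or32.
- by apply: Or33; rewrite rot90_tip.
Qed.

Lemma gmap_iter_rot90 k m :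
  gmap (iter k rot90) (induced_graph (petal m id)) =
  induced_graph (petal m (iter k rotp id)).
Proof.
rewrite gmap_induced.
- apply: induced_ext; elim: k => [|k IH] /=; first by rewrite image_id.
  by rewrite -petal_rot90 -IH -image_comp.
- elim: k => // k IH u v /= /rot90_inj; exact: IH.
- elim: k => // k IH u v /=; rewrite rot90_adj; exact: IH.
Qed.

Lemma petal_sub m p : petal m p `<=` full_part m.+1.
Proof.
move=> w [[kw bw]|->|->].
- left; split=> // b; have := bw b; rewrite /sg.
  by move: (2%:Z ^+ m.+1) => N; case: (p b); rewrite ?mulN1r ?mul1r; lia.
- by left; split=> [n|b]; rewrite !co0 // normr0 pow2_gt0.
- by right; exists p.
Qed.

Lemma sub_petal m p w : full_part m.+1 w -> (forall b, 0 <= sg (p b) * co b w) ->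
  petal m p w.
Proof.
move=> [[kw bw]|[q ->]] hw; last first.
  apply: Or33; apply: tip_ext => b; have := hw b; rewrite co_tip -pow2E.
  by have := pow2_gt0 m.+1; rewrite /sg; move: (2%:Z ^+ m.+1) => N; case: (p b); case: (q b) => //; lia.
have [->|w0] := eqVneq w 0; first exact: Or32.
apply: Or31; split=> // b.
have c0 : co b w != 0 by apply: contra_neq w0; exact: kenyon_vertex_co0.
move: (bw b) (hw b) c0; rewrite /sg; move: (2%:Z ^+ m.+1) (co b w) => N x.
by case: (p b); rewrite ?mulN1r ?mul1r; lia.
Qed.

Lemma rotp_all (p : bool -> bool) : exists k : 'I_4, p =1 iter k rotp id.
Proof.
case: (boolP (p false)) (boolP (p true)) => h0 [] h1.
- by exists (inord 1) => b; rewrite inordK //=; case: b => //=; apply/idP.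
- by exists (inord 2) => b; rewrite inordK //=; case: b => //=; apply/negbTE.
- by exists (inord 0) => b; rewrite inordK //=; case: b => //=; apply/negbTE.
- by exists (inord 3) => b; rewrite inordK //=; case: b => //=; apply/negbTE.
Qed.

Lemma petals_union m :
  gbigcup (fun k : 'I_4 => induced_graph (petal m (iter k rotp id))) =
  induced_graph (full_part m.+1).
Proof.
apply: graph_eq => /=.
  apply/seteqP; split=> [w [k _]|w hw]; first exact: petal_sub.
  have [k kE] := rotp_all (fun b => co b w < 0).
  exists k => //=; rewrite -(petal_ext m kE); apply: sub_petal => // b.
  by rewrite /sg; case: ifP; rewrite ?mulN1r ?mul1r; lia.
move=> u v; split.
  by move=> [k [uk vk uv]]; split=> //; [exact: petal_sub uk|exact: petal_sub vk].
(* A coordinate changes by one along an edge, so its two values never have opposite signs; the sign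
   of their sum selects a closed quadrant containing the whole edge. *)
move=> [fu fv uv]; have [k kE] := rotp_all (fun b => co b u + co b v < 0).
have h := (cayley_adj_co _ _).1 uv.
exists k; split=> //; rewrite -(petal_ext m kE); apply: sub_petal => // b;
  by have := h b; rewrite /sg; case: ifP; rewrite ?mulN1r ?mul1r; lia.
Qed.

Lemma kenyon_vertex_haxis x : kenyon_vertex (x, 0).
Proof. by move=> n; rewrite /co /= ?addr0 ?subr0. Qed.

Lemma full_part_haxis m x : `|x| <= 2%:Z ^+ m -> full_part m (x, 0).
Proof.
move=> hx; have [xE|xN] := eqVneq `|x| (2%:Z ^+ m); last first.
  by left; split=> [|[]]; [exact: kenyon_vertex_haxis|..];
    rewrite /co /= ?addr0 ?subr0 lt_neqAle xN.
right; exists (fun _ => x < 0); apply: co_inj => b; rewrite co_tip -pow2E -xE /sg.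
by case: b; rewrite /co /=; case: ifP; lia.
Qed.

Lemma haxis_endE m v : haxis_end (induced_graph (full_part m.+1)) v <->
  exists2 p, p false = p true & v = tip p (2 ^ m.+1).
Proof.
split=> [[w [[fv fw vw] uw v2 w2]]|[p pE ->]].
  case: (fv) => [[kv bv]|[p vE]]; last first.
    exists p => //; move: v2; rewrite vE.
    have := co_tip false p (2 ^ m.+1); have := co_tip true p (2 ^ m.+1).
    rewrite -pow2E; have := pow2_gt0 m.+1; rewrite /co /sg.
    by case: (p true); case: (p false) => //; move: (2%:Z ^+ _) => N; lia.
  (* A vertex of the axis inside the square has both its horizontal neighbours in the graph, against
     the uniqueness of its neighbour. *)
  exfalso; have vE : v = (v.1, 0) by rewrite -v2 -surjective_pairing.
  have nb x : `|x - v.1| = 1 -> (x, 0) = w.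
    move=> hx; apply: uw; split=> //.
      apply: full_part_haxis; have := bv false; rewrite /co v2 addr0.
      by move: (2%:Z ^+ _) => N; lia.
    by apply/cayley_adj_co => -[]; rewrite vE /co /= ?addr0 ?subr0.
  have := nb (v.1 + 1); rewrite addrC addKr normr1 => /(_ erefl) h1.
  have := nb (v.1 - 1); rewrite addrC addKr normrN1 => /(_ erefl).
  by rewrite -h1 => -[]; lia.
have N1 : 1 < 2%:Z ^+ m.+1 by rewrite exprS; have := pow2_gt0 m; lia.
have cE b : co b (tip p (2 ^ m.+1)) = sg (p false) * 2 ^+ m.+1.
  by rewrite co_tip -pow2E; case: b; rewrite // pE.
pose x := sg (p false) * 2%:Z ^+ m.+1.
have tE : tip p (2 ^ m.+1) = (x, 0).
  by apply: co_inj => b; rewrite cE; case: b; rewrite /co /= ?addr0 ?subr0.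
exists (x - sg (p false), 0); split; rewrite ?tE //.
- split.
  + apply: full_part_haxis; rewrite /x /sg; move: (2%:Z ^+ _) N1 => N.
    by case: (p false); lia.
  + apply: full_part_haxis; rewrite /x /sg; move: (2%:Z ^+ _) N1 => N.
    by case: (p false); lia.
  + apply/cayley_adj_co => b; rewrite /x /sg.
    by case: b; case: (p false); rewrite /co /=; lia.
- move=> w [_ fw /cayley_adj_co xw].
  have xw' b : `|co b w - x| = 1.
    by have := xw b; case: b; rewrite {2}/co /= ?subr0 ?addr0.
  apply: co_inj => b.
  have -> : co b (x - sg (p false), 0) = x - sg (p false).
    by case: b; rewrite /co /= ?subr0 ?addr0.
  have := xw' b; rewrite /x /sg; case: fw => [[_ bw]|[q ->]].
    have := bw b; move: (2%:Z ^+ m.+1) (co b w) N1 => N y.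
    by case: (p false); rewrite ?mulN1r ?mul1r; lia.
  rewrite co_tip -pow2E /sg; move: (2%:Z ^+ m.+1) N1 => N.
  by case: (p false); case: (q b); rewrite ?mulN1r ?mul1r; lia.
Qed.

Lemma prune_full_part m :
  prune_haxis (induced_graph (full_part m.+1)) = induced_graph (kenyon_part m.+1).
Proof.
have E w : kenyon_part m.+1 w <->
    full_part m.+1 w /\ ~ haxis_end (induced_graph (full_part m.+1)) w.
  rewrite haxis_endE; split.
    move=> [h|[p pp wE]].
      split; first by left.
      move=> [p _ wE]; have [_ /(_ false)] := h; rewrite wE co_tip -pow2E /sg.
      by case: (p false); move: (2%:Z ^+ _) => N; lia.
    split; first by right; exists p.
    move=> [q qq]; rewrite wE => tE.
    have h b : p b = q b.
      have := congr1 (co b) tE; rewrite !co_tip -pow2E /sg.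
      have := pow2_gt0 m.+1; move: (2%:Z ^+ _) => N.
      by case: (p b); case: (q b) => //; lia.
    by move: pp; rewrite !h qq eqxx.
  move=> [[h|[p wE]] hn]; first by left.
  by right; exists p => //; apply/negP => /eqP pE; apply: hn; exists p.
apply: graph_eq => /=; first by apply/seteqP; split=> w /E.
move=> u v; split.
  by move=> [[fu fv uv] nu nv]; split=> //; apply/E.
by move=> [/E[fu nu] /E[fv nv] uv]; split.
Qed.

Lemma kenyon_crossE : kenyon_cross = induced_graph (kenyon_part 1).
Proof.
have H (w : vertex) : (`|w.1| <= 1 /\ w.2 = 0) \/ (w.1 = 0 /\ `|w.2| <= 2) <->
    kenyon_part 1 w.
  split.
    have kE (x y : int) : `|x + y| = `|x - y| -> kenyon_vertex (x, y).
      move=> h n; rewrite /co /=; have [->|->] : x + y = x - y \/ x + y = - (x - y) by lia.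
        by [].
      by rewrite pdvdN.
    case: w => x y /= [[x1 ->]|[-> y2]].
      by left; split; [apply: kE; lia|case; rewrite /co /= expr1; lia].
    have [y1|y1] : `|y| <= 1 \/ `|y| = 2 by lia.
      by left; split; [apply: kE; lia|case; rewrite /co /= expr1; lia].
    right; exists (fun b => (y < 0) (+) b); first by case: (y < 0).
    apply: co_inj => b; rewrite co_tip expn1.
    by rewrite /sg; case: (boolP (y < 0)) => hy; case: b; rewrite /co /=; lia.
  move=> [[kw bw]|[p pp ->]].
    have := bw false; have := bw true; rewrite /co expr1; lia.
  have := co_tip false p (2 ^ 1); have := co_tip true p (2 ^ 1); rewrite expn1 /sg.
  by move: pp; case: (p false); case: (p true) => // _; rewrite /co; lia.
apply: graph_eq => /=.
  apply/seteqP; split=> [w [[] _ hw]|w /H[] hw].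
  - by apply/H; left.
  - by apply/H; right.
  - by exists true.
  - by exists false.
move=> u v; split.
  by move=> [[] [hu hv uv]]; split=> //; apply/H; [left|left|right|right].
move=> [/H hu /H hv uv]; have := (cayley_adj_co _ _).1 uv => h.
have := h true; have := h false; rewrite /co => h1 h2.
have [[k1 k2]|[k1 k2]] : ((`|u.1| <= 1 /\ u.2 = 0) /\ (`|v.1| <= 1 /\ v.2 = 0)) \/
  ((u.1 = 0 /\ `|u.2| <= 2) /\ (v.1 = 0 /\ `|v.2| <= 2)) by lia.
  by exists true.
by exists false.
Qed.

Lemma kenyonE m : kenyon m = induced_graph (kenyon_part m.+1).
Proof.
elim: m => [|m IH]; first exact: kenyon_crossE.
rewrite -prune_full_part -petals_union /=; congr prune_haxis.
congr gbigcup; apply/funext => k; rewrite -gmap_iter_rot90 IH; congr gmap.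
rewrite gmap_induced ?petal_shift //; first exact: addIr.
by move=> u v; rewrite !cayley_adj_co; split=> h b; have := h b; rewrite !coD; lia.
Qed.

Lemma kenyon_treeE : kenyon_tree = induced_graph kenyon_vertex.
Proof.
rewrite /kenyon_tree; have -> : kenyon = fun m => induced_graph (kenyon_part m.+1).
  by apply/funext => m; exact: kenyonE.
have sub m : kenyon_part m `<=` kenyon_vertex.
  move=> w [[]//|[p _ ->]]; exact: kenyon_vertex_edir.
have sup u v : exists m, forall w, w \in [:: u; v] -> kenyon_vertex w -> kenyon_part m.+1 w.
  pose K := (`|co false u| + `|co true u| + (`|co false v| + `|co true v|))%N.
  have KN : K%:Z < 2%:Z ^+ K.+1.
    by rewrite pow2E ltz_nat; apply: ltn_trans (ltnSn K) (ltn_expl K.+1 _).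
  exists K => w; rewrite !inE => wE kw; left; split=> // b.
  by apply: le_lt_trans KN; rewrite /K; case: b; case/orP: wE => /eqP ->; lia.
apply: graph_eq => /=.
  apply/seteqP; split=> [w [m _ /sub]//|w kw].
  by have [m h] := sup w w; exists m => //; apply: h; rewrite ?inE ?eqxx.
move=> u v; split; first by move=> [m [/sub ku /sub kv uv]].
move=> [ku kv uv]; have [m h] := sup u v; exists m.
by split=> //; apply: h; rewrite // ?inE ?eqxx ?orbT.
Qed.

(** * Pointed subgraphs and their translates *)

(** One direction of the agreement of two balls. Stated with walks, it composes well with
    translations, and two such inclusions give back the equality of the open balls. *)
Definition follows N (G H : graph) := forall n u w,
  (n < N)%N -> walk G n 0 u -> edges G u w -> edges H u w.

Section follows.
Variable R : realType.
Implicit Types (T : tspace R).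
Local Notation agree N T T' :=
  (open_ball R (tgraph T) 0 N = open_ball R (tgraph T') 0 N).

Lemma tgraph_inj : injective (@tgraph R).
Proof. by move=> [G p] [H q] /= GH; apply: eq_exist; exact: GH. Qed.

Lemma agree_follows N T T' : agree N T T' -> follows N (tgraph T) (tgraph T').
Proof.
move=> TT' n u w nN wu e.
have : edges (open_ball R (tgraph T) 0 N) u w.
  by split=> //; left; apply/open_ballP; exists n.
by rewrite TT' => -[].
Qed.

Lemma follows_walk N T T' n u : follows N (tgraph T) (tgraph T') -> (n <= N)%N ->
  walk (tgraph T) n 0 u -> walk (tgraph T') n 0 u.
Proof.
move=> f; have [sT _ _ _] := svalP T; have [sT' _ _ T'0] := svalP T'.
elim: n u => [u _ w|n IH u nN]; first by inversion w; subst; exact: walk0.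
move=> /(walk_split sT)[v wv e].
exact: walk_rcons sT' (IH _ (ltnW nN) wv) (f _ _ _ nN wv e).
Qed.

Lemma follows_agree N T T' : follows N (tgraph T) (tgraph T') ->
  follows N (tgraph T') (tgraph T) -> agree N T T'.
Proof.
move=> f g.
have BE v : (path_dist R (tgraph T) 0%R v < N%:R%:E)%E =
            (path_dist R (tgraph T') 0%R v < N%:R%:E)%E :> Prop.
  apply/propext; split=> /open_ballP[n nN w]; apply/open_ballP; exists n => //.
    exact: follows_walk f (ltnW nN) w.
  exact: follows_walk g (ltnW nN) w.
rewrite /open_ball; congr Graph; first exact/funext.
apply/funext => u; apply/funext => v; apply/propext.
have aux (S S' : tspace R) : follows N (tgraph S) (tgraph S') ->
    edges (tgraph S) u v -> ((path_dist R (tgraph S) 0%R u < N%:R%:E)%E \/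
      (path_dist R (tgraph S) 0%R v < N%:R%:E)%E) -> edges (tgraph S') u v.
  have [sS _ _ _] := svalP S; have [sS' _ _ _] := svalP S'.
  move=> h e [] /open_ballP[n nN w]; first exact: h nN w e.
  by have [_ /(h _ _ _ nN w) /sS'[]] := sS _ _ e.
by split=> -[e /= uv]; split; rewrite ?BE // -?BE //; apply: aux e _; rewrite ?BE // -?BE.
Qed.

Lemma agree_sym N T T' : agree N T T' -> agree N T' T. Proof. exact: esym. Qed.

Lemma tspace_nbhsP T (U : set (tspace R)) :
  nbhs T U <-> exists N, forall T', agree N T T' -> U T'.
Proof.
rewrite nbhs_ballP; split=> [[e /= e0 h]|[N h]].
  pose N := (Num.truncn (- ln e)).+1.
  exists N => T' TT'; apply: h; rewrite -[ball _ _]/[set y | tdist T y < e] /=.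
  have := agreement_ge TT'; rewrite /tdist.
  have := agreement_ge0 T T'; case: (agreement T T') => [r| |] //= _.
  rewrite lee_fin => Nr; rewrite -[X in _ < X](lnK e0) ltr_expR.
  by rewrite ltrNl; apply: lt_le_trans Nr; exact: truncnS_gt.
exists (expR (- N%:R)); first by rewrite /= expR_gt0.
move=> T'; rewrite -[ball _ _]/[set y | tdist T y < _] /= => d; apply: h.
apply: agreement_gt; move: d (agreement_ge0 T T'); rewrite /tdist.
case: (agreement T T') => [r| |] //=.
  by rewrite ltr_expR ltrN2 lte_fin.
by rewrite ltry.
Qed.

Lemma walk_box G n u : is_subgraph G -> walk G n 0 u -> forall b, `|co b u| <= n%:Z.
Proof.
move=> sG; elim: n u => [u w b|n IH u]; first by inversion w; subst; rewrite co0.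
move=> /(walk_split sG)[v /IH bv /sG[/cayley_adj_co vu _ _]] b.
have := vu b; have := bv b; lia.
Qed.

Lemma gsub_walk G v n a b : walk (gsub G v) n a b <-> walk G n (a + v) (b + v).
Proof.
split.
  elim=> {n a b} [u [w Gw <-]|n u x w [c [d [e <- <-]]] _ IH].
    by rewrite subrK; exact: walk0.
  rewrite subrK; apply: walkS e _; by rewrite subrK in IH.
move aE : (a + v) => a'; move bE : (b + v) => b' w.
elim: w a b aE bE => {n a' b'} [u Gu|n u x w e _ IH] a b aE bE.
  have -> : b = a by apply: (addIr v); rewrite aE bE.
  by apply: walk0; exists u => //; rewrite -aE addrK.
apply: (@walkS _ _ _ (x - v)); last by apply: IH; rewrite ?subrK.
by exists u, x; split=> //; rewrite -aE addrK.
Qed.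

Lemma gsub_pointed G v : pointed_subgraph G -> vertices G v ->
  pointed_subgraph (gsub G v).
Proof.
move=> [sG cG iG G0] Gv; split.
- move=> u w [a [b [/sG[ab ba Ga] <- <-]]]; split.
  + by rewrite /cayley_adj opprB addrA subrK.
  + by exists b, a.
  + by exists a.
- move=> _ _ [a Ga <-] [b Gb <-]; have [n w] := cG a b Ga Gb.
  by exists n; apply/gsub_walk; rewrite !subrK.
- apply: contra_not iG => f.
  have -> : vertices G = (fun u => u + v) @` vertices (gsub G v).
    apply/seteqP; split=> [u Gu|_ [_ [u Gu <-] <-]]; last by rewrite subrK.
    by exists (u - v); [exists u|rewrite subrK].
  exact: finite_image.
- by exists v => //; rewrite subrr.
Qed.

(* The value [T] for [v] outside of [T] is junk. *)
Definition shift (v : vertex) (T : tspace R) : tspace R :=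
  match pselect (vertices (tgraph T) v) with
  | left Tv => exist _ (gsub (tgraph T) v) (gsub_pointed (svalP T) Tv)
  | right _ => T
  end.

Lemma tgraph_shift v T : vertices (tgraph T) v -> tgraph (shift v T) = gsub (tgraph T) v.
Proof. by move=> Tv; rewrite /shift; case: pselect. Qed.

Lemma gsubK G v : gsub (gsub G v) (- v) = G.
Proof.
apply: graph_eq => /=.
  apply/seteqP; split=> [_ [_ [u Gu <-] <-]|u Gu]; first by rewrite opprK subrK.
  by exists (u - v); [exists u|rewrite opprK subrK].
move=> a b; split=> [[_ [_ [[c [d [e <- <-]]] <- <-]]]|e].
  by rewrite !opprK !subrK.
by exists (a - v), (b - v); rewrite !opprK !subrK; split=> //; exists a, b.
Qed.

Lemma vertices_shift v w T : vertices (tgraph T) v ->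
  vertices (tgraph (shift v T)) w <-> vertices (tgraph T) (w + v).
Proof.
move=> Tv; rewrite tgraph_shift //=; split=> [[u Tu <-]|Tw]; first by rewrite subrK.
by exists (w + v) => //; rewrite addrK.
Qed.

Lemma vertices_shiftN v T : vertices (tgraph T) v -> vertices (tgraph (shift v T)) (- v).
Proof. by move=> Tv; apply/vertices_shift => //; rewrite addNr; have [] := svalP T. Qed.

Lemma shiftK v T : vertices (tgraph T) v -> shift (- v) (shift v T) = T.
Proof.
move=> Tv; apply: tgraph_inj; rewrite tgraph_shift; last exact: vertices_shiftN.
by rewrite tgraph_shift // gsubK.
Qed.

Lemma trelP T T' : trel T T' <-> exists2 v, vertices (tgraph T) v & T' = shift v T.
Proof.
split=> -[v Tv TE]; exists v => //; last by rewrite TE tgraph_shift.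
by apply: tgraph_inj; rewrite TE tgraph_shift.
Qed.

Lemma agree_shift N l v T T' : walk (tgraph T) l 0 v -> agree (N + l) T T' ->
  agree N (shift v T) (shift v T').
Proof.
move=> w TT'; have [sT _ _ _] := svalP T; have [sT' _ _ _] := svalP T'.
have w' := follows_walk (agree_follows TT') (leq_addl _ _) w.
have aux (S S' : tspace R) : walk (tgraph S) l 0 v -> walk (tgraph S') l 0 v ->
    agree (N + l) S S' -> follows N (tgraph (shift v S)) (tgraph (shift v S')).
  move=> {}w {}w' f n a b nN; rewrite !tgraph_shift; [|exact: walk_last w'|exact: walk_last w].
  move=> /gsub_walk; rewrite add0r => wa [c [d [e ca db]]].
  exists c, d; split=> //.
  have ca' : a + v = c by rewrite -ca subrK.
  rewrite ca' in wa; apply: (agree_follows f) (walk_cat w wa) e.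
  by rewrite addnC ltn_add2r.
by apply: follows_agree; apply: aux.
Qed.

End follows.

(** * The Ghys-Kenyon minimal set *)

Section minimal_set.
Variable R : realType.
Implicit Types (T : tspace R).
Local Notation X := (ghys_kenyon R).
Local Notation agree N T T' :=
  (open_ball R (tgraph T) 0 N = open_ball R (tgraph T') 0 N).

(** The value [point] is a default for the phases whose graph is not an infinite connected graph
    through the origin. *)
Definition gtree (r : phase) : tspace R :=
  match pselect (pointed_subgraph (gph r)) with
  | left p => exist _ (gph r) p
  | right _ => point
  end.

Lemma tgraph_gtree r : pointed_subgraph (gph r) -> tgraph (gtree r) = gph r.
Proof. by move=> p; rewrite /gtree; case: pselect. Qed.

Definition ktree (v : vertex) : tspace R := gtree (cst_phase v).

Lemma kenyon_vertex_pointed v : kenyon_vertex v -> pointed_subgraph (gph (cst_phase v)).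
Proof. by move=> kv; apply: cst_pointed; rewrite cst_memberE add0r. Qed.

Lemma tgraph_ktree v : kenyon_vertex v -> tgraph (ktree v) = gph (cst_phase v).
Proof. by move=> /kenyon_vertex_pointed; exact: tgraph_gtree. Qed.

Lemma gsub_gph r v : gsub (gph r) v = gph (fun b n => co b v + r b n).
Proof.
rewrite /gsub gmap_induced; first last.
- by move=> a b; rewrite !cayley_adj_co; split=> h c; have := h c; rewrite !coB; lia.
- exact: addIr.
apply: induced_ext; apply/seteqP; split=> [_ [u mu <-] n|u mu].
  by rewrite !coB addrA subrK addrA subrK; exact: mu n.
exists (u + v); last exact: addrK.
by move=> n; have := mu n; rewrite !coD addrA [in X in _ = X]addrA.
Qed.

Lemma shift_ktree v w : kenyon_vertex v -> kenyon_vertex (w + v) ->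
  shift w (ktree v) = ktree (w + v).
Proof.
move=> kv kw; apply: tgraph_inj.
rewrite tgraph_shift tgraph_ktree //; last first.
  by rewrite -[vertices _ _]/(member _ _) cst_memberE.
rewrite gsub_gph tgraph_ktree //; congr gph.
by apply/funext => b; apply/funext => n; rewrite /cst_phase coD.
Qed.

Lemma translates_kenyon T :
  translates R kenyon_tree T <-> exists2 v, kenyon_vertex v & T = ktree v.
Proof.
have E v : gsub kenyon_tree v = gph (cst_phase v).
  rewrite kenyon_treeE; have -> : induced_graph kenyon_vertex = gph (fun _ _ => 0).
    by apply: induced_ext; apply/seteqP; split=> w h n; have := h n; rewrite !addr0.
  rewrite gsub_gph; congr gph; apply/funext => b; apply/funext => n.
  by rewrite addr0.
split=> -[v kv TE]; exists v.
- by move: kv; rewrite kenyon_treeE.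
- by apply: tgraph_inj; rewrite TE E tgraph_ktree //; move: kv; rewrite kenyon_treeE.
- by rewrite kenyon_treeE.
- by rewrite TE tgraph_ktree.
Qed.

Lemma gkP T : X T <-> forall N, exists2 v, kenyon_vertex v & agree N T (ktree v).
Proof.
split=> [XT N|h U /tspace_nbhsP[N NU]].
  have [|T' [/translates_kenyon[v kv ->] a]] := XT [set T' | agree N T T'].
    by apply/tspace_nbhsP; exists N.
  by exists v.
have [v kv a] := h N; exists (ktree v); split; last exact: NU.
by apply/translates_kenyon; exists v.
Qed.

(** Recognising a phase modulo [2 ^ m] takes walks of length up to [2 ^ m.+1]; the successor is
    there because balls are open. *)
Definition radius m := (2 ^ m.+1).+1.

Definition near m v T := kenyon_vertex v /\ agree (radius m) T (ktree v).

Lemma radius_le m n : (m <= n)%N -> (radius m <= radius n)%N.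
Proof. by move=> mn; rewrite ltnS leq_exp2l. Qed.

Lemma near_le m n v T : (m <= n)%N -> near n v T -> near m v T.
Proof. by move=> /radius_le mn [kv a]; split=> //; exact: agree_le mn a. Qed.

Lemma near_eq m v v' T : near m v T -> near m v' T ->
  forall b, pdvd m (co b v' - co b v).
Proof.
move=> [kv a] [kv' a']; apply: cst_phase_recognition.
- by rewrite cst_memberE add0r.
- by rewrite cst_memberE add0r.
move=> k w km; rewrite -tgraph_ktree // => wk.
have := open_ball_walk (etrans (esym a) a') wk; rewrite ltnS => /(_ km) /walk_last.
by rewrite tgraph_ktree.
Qed.

(* The phase of a point of [X]; the empty choice, for [T] outside of [X], is junk. *)
Definition phase_vertex (T : tspace R) (n : nat) : vertex := xget 0 [set v | near n v T].

Definition ph (T : tspace R) : phase := fun b n => co b (phase_vertex T n).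

Lemma phase_vertexP n T : X T -> near n (phase_vertex T n) T.
Proof.
by move=> /gkP /(_ (radius n))[v kv a]; rewrite /phase_vertex; case: xgetP => [v' _ //|/(_ v)[]].
Qed.

Lemma near_ph m n v T : X T -> (n <= m)%N -> near m v T ->
  forall b, pdvd n (co b v - ph T b n).
Proof. by move=> XT nm /(near_le nm); apply: near_eq; exact: phase_vertexP. Qed.

Lemma ph_coherent T : X T -> coherent (ph T).
Proof. by move=> XT b n; apply: near_ph (phase_vertexP n.+1 XT) b. Qed.

Lemma ph_agree n T T' : X T -> X T' -> agree (radius n) T T' ->
  forall b, pdvd n (ph T' b n - ph T b n).
Proof.
move=> XT XT' TT'; have [kv a] := phase_vertexP n XT'.
by apply: (near_ph XT (leqnn n)); split=> //; exact: etrans a.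
Qed.

Lemma vertices_dist T w : vertices (tgraph T) w -> exists l, walk (tgraph T) l 0 w.
Proof. by have [_ c _ T0] := svalP T; exact: c. Qed.

Lemma gk_kenyon N T : X T -> exists2 v, kenyon_vertex v &
  agree N T (ktree v) /\ forall b n, (n <= N)%N -> pdvd n (co b v - ph T b n).
Proof.
move=> XT; have [v kv a] := (gkP T).1 XT (N + radius N)%N.
exists v => //; split; first by apply: agree_le a; exact: leq_addr.
move=> b n nN; apply: (near_ph XT nN); split=> //.
by apply: agree_le a; exact: leq_addl.
Qed.

Lemma gk_kenyon_at w T : X T -> vertices (tgraph T) w -> forall N,
  exists2 v, kenyon_vertex v & [/\ agree N (shift w T) (ktree (w + v)),
   kenyon_vertex (w + v) & forall b n, (n <= N)%N -> pdvd n (co b v - ph T b n)].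
Proof.
move=> XT /vertices_dist[l wl] N; have [v kv [a d]] := gk_kenyon (N + l) XT.
have wl' := follows_walk (agree_follows a) (leq_addl _ _) wl.
have kwv : kenyon_vertex (w + v).
  by have := walk_last wl'; rewrite tgraph_ktree //= -cst_memberE.
exists v => //; split=> //.
- by rewrite -(shift_ktree kv) //; exact: agree_shift wl a.
- by move=> b n nN; apply: d; exact: leq_trans nN (leq_addr _ _).
Qed.

Lemma gk_shift w T : X T -> vertices (tgraph T) w -> X (shift w T).
Proof.
move=> XT Tw; apply/gkP => N; have [v _ [a kv _]] := gk_kenyon_at XT Tw N.
by exists (w + v).
Qed.

Lemma ph_shift w T : X T -> vertices (tgraph T) w -> forall b n,
  pdvd n (ph (shift w T) b n - (co b w + ph T b n)).
Proof.
move=> XT Tw b n; have [v _ [a kv d]] := gk_kenyon_at XT Tw (n + radius n).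
have h : pdvd n (co b (w + v) - ph (shift w T) b n).
  apply: (near_ph (gk_shift XT Tw) (leqnn n)); split=> //.
  by apply: agree_le a; exact: leq_addl.
have := pdvdB (d b n (leq_addr _ _)) h; congr pdvd; rewrite coD; ring.
Qed.

(** Divisibility by [2 ^ n] is read off a Kenyon tree that agrees with [T] far enough to contain
    [w]. The converse can fail when a coordinate of the phase is an integer: members beyond the
    corresponding line may be cut off from the origin. *)
Lemma gk_member w T : X T -> vertices (tgraph T) w -> member (ph T) w.
Proof.
move=> XT Tw n; have [v _ [_ kv d]] := gk_kenyon_at XT Tw n.
have e b : pdvd n (co b w + ph T b n) = pdvd n (co b (w + v)).
  apply: pdvd_eqr; rewrite -pdvdN; have := d b n (leqnn n); congr pdvd.
  by rewrite coD; ring.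
by rewrite !e; exact: kv.
Qed.

Lemma gk_parity T : X T -> pdvd 1 (ph T false 1) = pdvd 1 (ph T true 1).
Proof. by move=> XT; apply/member_parity/gk_member => //; have [] := svalP T. Qed.

(** The Kenyon tree is an induced subgraph, and a ball containing both endpoints transfers this
    property to the limit trees. *)
Lemma gk_edges T u v : X T ->
  edges (tgraph T) u v <-> [/\ vertices (tgraph T) u, vertices (tgraph T) v & cayley_adj u v].
Proof.
have [sT _ _ _] := svalP T.
move=> XT; split=> [e|[Tu Tv uv]]; first by have [? /sT[] ? ? ?] := sT _ _ e.
have [l wl] := vertices_dist Tu; have [l' wl'] := vertices_dist Tv.
have [x kx a] := (gkP T).1 XT (l.+1 + l')%N.
have f := agree_follows a; have g := agree_follows (agree_sym a).
have wlx := follows_walk f (ltnW (leq_addr l' l.+1)) wl.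
have wlx' := follows_walk f (leq_addl l.+1 l') wl'.
apply: (g _ _ _ _ wlx); first by rewrite addSn ltnS leq_addr.
by rewrite tgraph_ktree //; move: (walk_last wlx) (walk_last wlx'); rewrite tgraph_ktree.
Qed.

(** A partial converse of [gk_member] that also covers non-generic trees. In a Kenyon tree with the
    same phase modulo [2 ^ n.+1], the origin and [w] are joined through the centre of their common
    square by a walk of length at most [2 ^ n.+1], which stays in the ball where [T] agrees with
    that tree. *)
Lemma same_tile_vertex T n w : X T -> same_tile (ph T) n w ->
  (forall k, (k <= n)%N ->
     pdvd k (co false w + ph T false k) = pdvd k (co true w + ph T true k)) ->
  vertices (tgraph T) w.
Proof.
move=> XT st mw; have cr := ph_coherent XT.
have [u [lu b0 bw]] := same_tileP cr (gk_parity XT) st.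
have [v kv [a d]] := gk_kenyon (radius n) XT.
have nr : (n.+1 <= radius n)%N.
  by rewrite ltnS; apply: leq_trans (ltnW (ltn_expl n.+1 (isT : 1 < 2)%N)); exact: leqnSn.
have e b k x : (k <= n.+1)%N -> pdvd k (x + cst_phase v b k) = pdvd k (x + ph T b k).
  move=> kn; apply: pdvd_eqr; have := d b k (leq_trans kn nr); congr pdvd.
  by rewrite /cst_phase; ring.
have cv := @cst_coherent v.
have lu' : level_eq (cst_phase v) n u.
  move=> b; rewrite (coherentE cv b (co b u) (leqnSn n)) !e //.
  by rewrite -(coherentE cr b (co b u) (leqnSn n)); exact: lu.
have bg b : ~~ pdvd n.+1 (co b w + ph T b n.+1).
  have [_ /andP[h1 h2]] := st b; apply/negP => h.
  have : pdvd n.+1 (pmod n.+1 (ph T b n.+1) + co b w).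
    rewrite -(pdvd_eqr (y := co b w + ph T b n.+1)) //.
    by have := pmodB n.+1 (ph T b n.+1); congr pdvd; ring.
  by move=> /pdvd_small; rewrite ger0_norm ?ltW // => /(_ h2) h3; rewrite h3 ltxx in h1.
have mv : member (cst_phase v) w.
  move=> k; case: (leqP k n) => kn; first by rewrite !e //; [exact: mw|exact: leqW..].
  have big b : pdvd k (co b w + cst_phase v b k) = false.
    apply/negP => /(coherent_dvd cv kn); rewrite e //; exact/negP.
  by rewrite !big.
have m0 : member (cst_phase v) 0 by rewrite cst_memberE add0r.
have mu := level_eq_member cv lu'; have lu2 := level_eq_ge cv lu'.
have [k kn wk] := walk_in_box cv mu lu2 mv bw.
have [k' kn' wk'] := walk_in_box cv mu lu2 m0 b0.
have w0 := walk_cat wk' (walk_rev (@induced_subgraph _) wk).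
have := agree_follows (agree_sym a); rewrite -tgraph_ktree // in w0.
move=> /follows_walk /(_ _ w0) h; apply: walk_last (h _).
by rewrite leqW // expnS mul2n -addnn leq_add.
Qed.

Lemma generic_gk T : X T -> generic (ph T) -> tgraph T = gph (ph T).
Proof.
move=> XT gT; have cr := ph_coherent XT.
have V w : vertices (tgraph T) w <-> member (ph T) w.
  split; first exact: gk_member.
  move=> mw; pose K := (`|co false w| + `|co true w|)%N.
  have [n0 /(_ n0 (leqnn _)) h] := generic_same_tile cr K gT.
  apply: same_tile_vertex XT (h w _) _; last by move=> k _; exact: mw.
  by move=> b; rewrite /K; case: b; lia.
apply: graph_eq => /=; first by apply/seteqP; split=> w /V.
move=> u v; rewrite gk_edges //; split=> -[/V hu /V hv uv]; split=> //; exact/V.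
Qed.

Section generic_gtree.
Variable r : phase.
Hypotheses (cr : coherent r) (gr : generic r) (mr : member r 0).

Lemma generic_pointed : pointed_subgraph (gph r).
Proof. by apply: gph_pointed => //; apply: generic_connected => //; exact: member_parity. Qed.

(** Some [2 ^ M] divides no shifted coordinate in the window, so membership there is decided by the
    phase modulo the powers up to [2 ^ M]. This is the continuity of [gtree] at generic phases. *)
Lemma member_window N : exists M, forall r', coherent r' ->
  (forall b n, (n <= M)%N -> pdvd n (r' b n - r b n)) ->
  forall w, (forall b, `|co b w| <= N%:Z) -> member r' w <-> member r w.
Proof.
have [n0 h0] := generic_window cr false N gr.
have [n1 h1] := generic_window cr true N gr.
exists (n0 + n1)%N => r' cr' rr' w wN.
have hN b : ~~ pdvd (n0 + n1) (co b w + r b (n0 + n1)%N).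
  by case: b; [apply: h1 (leq_addl _ _) _ (wN _)|apply: h0 (leq_addr _ _) _ (wN _)].
have e b n : (n <= n0 + n1)%N -> pdvd n (co b w + r' b n) = pdvd n (co b w + r b n).
  by move=> nM; apply: pdvd_eqr; have := rr' b n nM; congr pdvd; ring.
have e' b n : pdvd n (co b w + r' b n) = pdvd n (co b w + r b n).
  case: (leqP n (n0 + n1)) => nM; first exact: e.
  have := hN b; rewrite -e // => hN'.
  transitivity false; first by apply/negbTE; apply: contra hN' => /(coherent_dvd cr' (ltnW nM)).
  by symmetry; apply/negbTE; apply: contra (hN b) => /(coherent_dvd cr (ltnW nM)).
by split=> h n; have := h n; rewrite !e'.
Qed.

Lemma gtree_agree r' N : pointed_subgraph (gph r') ->
  (forall w, (forall b, `|co b w| <= N%:Z) -> member r' w <-> member r w) ->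
  agree N (gtree r) (gtree r').
Proof.
move=> pr' mE; have pr := generic_pointed.
have aux A B : (forall w, (forall b, `|co b w| <= N%:Z) -> A w -> B w) ->
    follows N (induced_graph A) (induced_graph B).
  move=> AB n u w nN wu [Au Aw uw].
  have bu := walk_box (@induced_subgraph A) wu.
  split=> //; apply: AB => // b; have := bu b; have := (cayley_adj_co _ _).1 uw b; lia.
by apply: follows_agree; rewrite !tgraph_gtree //; apply: aux => w /mE[].
Qed.

Lemma gtree_near N : exists2 v, kenyon_vertex v & agree N (gtree r) (ktree v) /\
  forall b n, (n <= N)%N -> pdvd n (co b v - r b n).
Proof.
have [M hM] := member_window N.
have [v vE] : exists v, forall b, co b v = r b (M + N).+1.
  apply: co_onto; rewrite -pdvd1.
  have h b : pdvd 1 (r b (M + N).+1) = pdvd 1 (r b 1).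
    by have := coherentE cr b 0 (isT : 1 <= (M + N).+1)%N; rewrite !add0r.
  by have := member_parity mr; rewrite -!h !pdvd1; lia.
have mE := hM _ (@cst_coherent v) _.
have {}mE : forall w, (forall b, `|co b w| <= N%:Z) ->
    member (cst_phase v) w <-> member r w.
  apply: mE => b n nM; rewrite /cst_phase vE; apply: coherent_le => //; lia.
have kv : kenyon_vertex v.
  by rewrite -(add0r v) -cst_memberE; apply/mE => // b; rewrite co0 normr0.
exists v => //; split; last first.
  by move=> b n nN; rewrite vE; apply: coherent_le => //; lia.
exact: gtree_agree (kenyon_vertex_pointed kv) mE.
Qed.

Lemma gtree_gk : X (gtree r).
Proof. by apply/gkP => N; have [v kv [a _]] := gtree_near N; exists v. Qed.

Lemma ph_gtree b n : pdvd n (ph (gtree r) b n - r b n).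
Proof.
have [v kv [a d]] := gtree_near (n + radius n).
have h : pdvd n (co b v - ph (gtree r) b n).
  apply: (near_ph gtree_gk (leqnn n)); split=> //; apply: agree_le a; exact: leq_addl.
have := pdvdB (d b n (leq_addr _ _)) h; congr pdvd; ring.
Qed.

End generic_gtree.

Lemma gk_odd_even_vertices T : X T -> ~~ pdvd 1 (ph T false 1) -> forall w,
  generic (ph T) -> (forall b, pdvd 1 (co b w)) -> vertices (tgraph T) w.
Proof.
move=> XT oT w gT ew; rewrite generic_gk //=; apply: odd_member => //; first exact: ph_coherent.
move=> b; rewrite addrC -(pdvd_eqr (y := ph T b 1)).
  by case: b => //; rewrite -gk_parity.
by rewrite opprD addNKr pdvdN.
Qed.

(** The neighbours of an even origin are odd, hence members. The edge is read off a Kenyon tree on a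
    small ball, so that non-generic trees are covered too. *)
Lemma gk_even_neighbour T : X T -> pdvd 1 (ph T false 1) -> vertices (tgraph T) (1, 0).
Proof.
move=> XT eT; have [v kv [a d]] := gk_kenyon 2 XT.
have ev b : pdvd 1 (co b v).
  rewrite (pdvd_eqr (d b 1%N isT)); case: b => //; by rewrite -gk_parity.
have f := agree_follows (agree_sym a).
have [sT _ _ _] := svalP T.
suff e : edges (tgraph T) 0 (1, 0) by have [_ /sT[]] := sT _ _ e.
apply: (f 0%N) => //; first by apply: walk0; have [] := svalP (ktree v).
rewrite tgraph_ktree //; split; last by apply/cayley_adj_co => -[].
  by rewrite -[_ 0]/(member _ _) cst_memberE add0r.
apply: odd_member (@cst_coherent v) _ _ => b; rewrite /cst_phase.
have := ev b; rewrite !pdvd1; case: b; rewrite /co /=; lia.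
Qed.

End minimal_set.

(** * Binary digits *)

Definition bval (x : nat -> bool) (n : nat) : int :=
  \sum_(i < n) (x i : nat)%:Z * 2%:Z ^+ i.

Lemma bvalS x n : bval x n.+1 = bval x n + (x n : nat)%:Z * 2%:Z ^+ n.
Proof. by rewrite /bval big_ord_recr. Qed.

Lemma bval0 x : bval x 0 = 0. Proof. by rewrite /bval big_ord0. Qed.

Lemma bval_itv x n : 0 <= bval x n < 2%:Z ^+ n.
Proof.
elim: n => [|n]; first by rewrite bval0 expr0.
rewrite bvalS exprS; move: (bval x n) (2%:Z ^+ n) => y N.
by case: (x n); rewrite ?mul1r ?mul0r; lia.
Qed.

Lemma bval_coherent x n : pdvd n (bval x n.+1 - bval x n).
Proof. by rewrite bvalS addrC addKr; apply/pdvdP; eexists. Qed.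

Lemma bval_eqP x y n : (forall i, (i < n)%N -> x i = y i) <-> bval x n = bval y n.
Proof.
split=> [xy|].
  by rewrite /bval; apply: eq_bigr => i _; rewrite xy.
elim: n => [//|n IH]; rewrite !bvalS => h.
have {h} [h hn] : bval x n = bval y n /\ x n = y n.
  move: h (bval_itv x n) (bval_itv y n); move: (bval x n) (bval y n) (2%:Z ^+ n) => a b N.
  by case: (x n); case: (y n); rewrite ?mul1r ?mul0r => h1 h2 h3; split=> //; lia.
by move=> i; rewrite ltnS leq_eqVlt => /orP[/eqP ->|] //; exact: IH.
Qed.

Lemma bval_pdvd x y n : pdvd n (bval x n - bval y n) <-> bval x n = bval y n.
Proof.
split=> [/pdvd_small h|->]; last by rewrite subrr pdvd0.
apply/eqP; rewrite -subr_eq0; apply/eqP/h.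
move: (bval_itv x n) (bval_itv y n); move: (bval x n) (bval y n) (2%:Z ^+ n) => a b N; lia.
Qed.

Lemma bval_inj x y : (forall n, pdvd n (bval x n - bval y n)) -> x = y.
Proof.
by move=> h; apply/funext => i; apply: ((bval_eqP x y i.+1).2 ((bval_pdvd _ _ _).1 (h _))).
Qed.

(** Digit [i] is the leading bit of the residue modulo [2 ^ i.+1]. *)
Definition bits (s : nat -> int) (i : nat) : bool := 2%:Z ^+ i <= pmod i.+1 (s i.+1).

Lemma bval_bits s : (forall n, pdvd n (s n.+1 - s n)) ->
  forall n, bval (bits s) n = pmod n (s n).
Proof.
move=> cs; elim=> [|n IH].
  by rewrite bval0; symmetry; apply: pmodE; rewrite ?expr0 //; exact: pdvd_0.
rewrite bvalS IH /bits.
have h : pdvd n (pmod n.+1 (s n.+1) - pmod n (s n)).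
  have h1 := pdvd_le (leqnSn n) (pmodB n.+1 (s n.+1)).
  have h2 := pmodB n (s n); have := pdvdB (pdvdD (cs n) h2) h1.
  by congr pdvd; ring.
have := pmod_lt n.+1 (s n.+1); have := pmod_ge0 n.+1 (s n.+1).
have := pmod_lt n (s n); have := pmod_ge0 n (s n).
case/pdvdP: h; rewrite exprS; have := pow2_gt0 n.
move: (pmod n.+1 _) (pmod n _) (2%:Z ^+ n) => a b N N0 q qE h1 h2 h3 h4.
have [q0|q1] : q = 0 \/ q = 1 by nia.
  by rewrite q0 mul0r in qE; rewrite leNgt (_ : a < N) //=; lia.
by rewrite q1 in qE; rewrite (_ : N <= a) //=; lia.
Qed.

Lemma pdvd_bits s n : (forall n, pdvd n (s n.+1 - s n)) -> pdvd n (bval (bits s) n - s n).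
Proof. by move=> cs; rewrite bval_bits // pdvd_opp pmodB. Qed.

(** * The Cantor space as the space of pairs of 2-adic integers *)

(** Interleaving: the digits of even index form the coordinate [false], those of odd index the
    coordinate [true]. *)
Definition dig (g : cantor_space) : phase := fun b => bval (fun i => g (i.*2 + b)%N).

Definition enc (r : phase) : cantor_space := fun i => bits (r (odd i)) i./2.

Lemma dig_coherent g : coherent (dig g).
Proof. by move=> b n; exact: bval_coherent. Qed.

Lemma dig_enc r : coherent r -> forall b n, pdvd n (dig (enc r) b n - r b n).
Proof.
move=> cr b n; rewrite /dig (_ : (fun i => _) = bits (r b)); first exact: pdvd_bits.
apply/funext => i; rewrite /enc addnC oddD odd_double addbF oddb.
by congr bits; rewrite halfD odd_double andbF add0n doubleK; case: b.
Qed.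

Lemma dig_inj g g' : (forall b n, pdvd n (dig g b n - dig g' b n)) -> g = g'.
Proof.
move=> h; apply/funext => i; have := bval_inj (h (odd i)) => /(congr1 (fun f => f i./2)).
by rewrite addnC odd_double_half.
Qed.

Lemma enc_eq r r' : coherent r -> coherent r' ->
  (forall b n, pdvd n (r b n - r' b n)) -> enc r = enc r'.
Proof.
move=> cr cr' h; apply: dig_inj => b n; apply: pdvd_trans (dig_enc cr b n) _.
by apply: pdvd_trans (h b n) _; rewrite pdvd_opp dig_enc.
Qed.

Lemma enc_dig g : enc (dig g) = g.
Proof. by apply: dig_inj => b n; exact/dig_enc/dig_coherent. Qed.

Definition agree_upto (n : nat) (x y : nat -> bool) := forall i, (i < n)%N -> x i = y i.

Lemma dig_agree n g g' : agree_upto n.*2 g g' -> forall b, dig g b n = dig g' b n.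
Proof.
move=> h b; apply/bval_eqP => i ni; apply: h.
by rewrite -(ltn_double i n) in ni; case: b; rewrite ?addn0 // addn1 -doubleS leq_double; move: ni; rewrite ltn_double.
Qed.

(** Digit [i] reads [r (odd i)] at rank [m = i./2.+1], where [m.*2 + odd i = i.+2]; for [i < n] this
    is at most [n.+1]. *)
Lemma enc_agree n (r r' : phase) : (forall (b : bool) m, (m.*2 + b <= n.+1)%N -> pdvd m (r b m - r' b m)) ->
  agree_upto n (enc r) (enc r').
Proof.
move=> h i ni; rewrite /enc /bits; congr (_ <= _); apply: pmod_eq; apply: h.
by rewrite doubleS; have := odd_double_half i; lia.
Qed.

Definition cylinder (n : nat) (g : cantor_space) : set cantor_space :=
  [set g' | agree_upto n g' g].

Lemma cantor_nbhsP (g : cantor_space) (U : set cantor_space) :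
  nbhs g U <-> exists n, cylinder n g `<=` U.
Proof.
pose F := filter_from (@setT nat) (fun n => cylinder n g).
have FF : Filter F.
  apply: filter_from_filter; first by exists 0%N.
  move=> i j _ _; exists (maxn i j) => // g' h.
  by split=> k ki; apply: h; rewrite leq_max ki ?orbT.
split=> [|[n]].
  have : F --> g.
    apply/cvg_sup => i A /= [B [[C oC <-] /= Cg] BA].
    by exists i.+1 => // g' h; apply: BA => /=; rewrite h.
  by move=> h /h [n _ ?]; exists n.
move=> h; apply: filterS h _.
elim: n => [|n IH]; first by apply: (@filterS _ _ _ setT); [move=> ? _ //|exact: filterT].
have : nbhs g [set g' : cantor_space | g' n = g n].
  apply: (@proj_continuous _ (fun _ : nat => bool) n g [set b | b = g n]).
  exact: (@discrete_set1 bool).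
move=> /(filterI IH); apply: filterS => g' [h1 h2] i.
by rewrite ltnS leq_eqVlt => /orP[/eqP -> //|]; exact: h1.
Qed.

Lemma local_open n (U : set cantor_space) :
  (forall g g', agree_upto n g g' -> U g -> U g') -> open U.
Proof.
move=> h; rewrite openE => g Ug; apply/cantor_nbhsP; exists n => g' gg'.
by apply: h Ug => i ni; rewrite gg'.
Qed.

Lemma open_cylinder n g : open (cylinder n g).
Proof.
by apply: (@local_open n) => g' g'' h h' i ni; rewrite -h // h'.
Qed.

Lemma measurable_open (T : ptopologicalType) (U : set (borel T)) :
  @open T U -> measurable U.
Proof. by move=> oU; exact: sub_sigma_algebra. Qed.

Lemma measurable_local n (U : set (borel cantor_space)) :
  (forall g g', agree_upto n g g' -> U g -> U g') -> measurable U.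
Proof. by move=> /local_open; exact: (@measurable_open cantor_space). Qed.

Definition cylinders : set (set (borel cantor_space)) :=
  [set A | A = set0 \/ exists n g, A = cylinder n g].

Definition prefix_point (s : seq bool) : cantor_space := nth false s.

Lemma cylinder_prefix n g : cylinder n g = cylinder n (prefix_point (mkseq g n)).
Proof.
by apply/seteqP; split=> g' h i ni; rewrite h // /prefix_point nth_mkseq.
Qed.

(** There are countably many cylinders, one for each finite word, so every open set is a countable
    union of them. *)
Lemma borel_cantorE : @measurable _ (borel cantor_space) = <<s cylinders >>.
Proof.
apply/seteqP; split; last first.
  apply: smallest_sub; first exact: sigma_algebra_measurable.
  move=> _ [->|[n [g ->]]]; first exact: measurable0.
  by apply: measurable_open; exact: open_cylinder.
apply: smallest_sub; first exact: smallest_sigma_algebra.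
move=> U oU.
have -> : U = \bigcup_(k : nat) (if unpickle k is Some s then
    (if `[< cylinder (size s) (prefix_point s) `<=` U >]
     then cylinder (size s) (prefix_point s) else set0) else set0).
  apply/seteqP; split=> [g Ug|g [k _]]; last first.
    by case: (unpickle k) => // s; case: asboolP => // h /h.
  have /cantor_nbhsP[n nU] : nbhs g U by move: oU; rewrite openE => /(_ g Ug).
  exists (pickle (mkseq g n)) => //; rewrite pickleK size_mkseq -cylinder_prefix.
  by case: asboolP.
apply: (@bigcup_measurable _ (g_sigma_algebraType cylinders)) => k _.
move: (pmap _ _) => s; case: asboolP => _; last exact: measurable0.
by apply: sub_sigma_algebra; right; exists (size s), (prefix_point s).
Qed.

Lemma setI_cylinders : setI_closed cylinders.
Proof.
move=> A B [->|[n [g ->]]]; first by rewrite set0I => _; left.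
move=> [->|[m [g' ->]]]; first by rewrite setI0; left.
wlog nm : n m g g' / (n <= m)%N.
  move=> h; case: (leqP n m) => [nm|/ltnW mn]; first exact: h.
  by rewrite setIC; exact: h.
have [[x [xg xg']]|h] := pselect (exists x, cylinder n g x /\ cylinder m g' x).
  right; exists m, g'; apply/seteqP; split=> [y []//|y yg']; split=> // i ni.
  by rewrite yg' -?xg' -?xg //; exact: leq_trans ni nm.
by left; rewrite -subset0 => x [xg xg']; apply: h; exists x.
Qed.

Lemma cantor_measure_unique (R : realType)
    (m1 m2 : {measure set (borel cantor_space) -> \bar R}) :
  (m1 setT < +oo)%E -> (forall n g, m1 (cylinder n g) = m2 (cylinder n g)) ->
  forall A, measurable A -> m1 A = m2 A.
Proof.
move=> m1oo h A mA.
have cT : cylinder 0 (fun _ => false) = setT by apply/seteqP; split.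
apply: (measure_unique cylinders (fun _ => setT)) mA => //.
- exact: borel_cantorE.
- exact: setI_cylinders.
- by move=> _; right; exists 0%N, (fun _ => false); rewrite cT.
- by apply/seteqP; split=> // x _; exists 0%N.
- by move=> _ [->|[n [g ->]]]; rewrite ?measure0.
Qed.

Lemma measurable_fun_borel d (aT : measurableType d) (T : ptopologicalType)
    (D : set aT) (f : aT -> borel T) :
  (forall U : set T, open U -> measurable (D `&` f @^-1` U)) -> measurable_fun D f.
Proof.
move=> h; apply: (@measurability _ _ aT (borel T) D f (@open T)) => //.
by move=> _ [U oU <-]; exact: h.
Qed.

(** * The Haar measure of the Cantor group *)

Section coin.
Variable R : realType.

(** The Haar measure is built as the law of the binary digits of a uniform point of [[0, 1[], for
    which a cylinder of length [n] corresponds to a dyadic interval of length [2 ^- n]. *)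
Definition binary_digits (x : R) : cantor_space :=
  fun i => odd (Num.truncn (x * 2 ^+ i.+1)).

(** The most significant digit comes first, as in real expansions, contrary to [bval]. *)
Fixpoint prefix_value (g : nat -> bool) (n : nat) : nat :=
  if n is m.+1 then ((prefix_value g m).*2 + g m)%N else 0%N.

Lemma prefix_value_lt g n : (prefix_value g n < 2 ^ n)%N.
Proof. by elim: n => //= n IH; rewrite expnS; case: (g n); lia. Qed.

Lemma truncn_half (x : R) : 0 <= x -> (Num.truncn (x * 2))./2 = Num.truncn x.
Proof.
move=> x0; apply/eqP; rewrite eq_sym truncn_eq //.
have /truncn_itv : 0 <= x * 2 by rewrite mulr_ge0.
set m := Num.truncn _; rewrite -{1 2}(odd_double_half m) => /andP[h1 h2].
apply/andP; split.
  rewrite -(ler_pM2r (ltr0Sn R 1)); apply: le_trans h1.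
  by rewrite -natrM ler_nat; lia.
rewrite -(ltr_pM2r (ltr0Sn R 1)); apply: lt_le_trans h2 _.
by rewrite -natrM ler_nat; case: (odd m); lia.
Qed.

Lemma truncn_pow (x : R) n : 0 <= x < 1 ->
  Num.truncn (x * 2 ^+ n) = prefix_value (binary_digits x) n.
Proof.
move=> /andP[x0 x1]; elim: n => [|n IH] /=.
  by apply: truncn_def; rewrite expr0 mulr1 x0.
have h : (Num.truncn (x * 2 ^+ n.+1))./2 = Num.truncn (x * 2 ^+ n).
  by rewrite exprSr mulrA truncn_half // mulr_ge0 // exprn_ge0.
by rewrite -IH -h addnC /binary_digits odd_double_half.
Qed.

Lemma prefix_value_inj g g' n :
  prefix_value g n = prefix_value g' n <-> agree_upto n g g'.
Proof.
elim: n => [//|n IH] /=; split.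
  move=> h; have [h1 h2] : prefix_value g n = prefix_value g' n /\ g n = g' n.
    by case: (g n) (g' n) h => -[] h; split=> //; lia.
  by move=> i; rewrite ltnS leq_eqVlt => /orP[/eqP -> //|]; exact: (IH.1 h1).
move=> h; rewrite h // (IH.2 _) // => i ni; exact/h/ltnW.
Qed.

Local Notation I01 := (`[0, 1[%classic : set (measurableTypeR R)).

Lemma binary_digits_cylinder n g :
  I01 `&` binary_digits @^-1` cylinder n g =
  `[(prefix_value g n)%:R / 2 ^+ n, (prefix_value g n).+1%:R / 2 ^+ n[%classic.
Proof.
have N0 : (0 : R) < 2 ^+ n by rewrite exprn_gt0.
apply/seteqP; split=> x /=; rewrite !in_itv /=.
  move=> [x01 /prefix_value_inj xg]; rewrite -xg -truncn_pow //.
  case/andP: (x01) => x0 _.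
  have /truncn_itv : 0 <= x * 2 ^+ n by rewrite mulr_ge0 // ltW.
  by rewrite ler_pdivrMr // ltr_pdivlMr.
rewrite ler_pdivrMr // ltr_pdivlMr // => h.
have x01 : 0 <= x < 1.
  case/andP: h => h1 h2; rewrite -(pmulr_lge0 _ N0) (le_trans _ h1) //=.
  rewrite -(ltr_pM2r N0) mul1r (lt_le_trans h2) //.
  by rewrite -natrX ler_nat prefix_value_lt.
split=> //; apply/prefix_value_inj; rewrite -truncn_pow //; exact: truncn_def.
Qed.

Lemma measurable_I01 : measurable I01. Proof. exact: measurable_itv. Qed.

Definition lebesgue_I01 : {measure set (measurableTypeR R) -> \bar R} :=
  mrestr (@lebesgue_measure R) measurable_I01.

Lemma lebesgue_I01T : lebesgue_I01 setT = 1%E.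
Proof.
rewrite -[LHS]/(lebesgue_measure (setT `&` I01)) setTI.
by have -> := @lebesgue_measure_itv R `[0, 1[; rewrite /= lte_fin ltr01 oppr0 adde0.
Qed.

Definition lebesgue01 : probability (measurableTypeR R) R := mnormalize lebesgue_I01 point.

Lemma lebesgue01E A : lebesgue01 A = lebesgue_measure (A `&` I01).
Proof.
rewrite /lebesgue01 /= /mnormalize lebesgue_I01T.
by rewrite onee_eq0 /= invr1 mule1.
Qed.

(** The default value outside [I01] is harmless, as [lebesgue01] does not charge that set. *)
Definition restricted_digits (x : measurableTypeR R) : borel cantor_space :=
  if x \in I01 then binary_digits x else point.

Lemma measurable_restricted_digits : measurable_fun setT restricted_digits.
Proof.
apply: (@measurability _ _ _ _ setT _ cylinders); first exact: borel_cantorE.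
move=> _ [_ [->|[n [g ->]]] <-]; first by rewrite preimage_set0 setI0; exact: measurable0.
rewrite setTI.
have -> : restricted_digits @^-1` cylinder n g =
    (I01 `&` binary_digits @^-1` cylinder n g) `|`
    (~` I01 `&` [set _ | cylinder n g point]).
  rewrite /restricted_digits; apply/seteqP; split=> x /=.
    case: ifPn => [|]; rewrite ?inE ?notin_setE => xI h; [by left|by right].
  case=> -[xI h]; first by rewrite mem_set.
  by rewrite memNset.
apply: measurableU; first by rewrite binary_digits_cylinder; exact: measurable_itv.
apply: measurableI; first exact: measurableC.
have [h|h] := pselect (cylinder n g point).
  by rewrite (_ : [set _ | _] = setT) //; apply/seteqP; split.
by rewrite (_ : [set _ | _] = set0) //; apply/seteqP; split.
Qed.

HB.instance Definition _ :=
  isMeasurableFun.Build _ _ _ _ restricted_digits measurable_restricted_digits.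

Definition coin : probability (borel cantor_space) R :=
  distribution lebesgue01 (restricted_digits : {mfun _ >-> _}).

Lemma coin_cylinder n g : coin (cylinder n g) = ((2 ^- n : R)%:E)%E.
Proof.
rewrite /coin /= /distribution /pushforward /= lebesgue01E.
have -> : restricted_digits @^-1` cylinder n g `&` I01 =
    I01 `&` binary_digits @^-1` cylinder n g.
  rewrite setIC; apply/seteqP; split=> x /= [xI];
  by rewrite /restricted_digits mem_set.
rewrite binary_digits_cylinder lebesgue_measure_itv /= lte_fin.
have N0 : (0 : R) < 2 ^+ n by rewrite exprn_gt0.
rewrite ltr_pM2r ?invr_gt0 // ltr_nat ltnSn -EFinD; congr EFin.
by rewrite -mulrBl -natrB // subSnn mul1r.
Qed.

End coin.

Lemma pushforward_ex d d' (T : measurableType d) (T' : measurableType d') (R : realType)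
    (m : {measure set T -> \bar R}) (f : T -> T') : measurable_fun setT f ->
  exists m' : {measure set T' -> \bar R}, forall A, m' A = m (f @^-1` A).
Proof.
move=> mf; exists (measure_function_pushforward__canonical__measure_function_Measure m mf).
by [].
Qed.

Lemma cantor_law_unique (R : realType) d1 d2 (T1 : measurableType d1) (T2 : measurableType d2)
    (m1 : {measure set T1 -> \bar R}) (m2 : {measure set T2 -> \bar R})
    (f1 : T1 -> borel cantor_space) (f2 : T2 -> borel cantor_space) :
  measurable_fun setT f1 -> measurable_fun setT f2 -> (m1 setT < +oo)%E ->
  (forall n g, m1 (f1 @^-1` cylinder n g) = m2 (f2 @^-1` cylinder n g)) ->
  forall A, measurable A -> m1 (f1 @^-1` A) = m2 (f2 @^-1` A).
Proof.
move=> mf1 mf2 m1oo h A mA.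
have [m1' m1E] := pushforward_ex m1 mf1; have [m2' m2E] := pushforward_ex m2 mf2.
rewrite -m1E -m2E; apply: cantor_measure_unique mA; first by rewrite m1E preimage_setT.
by move=> n g; rewrite m1E m2E.
Qed.

(** * Isometries of the Cantor space *)

Definition cantor_isometry (f : cantor_space -> cantor_space) :=
  forall n g g', agree_upto n g g' <-> agree_upto n (f g) (f g').

Lemma agree_upto_sym n x y : agree_upto n x y -> agree_upto n y x.
Proof. by move=> h i ni; rewrite h. Qed.

Lemma agree_upto_trans n y x z : agree_upto n x y -> agree_upto n y z -> agree_upto n x z.
Proof. by move=> h h' i ni; rewrite h ?h'. Qed.

Lemma isometry_measurable f : cantor_isometry f ->
  measurable_fun setT (f : borel cantor_space -> borel cantor_space).
Proof.
move=> hf; apply: (@measurability _ _ _ _ setT _ cylinders); first exact: borel_cantorE.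
move=> _ [_ [->|[n [g ->]]] <-]; first by rewrite preimage_set0 setI0; exact: measurable0.
rewrite setTI; apply: (@measurable_local n) => x y xy.
by move=> h; apply: agree_upto_trans h; apply: (hf _ _ _).1; exact: agree_upto_sym.
Qed.

(** The map [F] induced on the finite set of words of length [n] is injective, hence onto; so the
    word of [g] has a preimage. *)
Lemma isometry_cylinder f n g : cantor_isometry f ->
  exists h, f @^-1` cylinder n g = cylinder n h.
Proof.
move=> hf.
pose F (t : n.-tuple bool) : n.-tuple bool := [tuple f (prefix_point t) i | i < n].
have Fi : injective F.
  move=> s t st; apply: eq_from_tnth => i.
  have h : agree_upto n (prefix_point s) (prefix_point t).
    apply: (hf _ _ _).2 => j jn; have := congr1 (fun u => tnth u (Ordinal jn)) st.
    by rewrite !tnth_mktuple.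
  by have := h i (ltn_ord i); rewrite /prefix_point -!tnth_nth.
have [t tE] : exists t, F t = [tuple g i | i < n].
  by have [F' _ FK] := injF_bij Fi; exists (F' [tuple g i | i < n]).
have ft : agree_upto n (f (prefix_point t)) g.
  move=> j jn; have := congr1 (fun u => tnth u (Ordinal jn)) tE.
  by rewrite !tnth_mktuple.
exists (prefix_point t); apply/seteqP; split=> x xh.
  by apply: (hf _ _ _).2; apply: agree_upto_trans xh (agree_upto_sym ft).
by apply: agree_upto_trans ft; exact: (hf _ _ _).1.
Qed.

Lemma isometry_coin (R : realType) f (A : set (borel cantor_space)) :
  cantor_isometry f -> measurable A -> coin R (f @^-1` A) = coin R A.
Proof.
move=> hf mA.
apply: (@cantor_law_unique R _ _ _ _ (coin R) (coin R) f id) mA => //.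
- exact: isometry_measurable.
- by apply: le_lt_trans (probability_le1 _ _) _; rewrite ?ltry.
move=> n g; have [h ->] := isometry_cylinder n g hf.
exact: etrans (coin_cylinder R n h) (esym (coin_cylinder R n g)).
Qed.

(** * The adding machine *)

Lemma bval_dyadic_add a x n :
  bval a n + bval x n =
  bval (dyadic_add a x) n + (dyadic_carry a x n : nat)%:Z * 2%:Z ^+ n.
Proof.
elim: n => [|n IH]; first by rewrite !bval0 mul0r.
rewrite !bvalS /= addrACA IH /dyadic_add exprS.
move: (bval (fun _ => _) n) (2%:Z ^+ n) => y N.
by case: (a n); case: (x n); case: (dyadic_carry a x n) => /=; ring.
Qed.

Lemma pdvd_dyadic_add a x n :
  pdvd n (bval (dyadic_add a x) n - (bval a n + bval x n)).
Proof.
rewrite bval_dyadic_add opprD addrA subrr add0r pdvdN; apply/pdvdP; by eexists.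
Qed.

Lemma agree_upto_bval n x y : agree_upto n x y <-> pdvd n (bval x n - bval y n).
Proof. by rewrite bval_pdvd -bval_eqP. Qed.

Lemma dyadic_add_isometry a : cantor_isometry (dyadic_add a).
Proof.
move=> n g g'; rewrite !agree_upto_bval.
suff -> : pdvd n (bval (dyadic_add a g) n - bval (dyadic_add a g') n) =
  pdvd n (bval g n - bval g' n) by [].
apply: pdvd_eqr.
have := pdvdB (pdvd_dyadic_add a g n) (pdvd_dyadic_add a g' n); congr pdvd; ring.
Qed.

Lemma coin_haar (R : realType) : haar_probability (coin R).
Proof. by move=> a C mC; apply: isometry_coin => //; exact: dyadic_add_isometry. Qed.

Lemma pdvd_adding_machine x n : pdvd n (bval (adding_machine x) n - (bval x n + 1)).
Proof.
have one : pdvd n (bval dyadic_one n - 1).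
  case: n => [|n]; first exact: pdvd_0.
  suff -> : bval dyadic_one n.+1 = 1 by rewrite subrr pdvd0.
  elim: n => [|n IH]; first by rewrite bvalS bval0.
  by rewrite bvalS IH mul0r addr0.
have := pdvdD (pdvd_dyadic_add x dyadic_one n) one; congr pdvd.
rewrite -/(adding_machine x); ring.
Qed.

Lemma pdvd_iter_adding_machine k x n :
  pdvd n (bval (iter k adding_machine x) n - (bval x n + k%:Z)).
Proof.
elim: k => [|k IH] /=; first by rewrite addr0 subrr pdvd0.
have := pdvdD (pdvd_adding_machine (iter k adding_machine x) n) IH; congr pdvd.
by rewrite intS; ring.
Qed.

(** * Integer translations and tail equivalence *)

Definition int_diff (z : int) (x y : nat -> bool) := forall n, pdvd n (bval x n + z - bval y n).

Lemma iter_adding_machineE k x y : iter k adding_machine x = y <-> int_diff k%:Z x y.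
Proof.
split=> [<- n|h]; first by rewrite pdvd_opp pdvd_iter_adding_machine.
apply: bval_inj => n; have := pdvdD (pdvd_iter_adding_machine k x n) (h n).
by congr pdvd; ring.
Qed.

Lemma int_diffN z x y : int_diff z x y -> int_diff (- z) y x.
Proof. by move=> h n; rewrite -pdvdN; have := h n; congr pdvd; ring. Qed.

Lemma orbit_relE x y : orbit_rel adding_machine x y <-> exists z, int_diff z x y.
Proof.
split=> [[k [/iter_adding_machineE h|/iter_adding_machineE /int_diffN h]]|[z h]].
- by exists k%:Z.
- by exists (- k%:Z).
case: (leP 0 z) => z0; exists `|z|%N.
  by left; apply/iter_adding_machineE; rewrite gez0_abs.
by right; apply/iter_adding_machineE; rewrite ltz0_abs //; exact: int_diffN.
Qed.

Definition tail_eq (x y : nat -> bool) := exists N, forall i, (N <= i)%N -> x i = y i.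

Lemma tail_eq_int_diff x y : tail_eq x y -> exists z, int_diff z x y.
Proof.
move=> [N h]; exists (bval y N - bval x N) => n.
have big m : (N <= m)%N -> bval x m + (bval y N - bval x N) - bval y m = 0.
  elim: m => [|m IH]; first by rewrite leqn0 => /eqP ->; ring.
  rewrite leq_eqVlt => /orP[/eqP <-|]; first by ring.
  rewrite ltnS => Nm; rewrite !bvalS h // -(IH Nm); ring.
case: (leqP N n) => [/big ->|nN]; first exact: pdvd0.
have hx := coherent_le (r := fun _ => bval x) (fun _ => bval_coherent x) true (ltnW nN).
have hy := coherent_le (r := fun _ => bval y) (fun _ => bval_coherent y) true (ltnW nN).
by have := pdvdB hy hx; congr pdvd; ring.
Qed.

Definition not_integer (x : nat -> bool) := forall z, exists n, ~~ pdvd n (z + bval x n).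

(** The residues of a non-integer end up farther than [|z|] from both [0] and [2 ^ n], so adding [z]
    eventually produces no carry and leaves the higher digits alone. *)
Lemma int_diff_tail_eq z x y : not_integer x -> int_diff z x y -> tail_eq x y.
Proof.
move=> nx xy.
have cx : coherent (fun _ => bval x) by move=> _; exact: bval_coherent.
have [n0 h] := generic_pmod cx true `|z|%N (fun _ => nx).
have e n : (n0 <= n)%N -> bval y n = bval x n + z.
  move=> /h /(_ z); rewrite pmod_id ?bval_itv // => /(_ (lexx _)) hz.
  have := pdvd_small (xy n); move: hz (bval_itv y n).
  move: (bval x n) (bval y n) (2%:Z ^+ n) => a b N; lia.
exists n0 => i n0i; have := e i.+1 (leqW n0i); rewrite !bvalS e //.
have := pow2_gt0 i; move: (bval x i) (2%:Z ^+ i) => a N.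
by case: (x i); case: (y i); rewrite ?mul1r ?mul0r => //; lia.
Qed.

(** Here [x] is the integer [- z], whose digits are eventually 1 if it is negative and eventually 0
    otherwise. *)
Lemma integer_tail x z : (forall n, pdvd n (z + bval x n)) -> exists c, tail_eq x (fun _ => c).
Proof.
move=> h; pose M := `|z|%N; exists (0 < z).
have e n : (M < n)%N -> bval x n = if 0 < z then 2%:Z ^+ n - z else - z.
  move=> Mn; have zn : `|z| < 2%:Z ^+ n.
    by rewrite pow2E -abszE ltz_nat; apply: ltn_trans Mn _; exact: ltn_expl.
  case: ifP => z0.
    have : pdvd n (z + bval x n - 2 ^+ n) by apply: pdvdB => //; exact: pdvd_pow.
    move=> /pdvd_small; move: zn (bval_itv x n); move: (bval x n) (2%:Z ^+ n) => a N; lia.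
  have := pdvd_small (h n); move: zn (bval_itv x n); move: (bval x n) (2%:Z ^+ n) => a N; lia.
exists M.+1 => i Mi; have := e i.+1 (leqW Mi); rewrite bvalS e // exprS.
have := pow2_gt0 i; move: (2%:Z ^+ i) => N.
by case: ifP; case: (x i); rewrite ?mul1r ?mul0r => //; lia.
Qed.

Lemma tail_cst_integer x c : tail_eq x (fun _ => c) -> exists z, forall n, pdvd n (z + bval x n).
Proof.
move=> /tail_eq_int_diff[z h].
have bc n : bval (fun _ => c) n = if c then 2%:Z ^+ n - 1 else 0.
  elim: n => [|n IH]; first by rewrite bval0; case: c {h}.
  by rewrite bvalS IH exprS; case: c {h IH} => /=; ring.
exists (if c then z + 1 else z) => n; have := h n; rewrite bc; case: c {h bc}.
  by move=> /pdvdD /(_ (pdvd_pow (leqnn n))); congr pdvd; ring.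
by congr pdvd; ring.
Qed.

Definition digit_seq (b : bool) (g : cantor_space) : nat -> bool := fun i => g (i.*2 + b)%N.

Lemma tail_eq_digit_seq g g' :
  tail_eq g g' <-> forall b, tail_eq (digit_seq b g) (digit_seq b g').
Proof.
split=> [[N h] b|h].
  exists N => i Ni; apply: h; lia.
have [N hN] := h false; have [M hM] := h true.
exists (N + M).*2 => i; rewrite -(odd_double_half i) [(odd i + _)%N]addnC => hi.
by case: (odd i) hi => hi; [apply: hM|apply: hN]; lia.
Qed.

(** Both sides amount to tail equivalence, which is compatible with interleaving. The point [g] is
    itself not an integer: an integer has a constant tail, and so would have its digit
    subsequences. *)
Lemma orbit_rel_dig g g' : generic (dig g) ->
  orbit_rel adding_machine g g' <->
  exists a : bool -> int, forall b n, pdvd n (dig g b n + a b - dig g' b n).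
Proof.
move=> gg.
have nb b : not_integer (digit_seq b g) by exact: gg b.
have ng : not_integer g.
  move=> z; apply: contrapT => /forallNP h.
  have [|c /tail_eq_digit_seq /(_ true) t] := @integer_tail g z.
    by move=> n; apply/negPn/negP; exact: h.
  have [z' hz] := @tail_cst_integer (digit_seq true g) c t.
  by have [n /negP] := nb true z'; apply; exact: hz.
rewrite orbit_relE; split=> [[z h]|[a h]].
  have t := (tail_eq_digit_seq _ _).1 (int_diff_tail_eq ng h).
  have [a0 h0] := tail_eq_int_diff (t false); have [a1 h1] := tail_eq_int_diff (t true).
  by exists (fun b => if b then a1 else a0) => -[].
apply: tail_eq_int_diff; apply/tail_eq_digit_seq => b.
exact: int_diff_tail_eq (nb b) (h b).
Qed.

(** * Translations by pairs of integers *)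

Definition trans (a : bool -> int) (g : cantor_space) : cantor_space :=
  enc (fun b n => dig g b n + a b).

Lemma trans_coherent a g : coherent (fun b n => dig g b n + a b).
Proof. by move=> b n; have := dig_coherent g b n; congr pdvd; ring. Qed.

Lemma dig_trans a g b n : pdvd n (dig (trans a g) b n - (dig g b n + a b)).
Proof. by have := dig_enc (@trans_coherent a g) b n. Qed.

Lemma transK a : cancel (trans a) (trans (fun b => - a b)).
Proof.
move=> g; apply: dig_inj => b n.
have := pdvdD (dig_trans (fun b => - a b) (trans a g) b n) (dig_trans a g b n).
by congr pdvd; ring.
Qed.

Lemma trans_eq a g g' : (forall b n, pdvd n (dig g b n + a b - dig g' b n)) -> trans a g = g'.
Proof.
by move=> h; apply: dig_inj => b n; have := pdvdD (dig_trans a g b n) (h b n); congr pdvd; ring.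
Qed.

Lemma trans_agree a n g g' : agree_upto n g g' -> agree_upto n (trans a g) (trans a g').
Proof.
move=> h; rewrite /trans.
apply: enc_agree => b m hm.
rewrite opprD addrACA subrr addr0.
apply/bval_pdvd/bval_eqP => i im; apply: h; lia.
Qed.

Lemma trans_isometry a : cantor_isometry (trans a).
Proof.
move=> n g g'; split; first exact: trans_agree.
by move=> /(trans_agree (fun b => - a b)); rewrite !transK.
Qed.

(** * Measurability in the minimal set *)

Section coding.
Variable R : realType.
Implicit Types (T : tspace R).
Local Notation X := (ghys_kenyon R).
Local Notation bT := (borel (tspace R)).
Local Notation bC := (borel cantor_space).
Local Notation agree N T T' :=
  (open_ball R (tgraph T) 0 N = open_ball R (tgraph T') 0 N).

Lemma tspace_open (U : set (tspace R)) :
  (forall T, U T -> exists N, forall T', agree N T T' -> U T') -> open U.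
Proof. by move=> h; rewrite openE => T /h /tspace_nbhsP. Qed.

Lemma measurable_gk : measurable (X : set bT).
Proof.
rewrite -[X]setCK; apply: measurableC; apply: measurable_open.
by apply: closed_openC; exact: closed_closure.
Qed.

Lemma measurable_local_gk (A : set (tspace R)) : A `<=` X ->
  (forall T, A T -> exists N, forall T', X T' -> agree N T T' -> A T') ->
  measurable (A : set bT).
Proof.
move=> AX h.
pose U : set (tspace R) := [set T' | exists T N, [/\ A T,
  forall T', X T' -> agree N T T' -> A T' & agree N T T']].
have -> : A = X `&` U.
  apply/seteqP; split=> [T AT|T' [XT' [T [N [AT hN a]]]]]; last exact: hN.
  by split; [exact: AX|have [N hN] := h T AT; exists T, N].
apply: measurableI; first exact: measurable_gk.
apply: measurable_open; apply: tspace_open => T' [T [N [AT hN a]]].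
by exists N => T'' a'; exists T, N; split=> //; exact: etrans a a'.
Qed.

Definition psi (T : tspace R) : cantor_space := enc (ph T).

Lemma dig_psi T : X T -> forall b n, pdvd n (dig (psi T) b n - ph T b n).
Proof. by move=> XT; exact/dig_enc/ph_coherent. Qed.

Lemma psi_agree n T T' : X T -> X T' -> agree (radius n.+1) T T' ->
  agree_upto n (psi T) (psi T').
Proof.
move=> XT XT' a; apply: enc_agree => b m bm; rewrite pdvd_opp; apply: ph_agree => //.
by apply: agree_le a; apply: radius_le; lia.
Qed.

Lemma measurable_psi : measurable_fun (X : set bT) (psi : bT -> bC).
Proof.
apply: measurable_fun_borel => U oU; apply: measurable_local_gk => [T []//|T [XT UT]].
have /cantor_nbhsP[n nU] : nbhs (psi T) U by move: oU; rewrite openE; apply.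
exists (radius n.+1) => T' XT' a; split=> //; apply: nU.
exact/agree_upto_sym/psi_agree.
Qed.

Lemma measurable_psi_preimage (A : set bT) (E : set bC) : measurable A -> A `<=` X ->
  measurable E -> measurable (A `&` psi @^-1` E).
Proof.
move=> mA AX mE; rewrite -(setIidl AX) -setIA; apply: measurableI => //.
by apply: measurable_psi => //; exact: measurable_gk.
Qed.

Lemma open_vertex v : open [set T : tspace R | vertices (tgraph T) v].
Proof.
apply: tspace_open => T /vertices_dist[l w]; exists l => T' a.
exact: walk_last (follows_walk (agree_follows a) (leqnn l) w).
Qed.

Lemma measurable_shift v :
  measurable_fun ([set T | vertices (tgraph T) v] : set bT) (shift v : bT -> bT).
Proof.
apply: measurable_fun_borel => U oU; apply: measurable_open.
apply: tspace_open => T [Tv UT].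
have /tspace_nbhsP[N NU] : nbhs (shift v T) U by move: oU; rewrite openE; apply.
have [l w] := vertices_dist Tv; exists (N + l)%N => T' a; split.
  exact: walk_last (follows_walk (agree_follows a) (leq_addl _ _) w).
by apply: NU; exact: agree_shift w a.
Qed.

Lemma shift_image v (A : set bT) : A `<=` [set T | vertices (tgraph T) v] ->
  shift v @` A = [set T | vertices (tgraph T) (- v)] `&` shift (- v) @^-1` A.
Proof.
move=> Av; apply/seteqP; split=> [_ [T AT <-]|T [Tv AT]].
  by split; [exact/vertices_shiftN/Av|rewrite /= shiftK //; exact: Av].
by exists (shift (- v) T) => //; rewrite -{1}(opprK v) shiftK.
Qed.

Lemma measurable_shift_image v (A : set bT) : A `<=` [set T | vertices (tgraph T) v] ->
  measurable A -> measurable (shift v @` A : set bT).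
Proof.
move=> Av mA; rewrite shift_image //; apply: measurable_shift => //.
by apply: measurable_open; exact: open_vertex.
Qed.

Lemma shift_inj v T T' : vertices (tgraph T) v -> vertices (tgraph T') v ->
  shift v T = shift v T' -> T = T'.
Proof. by move=> Tv Tv' e; rewrite -(shiftK Tv) e shiftK. Qed.

Lemma shift_partial_transformation v (A : set bT) : measurable A -> A `<=` X ->
  A `<=` [set T | vertices (tgraph T) v] ->
  @partial_transformation _ bT (@trel R) X A (shift v @` A) (shift v).
Proof.
move=> mA AX Av; split=> //.
- by move=> _ [T AT <-]; apply: gk_shift; [exact: AX|exact: Av].
- split=> //.
  + exact: measurable_shift_image.
  + split=> //.
    by move=> T T'; rewrite !inE => AT AT'; apply: shift_inj; exact: Av.
  + apply: (measurable_funS _ Av (@measurable_shift v)).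
    by apply: measurable_open; exact: open_vertex.
  + by move=> C mC CA; apply: measurable_shift_image => //; exact: subset_trans Av.
- by move=> T AT; apply/trelP; exists v => //; exact: Av.
Qed.

Lemma shift_invariant (nu : {measure set bT -> \bar R}) v (A : set bT) :
  invariant_measure nu (@trel R) X -> measurable A -> A `<=` X ->
  A `<=` [set T | vertices (tgraph T) v] -> nu (shift v @` A) = nu A.
Proof.
move=> inu mA AX Av; have pt := shift_partial_transformation mA AX Av.
have := inu _ _ _ pt (shift v @` A) => <- //; last exact: measurable_shift_image.
by congr (nu _); apply/seteqP; split=> [T []//|T AT]; split=> //; exists T.
Qed.

(** * The coding of the generic trees *)

Lemma gph_eq r r' : (forall b n, pdvd n (r b n - r' b n)) -> gph r = gph r'.
Proof.
move=> h; apply: induced_ext.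
have e w b n : pdvd n (co b w + r b n) = pdvd n (co b w + r' b n).
  by apply: pdvd_eqr; have := h b n; congr pdvd; ring.
by apply/seteqP; split=> w hw n; have := hw n; rewrite !e.
Qed.

Lemma generic_eq r r' : (forall b n, pdvd n (r b n - r' b n)) -> generic r -> generic r'.
Proof.
move=> h g b z; have [n gn] := g b z; exists n; move: gn; congr (~~ _).
by apply: pdvd_eqr; have := h b n; congr pdvd; ring.
Qed.

Definition gen : set cantor_space := [set g | generic (dig g)].

(** The codes of the generic trees: [psi] maps [gen_tree] bijectively onto this set, with inverse
    [phi]. *)
Definition gen_vertex : set cantor_space := [set g | generic (dig g) /\ member (dig g) 0].

Definition gen_tree : set (tspace R) := [set T | X T /\ generic (ph T)].

Definition phi (g : cantor_space) : tspace R := gtree R (dig g).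

Lemma gen_tree_psi T : X T -> generic (ph T) <-> gen (psi T).
Proof.
by move=> XT; split; apply: generic_eq => b n; [rewrite pdvd_opp|]; exact: dig_psi.
Qed.

Lemma phi_gk g : gen_vertex g -> X (phi g).
Proof. by move=> [gg mg]; apply: gtree_gk => //; exact: dig_coherent. Qed.

Lemma ph_phi g : gen_vertex g -> forall b n, pdvd n (ph (phi g) b n - dig g b n).
Proof. by move=> [gg mg] b n; apply: ph_gtree => //; exact: dig_coherent. Qed.

Lemma psi_phi g : gen_vertex g -> psi (phi g) = g.
Proof.
move=> Vg; rewrite -[RHS]enc_dig; apply: enc_eq; last exact: ph_phi.
  exact/ph_coherent/phi_gk.
exact: dig_coherent.
Qed.

Lemma phi_gen g : gen_vertex g -> gen_tree (phi g).
Proof.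
move=> Vg; split; first exact: phi_gk.
by apply/gen_tree_psi; [exact: phi_gk|rewrite psi_phi //; case: Vg].
Qed.

Lemma psi_gen T : gen_tree T -> gen_vertex (psi T).
Proof.
move=> [XT gT]; split; first exact/gen_tree_psi.
have : member (ph T) 0 by apply: gk_member => //; have [] := svalP T.
move=> h n; have := h n; rewrite !co0 !add0r.
by rewrite -!(pdvd_eqr (dig_psi XT _ n)).
Qed.

Lemma phi_psi T : gen_tree T -> phi (psi T) = T.
Proof.
move=> GT; have [XT gT] := GT; have [gg mg] := psi_gen GT.
apply: tgraph_inj; rewrite (generic_gk XT gT) tgraph_gtree.
  by apply: gph_eq => b n; exact: dig_psi.
exact: generic_pointed (@dig_coherent _) gg mg.
Qed.

Lemma psi_inj T T' : gen_tree T -> gen_tree T' -> psi T = psi T' -> T = T'.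
Proof. by move=> /phi_psi {2}<- /phi_psi {2}<- ->. Qed.

Lemma measurable_gen_at b z : measurable ([set g | forall n, pdvd n (z + dig g b n)] : set bC).
Proof.
have -> : [set g | forall n, pdvd n (z + dig g b n)] =
    \bigcap_n [set g | pdvd n (z + dig g b n)].
  by apply/seteqP; split=> [g h n _|g h n]; exact: h.
apply: bigcapT_measurable => n; apply: (@measurable_local n.*2) => g g' gg' /=.
by rewrite (dig_agree gg').
Qed.

Definition integer_at (b : bool) (z : int) : set cantor_space :=
  [set g | forall n, pdvd n (z + dig g b n)].

Lemma genE : gen = ~` \bigcup_(k : nat)
  (if unpickle k is Some (b, z) then integer_at b z else set0).
Proof.
apply/seteqP; split=> [g gg [k _]|g h b z].
  by case: unpickle => // -[b z] h; have [n /negP] := gg b z; apply.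
apply: contrapT => /forallNP hn; apply: h; exists (pickle (b, z)) => //; rewrite pickleK.
by move=> n; apply/negPn/negP; exact: hn.
Qed.

Lemma measurable_gen : measurable (gen : set bC).
Proof.
rewrite genE; apply: measurableC; apply: bigcupT_measurable => k.
by case: unpickle => // -[b z]; exact: measurable_gen_at.
Qed.

Lemma measurable_gen_vertex : measurable (gen_vertex : set bC).
Proof.
have -> : gen_vertex = gen `&` \bigcap_n [set g | pdvd n (co false 0 + dig g false n) =
    pdvd n (co true 0 + dig g true n)].
  by apply/seteqP; split=> g [gg h]; split=> // n; [move=> _; exact: h|exact: h].
apply: measurableI; first exact: measurable_gen.
apply: bigcapT_measurable => n; apply: (@measurable_local n.*2) => g g' gg' /=.
by rewrite !(dig_agree gg').
Qed.

Lemma measurable_gen_tree : measurable (gen_tree : set bT).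
Proof.
have -> : gen_tree = X `&` psi @^-1` gen.
  by apply/seteqP; split=> T [XT gT]; split=> //; apply/gen_tree_psi.
by apply: measurable_psi_preimage => //; [exact: measurable_gk|exact: measurable_gen].
Qed.

Lemma phi_agree g N : gen_vertex g -> exists n, forall g', gen_vertex g' ->
  agree_upto n g g' -> agree N (phi g) (phi g').
Proof.
move=> [gg mg]; have [M hM] := member_window (@dig_coherent g) gg N.
exists M.*2 => g' [gg' mg'] a; apply: gtree_agree => //.
- exact: dig_coherent.
- by apply: generic_pointed => //; exact: dig_coherent.
apply: hM; first exact: dig_coherent.
move=> b n nM; have -> : dig g' b n = dig g b n; last by rewrite subrr pdvd0.
by apply: dig_agree => i ni; rewrite a //; apply: leq_trans ni _; rewrite leq_double.
Qed.

Lemma measurable_phi : measurable_fun (gen_vertex : set bC) (phi : bC -> bT).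
Proof.
apply: measurable_fun_borel => U oU.
pose O : set cantor_space := [set g' | exists g n, [/\ (gen_vertex `&` phi @^-1` U) g,
  forall g', gen_vertex g' -> agree_upto n g g' -> U (phi g') & agree_upto n g g']].
have -> : gen_vertex `&` phi @^-1` U = gen_vertex `&` O.
  apply/seteqP; split=> [g [Vg Ug]|g' [Vg' [g [n [_ h a]]]]]; split=> //; last exact: h.
  have /tspace_nbhsP[N NU] : nbhs (phi g) U by move: oU; rewrite openE; apply.
  have [n hn] := phi_agree N Vg; exists g, n; split=> // g' Vg' a.
  by apply: NU; exact: hn.
apply: measurableI; first exact: measurable_gen_vertex.
apply: measurable_open; rewrite openE => g' [g [n [Vg h a]]].
apply/cantor_nbhsP; exists n => g'' a'; exists g, n; split=> //.
exact: agree_upto_trans a (agree_upto_sym a').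
Qed.

Lemma measurable_phi_preimage (A : set bT) : measurable A ->
  measurable (gen_vertex `&` phi @^-1` A : set bC).
Proof. by move=> mA; apply: measurable_phi => //; exact: measurable_gen_vertex. Qed.

Lemma psi_image (A : set (tspace R)) : A `<=` gen_tree ->
  psi @` A = gen_vertex `&` phi @^-1` A.
Proof.
move=> AG; apply/seteqP; split=> [_ [T AT <-]|g [Vg Ag]]; last first.
  by exists (phi g) => //; exact: psi_phi.
by split; [exact/psi_gen/AG|rewrite /= phi_psi //; exact: AG].
Qed.

Lemma psi_shift T v : X T -> vertices (tgraph T) v ->
  psi (shift v T) = trans (fun b => co b v) (psi T).
Proof.
move=> XT Tv; symmetry; apply: trans_eq => b n.
have h1 := dig_psi XT b n; have h2 := dig_psi (gk_shift XT Tv) b n.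
have h3 := ph_shift XT Tv b n.
by have := pdvdB (pdvdB h1 h2) h3; congr pdvd; ring.
Qed.

Lemma gen_trans a g : gen g <-> gen (trans a g).
Proof.
have aux a' g' : gen g' -> gen (trans a' g').
  move=> gg b z; have [n gn] := gg b (z + a' b); exists n.
  rewrite (pdvd_eqr (z := z + a' b + dig g' b n)) //.
  by have := dig_trans a' g' b n; congr pdvd; ring.
by split=> [|/(aux (fun b => - a b))]; [exact: aux|rewrite transK].
Qed.

Lemma gen_tree_shift T v : X T -> vertices (tgraph T) v ->
  gen_tree T <-> gen_tree (shift v T).
Proof.
move=> XT Tv; have XT' := gk_shift XT Tv; rewrite /gen_tree /=.
have e1 := gen_tree_psi XT; have e2 := gen_tree_psi XT'.
have e3 := gen_trans (fun b => co b v) (psi T); rewrite -psi_shift // in e3.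
tauto.
Qed.

End coding.

(** * The invariant measure *)

Lemma measure_countable_eq (R : realType) d d' (T : measurableType d) (T' : measurableType d')
    (m : {measure set T -> \bar R}) (m' : {measure set T' -> \bar R}) (I : countType)
    (F : I -> set T) (F' : I -> set T') :
  (forall i, measurable (F i)) -> (forall i, measurable (F' i)) ->
  (forall i j x, F i x -> F j x -> i = j) -> (forall i j x, F' i x -> F' j x -> i = j) ->
  (forall i, m (F i) = m' (F' i)) ->
  m (\bigcup_i F i) = m' (\bigcup_i F' i).
Proof.
move=> mF mF' tF tF' mm'.
(* [pickle_inv] sends distinct numbers to distinct indices where it is defined, so no piece is
   enumerated twice and disjointness survives. *)
pose ext (U : Type) (H : I -> set U) (k : nat) := if pickle_inv k is Some i then H i else set0.
have extU U (H : I -> set U) : \bigcup_i H i = \bigcup_k ext U H k.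
  apply/seteqP; split=> [x [i _ Hx]|x [k _]].
    by exists (pickle i) => //; rewrite /ext pickleK_inv.
  by rewrite /ext; case: pickle_inv => // i Hx; exists i.
have ext_triv U (H : I -> set U) : (forall i j x, H i x -> H j x -> i = j) ->
    trivIset setT (ext U H).
  move=> tH k l _ _ [x []]; rewrite /ext.
  have := @pickle_invK I k; have := @pickle_invK I l.
  case: pickle_inv => [j|//] /= <-; case: pickle_inv => [i|//] /= <- Hi Hj.
  by rewrite (tH _ _ _ Hi Hj).
have mext d0 (U : measurableType d0) (H : I -> set U) : (forall i, measurable (H i)) ->
    forall k, measurable (ext U H k).
  by move=> mH k; rewrite /ext; case: pickle_inv.
rewrite !extU !measure_semi_bigcup; [|exact: mext|exact: ext_triv|
  by apply: bigcupT_measurable; exact: mext|exact: mext|exact: ext_triv|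
  by apply: bigcupT_measurable; exact: mext].
apply: eq_eseriesr => k _; rewrite /ext; case: pickle_inv => [i|]; first exact: mm'.
by rewrite !measure0.
Qed.

Lemma disjoint_equal_null (R : realType) d (T : measurableType d)
    (m : {measure set T -> \bar R}) (F : nat -> set T) :
  (m setT < +oo)%E -> (forall i, measurable (F i)) -> trivIset setT F ->
  (forall i, m (F i) = m (F 0%N)) -> m (F 0%N) = 0%E.
Proof.
move=> moo mF tF mE; apply/eqP; rewrite eq_le measure_ge0 andbT leNgt; apply/negP => m0.
have mfin A : measurable A -> m A \is a fin_num.
  move=> mA; rewrite ge0_fin_numE ?measure_ge0 //.
  by apply: le_lt_trans moo; apply: le_measure; rewrite ?inE.
have mTE := fineK (mfin setT measurableT); have mFE := fineK (mfin _ (mF 0%N)).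
have mU : measurable (\bigcup_n F n) by exact: bigcupT_measurable.
have le_n n : ((n%:R * fine (m (F 0%N)))%:E <= (fine (m setT))%:E)%E.
  rewrite mTE; apply: (@le_trans _ _ (m (\bigcup_n F n))); last first.
    by apply: le_measure; rewrite ?inE.
  rewrite measure_semi_bigcup //.
  apply: le_trans (nneseries_lim_ge n _); last by [].
  rewrite (eq_bigr (fun _ => (fine (m (F 0%N)))%:E)); last by move=> i _; rewrite mE mFE.
  by rewrite sumEFin big_const_nat subn0 iter_addr_0 mulr_natl.
have c0 : 0 < fine (m (F 0%N)) by rewrite -lte_fin mFE.
pose k := (Num.truncn (fine (m setT) / fine (m (F 0%N)))).+1.
have := le_n k; rewrite lee_fin leNgt => /negP; apply.
by rewrite -ltr_pdivrMr //; exact: truncnS_gt.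
Qed.

Section invariant_measure.
Variable R : realType.
Implicit Types (T : tspace R).
Local Notation X := (ghys_kenyon R).
Local Notation bT := (borel (tspace R)).
Local Notation bC := (borel cantor_space).

Lemma coin_fin : (coin R setT < +oo)%E.
Proof. by rewrite probability_setT ltry. Qed.

(** The sets attached to [z + i] are pairwise disjoint, and they are translates of one another,
    hence of equal measure. *)
Lemma coin_integer_at b z : coin R (integer_at b z) = 0%E.
Proof.
pose F (i : nat) : set bC := integer_at b (z + i%:Z).
have -> : integer_at b z = F 0%N by rewrite /F addr0.
apply: disjoint_equal_null => [|i|i j _ _ [g [gi gj]]|i].
- exact: coin_fin.
- exact: measurable_gen_at.
- have h n : pdvd n (i%:Z - j%:Z).
    by have := pdvdB (gi n) (gj n); congr pdvd; ring.
  have := pdvd_small (h (i + j)%N); rewrite pow2E.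
  have := ltn_expl (i + j) (isT : 1 < 2)%N; move: (2 ^ _)%N => N; lia.
- pose a (c : bool) := if c == b then i%:Z else 0.
  have mF0 : measurable (F 0%N) by exact: measurable_gen_at.
  rewrite -[RHS](isometry_coin R (@trans_isometry a) mF0); congr (coin R _).
  have e g n : pdvd n (z + i%:Z + dig g b n) = pdvd n (z + 0%:Z + dig (trans a g) b n).
    apply: pdvd_eqr; rewrite pdvd_opp; have := dig_trans a g b n.
    have -> : a b = i%:Z by rewrite /a eqxx.
    by congr pdvd; ring.
  by apply/seteqP; split=> g h n; have := h n; rewrite e.
Qed.

Lemma coin_not_gen : coin R (~` gen) = 0%E.
Proof.
apply/negligibleP; first by apply: measurableC; exact: measurable_gen.
rewrite genE setCK; apply: negligible_bigcup => k.
case: unpickle => [[b z]|]; last exact: negligible_set0.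
by apply/negligibleP; [exact: measurable_gen_at|exact: coin_integer_at].
Qed.

(** Digits 0 and 1 are the lowest digits of the two coordinates. *)
Definition odd_cantor : set cantor_space := [set g | g 0%N /\ g 1%N].

Lemma odd_cantorE g : odd_cantor g <-> forall b, ~~ pdvd 1 (dig g b 1).
Proof.
have e b : dig g b 1 = (g b : nat)%:Z by rewrite /dig bvalS bval0 add0r mulr1.
split=> [[g0 g1] b|h]; first by rewrite e; case: b; rewrite ?g0 ?g1.
have := h false; have := h true; rewrite !e /= => h1 h0; split.
  by move: h0; rewrite /nat_of_bool; case: (g 0%N).
by move: h1; rewrite /nat_of_bool; case: (g 1%N).
Qed.

Lemma odd_gen_vertex g : odd_cantor g -> gen g -> gen_vertex g.
Proof.
move=> /odd_cantorE og gg; split=> //; apply: odd_member; first exact: dig_coherent.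
by move=> b; rewrite co0 add0r.
Qed.

Lemma odd_cantor_cylinder : odd_cantor = cylinder 2 (fun _ => true).
Proof.
apply/seteqP; split=> g; first by move=> [g0 g1] [|[|//]].
by move=> h; split; [rewrite (h 0%N)|rewrite (h 1%N)].
Qed.

Lemma coin_gen_vertex_gt0 : (0 < coin R gen_vertex)%E.
Proof.
have mO : measurable (odd_cantor : set bC).
  by rewrite odd_cantor_cylinder; apply: measurable_open; exact: open_cylinder.
have mG := measurable_gen.
have h : (coin R odd_cantor <= coin R gen_vertex)%E.
  have -> : coin R odd_cantor = coin R (odd_cantor `&` gen).
    rewrite -[in LHS](setUIDK odd_cantor gen) measureU0 //.
    - exact: measurableI.
    - exact: measurableD.
    - apply: (subset_measure0 _ _ _ coin_not_gen); last by move=> g [].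
        exact: measurableD.
      exact: measurableC.
  apply: le_measure; rewrite ?inE //; first exact: measurableI.
    exact: measurable_gen_vertex.
  by move=> g [og gg]; exact: odd_gen_vertex.
apply: lt_le_trans h; rewrite odd_cantor_cylinder.
have -> := coin_cylinder R 2 (fun _ => true).
by rewrite lte_fin invr_gt0 exprn_gt0.
Qed.

Definition coin_gen_vertex : {measure set bC -> \bar R} :=
  mrestr (coin R) measurable_gen_vertex.

Definition Phi (g : bC) : bT := if g \in gen_vertex then phi R g else point.

Lemma measurable_Phi : measurable_fun setT Phi.
Proof.
move=> _ A mA; rewrite setTI.
have -> : Phi @^-1` A = (gen_vertex `&` phi R @^-1` A) `|`
    (~` gen_vertex `&` [set _ | A point]).
  rewrite /Phi; apply/seteqP; split=> g /=.
    case: ifPn => [|]; rewrite ?inE ?notin_setE => gV h; [by left|by right].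
  case=> -[gV h]; first by rewrite mem_set.
  by rewrite memNset.
apply: measurableU; first exact: measurable_phi_preimage.
apply: measurableI; first by apply: measurableC; exact: measurable_gen_vertex.
have [h|h] := pselect (A point).
  by rewrite (_ : [set _ | _] = setT) //; apply/seteqP; split.
by rewrite (_ : [set _ | _] = set0) //; apply/seteqP; split.
Qed.

HB.instance Definition _ := isMeasurableFun.Build _ _ _ _ Phi measurable_Phi.

(** The Haar measure conditioned on [gen_vertex] and transported to the generic trees. *)
Definition gk_measure : probability bT R :=
  distribution (mnormalize coin_gen_vertex point) (Phi : {mfun _ >-> _}).

Lemma gk_measureE A : gk_measure A =
  (coin R (gen_vertex `&` phi R @^-1` A) * ((fine (coin R gen_vertex))^-1)%:E)%E.
Proof.
have e B : coin_gen_vertex B = coin R (B `&` gen_vertex) by [].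
rewrite -[LHS]/(mnormalize coin_gen_vertex point (Phi @^-1` A)) /mnormalize.
rewrite !e setTI gt_eqF ?coin_gen_vertex_gt0 //=.
have -> : (coin R gen_vertex == +oo)%E = false.
  apply/negbTE; rewrite lt_eqF //; apply: le_lt_trans (probability_le1 _ _) _.
    exact: measurable_gen_vertex.
  by rewrite ltry.
congr (coin R _ * _)%E; apply/seteqP; split=> g.
  by rewrite /Phi => -[/= h Vg]; rewrite mem_set // in h.
by rewrite /Phi => -[Vg h]; split=> //=; rewrite mem_set.
Qed.

Lemma gk_measure_gk : gk_measure X = 1%E.
Proof.
rewrite gk_measureE.
have -> : gen_vertex `&` phi R @^-1` X = gen_vertex.
  by apply/seteqP; split=> [g []//|g Vg]; split=> //; exact: phi_gk.
have h : coin R gen_vertex \is a fin_num.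
  by rewrite fin_num_measure //; exact: measurable_gen_vertex.
rewrite -{1}(fineK h) -EFinM divff // fine_eq0 // gt_eqF //.
exact: coin_gen_vertex_gt0.
Qed.

Lemma trans_co_inj v w g : trans (fun b => co b v) g = trans (fun b => co b w) g -> v = w.
Proof.
move=> e; apply: co_inj => b; apply/eqP; rewrite -subr_eq0; apply/eqP.
have h n : pdvd n (co b v - co b w).
  have h1 := dig_trans (fun b => co b v) g b n; have h2 := dig_trans (fun b => co b w) g b n.
  by rewrite e in h1; have := pdvdB h2 h1; congr pdvd; ring.
apply: pdvd_small (h `|co b v - co b w|%N) _.
by rewrite pow2E -abszE ltz_nat; exact: ltn_expl.
Qed.

Lemma trans_image a (A : set cantor_space) : trans a @` A = trans (fun b => - a b) @^-1` A.
Proof.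
have tK : cancel (trans (fun b => - a b)) (trans a).
  move=> g; have := transK (fun b => - a b) g; congr (_ = _).
  by congr trans; apply/funext => b; rewrite opprK.
apply/seteqP; split=> [_ [g Ag <-]|g Ag]; first by rewrite /= transK.
by exists (trans (fun b => - a b) g); rewrite ?tK.
Qed.

(** A partial transformation is cut into countably many pieces on which it is one translation; on
    codes each piece is moved by an isometry [trans], which preserves the Haar measure. *)
Lemma gk_measure_invariant : invariant_measure gk_measure (@trel R) X.
Proof.
move=> A B f [AX BX [mA mB [fAB finj fsurj] mf _] ftrel] C mC CB.
apply: (etrans (gk_measureE _)); apply: (etrans _ (esym (gk_measureE _))).
congr (_ * _)%E.
have CX : C `<=` X by exact: subset_trans BX.
have mAC : measurable (A `&` f @^-1` C) by exact: mf.
pose G : set bC := gen_vertex `&` phi R @^-1` (A `&` f @^-1` C).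
pose H : set bC := gen_vertex `&` phi R @^-1` C.
pose ta (v : vertex) := trans (fun b => co b v).
pose Gv (v : vertex) : set bC := G `&` [set g | psi (f (phi R g) : tspace R) = ta v g].
have mGv v : measurable (Gv v).
  (* The equality of two codes is tested digit by digit, which makes it a countable combination of
     measurable conditions. *)
  have -> : Gv v = \bigcap_(i : nat) \bigcup_(c : bool)
      (gen_vertex `&` phi R @^-1` (A `&` f @^-1` (C `&` @psi R @^-1` [set g | g i = c]))
       `&` [set g | ta v g i = c]).
    apply/seteqP; split=> [g [[Vg [Ag Cg]] /= e] i _|g h].
      by exists (ta v g i) => //=; rewrite e.
    have [c _ [[Vg [/= Ag [Cg _]]] _]] := h 0%N Logic.I; split=> //=.
    by apply/funext => i; have [c' _ [[_ [_ [_ /= ->]]]]] := h i Logic.I.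
  apply: bigcapT_measurable => i; apply: fin_bigcup_measurable => // c _.
  apply: measurableI.
    apply: measurable_phi_preimage; apply: mf => //.
    apply: measurable_psi_preimage => //.
    by apply: (@measurable_local i.+1) => g g' gg' /= <-; rewrite gg'.
  apply: (@measurable_local i.+1) => g g' gg' /= <-.
  by apply: (@trans_agree _ i.+1 g' g) => //; exact: agree_upto_sym.
have GE : G = \bigcup_v Gv v.
  apply/seteqP; split=> [g Gg|g [v _ []//]]; have [Vg [Ag Cg]] := Gg.
  have /trelP[v Tv e] := ftrel _ Ag; exists v => //; split=> //=.
  by rewrite e psi_shift //; [rewrite psi_phi|exact: AX].
have fG g : G g -> gen_tree (f (phi R g) : tspace R).
  move=> [Vg [Ag Cg]]; have /trelP[v Tv e] := ftrel _ Ag; rewrite e.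
  exact: (gen_tree_shift (AX _ Ag) Tv).1 (phi_gen R Vg).
have HE : H = \bigcup_v (ta v @` Gv v).
  apply/seteqP; split=> [g' [Vg' /= Cg']|_ [v _ [g [Gg /= e] <-]]]; last first.
    have [Vg [Ag Cg]] := Gg; rewrite -e; split; first exact/psi_gen/fG.
    by rewrite /= phi_psi //; exact: fG.
  have [T AT fT] := fsurj _ (CB _ Cg'); have /trelP[v Tv e] := ftrel _ AT.
  have XT := AX _ AT.
  have gT : gen_tree (T : tspace R).
    by apply: (gen_tree_shift XT Tv).2; rewrite -e fT; exact: phi_gen.
  have ee : psi (f T : tspace R) = ta v (psi (T : tspace R)) by rewrite e psi_shift.
  exists v => //; exists (psi (T : tspace R)); last by rewrite -ee fT psi_phi.
  have Gg : G (psi (T : tspace R)).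
    by split; [exact: psi_gen|rewrite /= phi_psi // fT; split].
  by split=> //=; rewrite phi_psi.
rewrite -/G -/H GE HE.
apply: measure_countable_eq => //.
- move=> v; rewrite /ta trans_image -[X in measurable X]setTI.
  by apply: isometry_measurable => //; exact: trans_isometry.
- by move=> v w g [_ /= e1] [_ /= e2]; apply: (@trans_co_inj v w g); exact: etrans (esym e1) e2.
(* The images are disjoint because [f] is injective and a code determines its generic tree: a common
   image forces [g = g'], and then [v = w]. *)
- move=> v w _ [g [Gg /= e1] <-] [g' [Gg' /= e2] e].
  have [Vg [Ag Cg]] := Gg; have [Vg' [Ag' Cg']] := Gg'.
  have ff : f (phi R g) = f (phi R g').
    by apply: psi_inj; [exact: fG|exact: fG|rewrite e1 e2].
  have pp : phi R g = phi R g' by apply: finj; rewrite ?inE.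
  have gg : g = g' by rewrite -(psi_phi R Vg) pp psi_phi.
  by apply: (@trans_co_inj v w g); rewrite -/(ta v g) -e -gg.
- by move=> v; rewrite /ta trans_image; symmetry; apply: isometry_coin => //; exact: trans_isometry.
Qed.

End invariant_measure.

(** * Unique ergodicity *)

Section uniqueness.
Variable R : realType.
Implicit Types (T : tspace R).
Local Notation X := (ghys_kenyon R).
Local Notation bT := (borel (tspace R)).
Local Notation bC := (borel cantor_space).

(* The trees lying at integral distance [k] from a boundary line [co b = const]
   of the hierarchy of squares. *)
Definition boundary_tree (b : bool) (k : int) : set (tspace R) :=
  [set T | X T /\ forall n, pdvd n (ph T b n - k)].

Lemma boundary_treeE b k : boundary_tree b k = X `&` @psi R @^-1` integer_at b (- k).
Proof.
have e T : X T -> forall n, pdvd n (- k + dig (psi T) b n) = pdvd n (ph T b n - k).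
  move=> XT n; apply: pdvd_eqr; have := dig_psi XT b n; congr pdvd; ring.
by apply/seteqP; split=> T [XT h]; split=> // n; have := h n; rewrite e.
Qed.

Lemma measurable_boundary_tree b k : measurable (boundary_tree b k : set bT).
Proof.
rewrite boundary_treeE; apply: measurable_psi_preimage => //.
  exact: measurable_gk.
exact: measurable_gen_at.
Qed.

Lemma boundary_tree_inj b k k' T : boundary_tree b k T -> boundary_tree b k' T -> k = k'.
Proof.
move=> [_ h] [_ h']; apply/eqP; rewrite -subr_eq0; apply/eqP.
have hk n : pdvd n (k - k') by have := pdvdB (h' n) (h n); congr pdvd; ring.
apply: pdvd_small (hk `|k - k'|%N) _.
by rewrite pow2E -abszE ltz_nat; exact: ltn_expl.
Qed.

Lemma boundary_tree_shift b k w T : boundary_tree b k T -> vertices (tgraph T) w ->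
  boundary_tree b (k + co b w) (shift w T).
Proof.
move=> [XT h] Tw; split; first exact: gk_shift.
by move=> n; have := pdvdD (ph_shift XT Tw b n) (h n); congr pdvd; ring.
Qed.

Lemma boundary_tree_odd b k T : boundary_tree b k T -> ~~ pdvd 1 k ->
  forall c, ~~ pdvd 1 (ph T c 1).
Proof.
move=> [XT h] k1 c.
have hb : ~~ pdvd 1 (ph T b 1) by rewrite (pdvd_eqr (h 1%N)).
have := gk_parity XT; case: b {h} hb; case: c => // hb e; first by rewrite e.
by rewrite -e.
Qed.

(** The boundary line bounds squares of every size. As [w] stays on the origin's side of it and does
    not move in the other coordinate, where an odd origin meets no line, one large square contains
    both points. An even vector keeps the coordinates odd, so [same_tile_vertex] applies. *)
Lemma boundary_tree_vertex b k w T : boundary_tree b k T -> ~~ pdvd 1 k ->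
  co (~~ b) w = 0 -> pdvd 1 (co b w) ->
  (0 < k /\ 0 < k + co b w) \/ (k < 0 /\ k + co b w < 0) -> vertices (tgraph T) w.
Proof.
move=> Bk k1 cw ew hs; have [XT h] := Bk; have cr := ph_coherent XT.
have ow := boundary_tree_odd Bk k1.
have ec c : pdvd 1 (co c w) by have [->//|/negPf] := eqVneq c b; case: c b cw ew {Bk h hs ow} => -[] //= ->; rewrite pdvd0.
pose n := (`|k| + `|co b w|)%N.
have nN : n%:Z < 2%:Z ^+ n.+1.
  by rewrite pow2E ltz_nat; apply: ltn_trans (ltnSn n) (ltn_expl n.+1 _).
apply: (same_tile_vertex (n := n)) => //; last first.
  move=> m _; apply: odd_member => // c.
  by rewrite (pdvd_eqr (z := ph T c 1)) // addrK.
move=> c.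
have pk : pmod n.+1 (ph T b n.+1) = if 0 < k then k else 2%:Z ^+ n.+1 + k.
  apply: pmodE; last by move: nN; rewrite /n; case: ifP => k0; move: (2%:Z ^+ n.+1) => N; lia.
  case: ifP => _; first exact: h.
  by have := pdvdB (h n.+1) (pdvd_pow (leqnn n.+1)); congr pdvd; ring.
have [->|cb] := eqVneq c b.
  rewrite pk; move: nN; rewrite /n; move: (2%:Z ^+ n.+1) => N.
  by case: ifP; lia.
have -> : co c w = 0 by move: cb cw; clear; case: c; case: b.
have p0 : 0 < pmod n.+1 (ph T c n.+1).
  apply: pmod_gt0; apply: contra (ow c); rewrite -(add0r (ph T c n.+1)).
  by move=> /(coherent_dvd cr (isT : 1 <= n.+1)%N); rewrite add0r.
by rewrite addr0; split=> //; rewrite p0 pmod_lt.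
Qed.

Definition odd_tree : set (tspace R) := gen_tree (R:=R) `&` @psi R @^-1` odd_cantor.

Lemma odd_tree_ph T : odd_tree T -> forall b, ~~ pdvd 1 (ph T b 1).
Proof.
move=> [[XT _] /odd_cantorE o] b; have := o b; congr (~~ _).
by apply: pdvd_eqr; exact: dig_psi.
Qed.

Lemma ph_odd_tree T b : gen_tree T -> ~~ pdvd 1 (ph T b 1) -> odd_tree T.
Proof.
move=> GT o; have [XT _] := GT; split=> //; apply/odd_cantorE => c.
rewrite (pdvd_eqr (dig_psi XT c 1)); have := gk_parity XT.
by case: b o; case: c => // o e; rewrite ?e // -e.
Qed.

Lemma measurable_odd_cantor : measurable (odd_cantor : set bC).
Proof. by rewrite odd_cantor_cylinder; apply: measurable_open; exact: open_cylinder. Qed.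

Lemma gen_tree_gk : gen_tree (R:=R) `<=` X. Proof. by move=> T []. Qed.

Lemma measurable_odd_tree : measurable (odd_tree : set bT).
Proof.
apply: measurable_psi_preimage; [exact: measurable_gen_tree|exact: gen_tree_gk|].
exact: measurable_odd_cantor.
Qed.

Variable nu : {measure set bT -> \bar R}.
Hypotheses (nuT : nu setT = 1%E) (nuX : nu X = 1%E) (nuI : invariant_measure nu (@trel R) X).

Let nu_shift v (A : set bT) : measurable A -> A `<=` X ->
  A `<=` [set T | vertices (tgraph T) v] -> nu (shift v @` A) = nu A.
Proof. exact: shift_invariant. Qed.

Let nu_le (A B : set bT) : measurable A -> measurable B -> A `<=` B -> (nu A <= nu B)%E.
Proof. by move=> mA mB AB; apply: le_measure; rewrite ?inE. Qed.

Let nu_add (A B : set bT) : measurable A -> measurable B -> A `&` B = set0 ->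
  nu (A `|` B) = (nu A + nu B)%E.
Proof. by move=> mA mB AB; rewrite measureU. Qed.

Let nu_fin (A : set bT) : measurable A -> nu A \is a fin_num.
Proof.
move=> mA; rewrite ge0_fin_numE //; apply: le_lt_trans (nu_le mA measurableT _) _ => //.
by rewrite nuT ltry.
Qed.

Lemma boundary_tree_eq b k w : ~~ pdvd 1 k -> co (~~ b) w = 0 -> pdvd 1 (co b w) ->
  (0 < k /\ 0 < k + co b w) \/ (k < 0 /\ k + co b w < 0) ->
  nu (boundary_tree b (k + co b w)) = nu (boundary_tree b k).
Proof.
move=> k1 cw ew hs.
have Bw T : boundary_tree b k T -> vertices (tgraph T) w.
  by move=> Bk; apply: boundary_tree_vertex Bk _ _ _ _.
rewrite -(@nu_shift w (boundary_tree b k)) //.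
- congr (nu _); apply/seteqP; split=> [T' BT'|_ [T BT <-]]; last first.
    by apply: boundary_tree_shift => //; exact: Bw.
  have Tw : vertices (tgraph (T' : tspace R)) (- w).
    apply: (boundary_tree_vertex BT'); rewrite ?coN ?cw ?oppr0 ?pdvdN ?addrK //.
    - by rewrite (pdvd_eqr (z := k)) // addrC addKr.
    - by case: hs => -[h1 h2]; [left|right].
  exists (shift (- w) T').
    by have := boundary_tree_shift BT' Tw; rewrite coN addrK.
  by have := shiftK Tw; rewrite opprK.
- exact: measurable_boundary_tree.
- by move=> T [].
Qed.

Lemma boundary_tree_null b k : nu (boundary_tree b k) = 0%E.
Proof.
have odd_null c (i : nat) : nu (boundary_tree b (sg c * (i.*2.+1)%:Z)) = 0%E.
  pose F i : set bT := boundary_tree b (sg c * (i.*2.+1)%:Z).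
  have mF j : measurable (F j) by exact: measurable_boundary_tree.
  (* The shortest even displacement away from the line and parallel to the other axis, whence the
     step of 2. *)
  have [w wE] : exists w, forall d, co d w = if d == b then sg c * 2 else 0.
    apply: co_onto; rewrite /sg; case: b {F mF}; case: c => /=; lia.
  have step j : nu (F j.+1) = nu (F j).
    have wb : co b w = sg c * 2 by rewrite wE eqxx.
    have -> : F j.+1 = boundary_tree b (sg c * (j.*2.+1)%:Z + co b w).
      by rewrite /F wb; congr boundary_tree; rewrite /sg; case: c {F mF wE wb} => /=; lia.
    apply: boundary_tree_eq; rewrite ?wb /sg.
    - by rewrite pdvd1; case: c {F mF wE wb}; lia.
    - by rewrite wE; case: b {F mF wE wb}.
    - by rewrite pdvd1; case: c {F mF wE wb}.
    - by case: c {F mF wE wb}; [right|left]; lia.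
  have allF j : nu (F j) = nu (F 0%N) by elim: j => [//|j IH]; rewrite step.
  rewrite -/(F i) allF; apply: (disjoint_equal_null (m := nu)) => //.
    by rewrite nuT ltry.
  move=> j l _ _ [T [hj hl]]; have := boundary_tree_inj hj hl.
  by rewrite /sg; case: c {F mF wE step allF hj hl}; lia.
have {}odd_null l : ~~ pdvd 1 l -> nu (boundary_tree b l) = 0%E.
  rewrite pdvd1 => l1; have := odd_null (l < 0) `|l|%N./2.
  congr (nu (boundary_tree b _) = _).
  by rewrite /sg; case: ifP => l0; have := odd_double_half `|l|%N; lia.
(* For even [k], the vector [(1, 0)] raises either coordinate by one and injects the set into the
   one at distance [k + 1], already null. *)
case: (boolP (pdvd 1 k)) => [k1|]; last exact: odd_null.
have hv T : boundary_tree b k T -> vertices (tgraph T) (1, 0).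
  move=> [XT h]; apply: gk_even_neighbour => //.
  have hb : pdvd 1 (ph T b 1) by rewrite (pdvd_eqr (h 1%N)).
  by have := gk_parity XT; case: b hb {h odd_null} => // ->.
have k2 : ~~ pdvd 1 (k + 1) by move: k1; rewrite !pdvd1; lia.
apply/eqP; rewrite eq_le measure_ge0 andbT -(odd_null _ k2).
rewrite -(@nu_shift (1, 0) (boundary_tree b k)) //; last 2 first.
- exact: measurable_boundary_tree.
- by move=> T [].
apply: nu_le.
- by apply: measurable_shift_image => //; exact: measurable_boundary_tree.
- exact: measurable_boundary_tree.
- move=> _ [T BT <-]; have := boundary_tree_shift BT (hv _ BT).
  by have -> : co b (1, 0) = 1 by case: b {hv k1 k2 BT odd_null}.
Qed.

Lemma gen_tree_full (A : set bT) : measurable A -> nu A = nu (A `&` gen_tree (R:=R)).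
Proof.
move=> mA; have mG := @measurable_gen_tree R; have mX := @measurable_gk R.
rewrite -{1}(setUIDK A (gen_tree (R:=R))) measureU0 //; [exact: measurableI|exact: measurableD|].
have nX : nu (~` X) = 0%E.
  have mXC : measurable (~` X : set bT) by exact: measurableC.
  have := nu_add mX mXC (setICr _); rewrite setUv nuT nuX -(fineK (nu_fin mXC)).
  by rewrite -EFinD => -[h]; congr EFin; lra.
apply: (@subset_measure0 _ _ _ nu _ (~` X `|` (X `\` gen_tree (R:=R)))).
- exact: measurableD.
- by apply: measurableU; [exact: measurableC|exact: measurableD].
- by move=> T [AT nG]; have [XT|nXT] := pselect (X T); [right|left].
suff z : nu (X `\` gen_tree (R:=R)) = 0%E.
  by apply: etrans (measureU0 _ _ z) nX; [exact: measurableC|exact: measurableD].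
apply/negligibleP; first exact: measurableD.
pose N : set bT := \bigcup_(i : nat)
  (if unpickle i is Some (b, z) then boundary_tree b z else set0).
apply: (@negligibleS _ _ _ _ N); last first.
  apply: negligible_bigcup => i; case: unpickle => [[b z]|]; last exact: negligible_set0.
  by apply/negligibleP; [exact: measurable_boundary_tree|exact: boundary_tree_null].
move=> T [XT nG]; apply: contrapT => nB; apply: nG; split=> // b z.
apply: contrapT => /forallNP h; apply: nB; exists (pickle (b, - z)) => //.
rewrite pickleK; split=> // n; rewrite opprK addrC.
by apply/negPn/negP; exact: h.
Qed.

(** * Equidistribution of the odd trees *)

Let odd_cylinder n g : set bT := odd_tree `&` @psi R @^-1` cylinder n g.

Let measurable_odd_cylinder n g : measurable (odd_cylinder n g).
Proof.
apply: measurable_psi_preimage; first exact: measurable_odd_tree.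
  by move=> T [[]].
by apply: measurable_open; exact: open_cylinder.
Qed.

Lemma agree_upto_dig n g g' : (forall b, dig g b n = dig g' b n) -> agree_upto n g g'.
Proof.
move=> h i ni; have /bval_eqP/(_ i./2) := h (odd i).
rewrite addnC odd_double_half; apply.
by apply: leq_ltn_trans ni; rewrite -{2}(odd_double_half i); lia.
Qed.

(** One even vector carries the prefix of [g] to that of [g']. It is a vertex of every generic odd
    tree, so the translation is defined on the whole cylinder and maps it into the other one;
    exchanging [g] and [g'] will give equality. *)
Lemma odd_cylinder_le n g g' : odd_cantor g -> odd_cantor g' ->
  (nu (odd_cylinder n g) <= nu (odd_cylinder n g'))%E.
Proof.
move=> /odd_cantorE og /odd_cantorE og'.
have d1 h b : pdvd 1 (dig h b n.+1 - dig h b 1).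
  exact: coherent_le (@dig_coherent h) _ _ _ _.
(* Rank [n.+1] instead of [n] makes [a] even also when [n = 0]. *)
pose a b := dig g' b n.+1 - dig g b n.+1.
have ea b : pdvd 1 (a b).
  move: (d1 g b) (d1 g' b) (og b) (og' b); rewrite /a !pdvd1; lia.
have [w wE] : exists w, forall b, co b w = a b.
  by apply: co_onto; move: (ea false) (ea true); rewrite !pdvd1; lia.
have Aw : odd_cylinder n g `<=` [set T | vertices (tgraph T) w].
  move=> T [OT _]; have [[XT gT] _] := OT; apply: gk_odd_even_vertices => //.
    exact: odd_tree_ph.
  by move=> b; rewrite wE.
rewrite -(@nu_shift w (odd_cylinder n g)) //; last by move=> T [[[]]].
apply: nu_le => //; first exact: measurable_shift_image.
move=> _ [T [OT cT] <-]; have [GT _] := OT; have [XT gT] := GT.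
have Tw : vertices (tgraph (T : tspace R)) w by apply: Aw.
have aE : (fun b => co b w) = a by apply/funext.
split.
  apply: (@ph_odd_tree _ true); first exact: (gen_tree_shift XT Tw).1.
  have e : pdvd 1 (ph (shift w (T : tspace R)) true 1 - ph (T : tspace R) true 1).
    by have := pdvdD (ph_shift XT Tw true 1) (ea true); rewrite wE; congr pdvd; ring.
  by rewrite (pdvd_eqr e); exact: odd_tree_ph OT true.
rewrite /= psi_shift // aE.
apply: agree_upto_trans (trans_agree _ cT) _.
have h : agree_upto n.+1 (trans a g) g'.
  apply: agree_upto_dig => b; apply/bval_pdvd.
  by have := dig_trans a g b n.+1; congr pdvd; rewrite /a; ring.
by move=> i ni; apply: h; exact: leqW.
Qed.

Lemma odd_cylinder_eq n g g' : odd_cantor g -> odd_cantor g' ->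
  nu (odd_cylinder n g) = nu (odd_cylinder n g').
Proof. by move=> og og'; apply/eqP; rewrite eq_le !odd_cylinder_le. Qed.

Definition set_digit (g : cantor_space) (n : nat) (c : bool) : cantor_space :=
  fun i => if i == n then c else g i.

Lemma cylinder_split n g : cylinder n g =
  cylinder n.+1 (set_digit g n true) `|` cylinder n.+1 (set_digit g n false).
Proof.
have aux c h : agree_upto n.+1 h (set_digit g n c) <-> agree_upto n h g /\ h n = c.
  split=> [hh|[hh hn] i].
    split=> [i ni|]; last by rewrite hh // /set_digit eqxx.
    by rewrite hh ?leqW // /set_digit ltn_eqF.
  rewrite ltnS leq_eqVlt /set_digit; case: eqVneq => [->//|_] /=; exact: hh.
apply/seteqP; split=> h.
  by move=> hg; case hn : (h n); [left|right]; apply/aux.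
by move=> [] /aux[].
Qed.

Lemma cylinder_split_disj n g :
  cylinder n.+1 (set_digit g n true) `&` cylinder n.+1 (set_digit g n false) = set0.
Proof.
rewrite -subset0 => h [/(_ n (ltnSn n)) h1 /(_ n (ltnSn n))].
by rewrite h1 /set_digit eqxx.
Qed.

(** Digit [m.+2] comes after the two parity digits, so both ways of prescribing it leave odd words,
    of equal measure. *)
Lemma odd_cylinder_half m g : odd_cantor g ->
  nu (odd_cylinder m.+2 g) = (2%:E * nu (odd_cylinder m.+3 g))%E.
Proof.
move=> og; have os c : odd_cantor (set_digit g m.+2 c) by [].
rewrite {1}/odd_cylinder cylinder_split preimage_setU setIUr nu_add //.
- rewrite -/(odd_cylinder m.+3 (set_digit g m.+2 true)).
  rewrite -/(odd_cylinder m.+3 (set_digit g m.+2 false)).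
  rewrite (odd_cylinder_eq m.+3 (os true) og) (odd_cylinder_eq m.+3 (os false) og).
  by rewrite -mule2n mule_natl.
- exact: measurable_odd_cylinder.
- exact: measurable_odd_cylinder.
- by rewrite setIACA -preimage_setI cylinder_split_disj preimage_set0 setI0.
Qed.

Lemma odd_cylinderE m g : odd_cantor g ->
  nu (odd_cylinder m.+2 g) = ((2 ^- m)%:E * nu odd_tree)%E.
Proof.
move=> og; have f := nu_fin.
have mo := measurable_odd_tree.
elim: m => [|m IH].
  rewrite expr0 invr1 mul1e; congr (nu _); apply/seteqP; split=> [T []//|T OT].
  split=> //; have [_ [p0 p1]] := OT; case: og => g0 g1.
  by move=> [|[|//]] _; [rewrite p0 g0|rewrite p1 g1].
have := odd_cylinder_half m og; rewrite IH.
rewrite -(fineK (f _ mo)) -(fineK (f _ (measurable_odd_cylinder m.+3 g))).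
rewrite -!EFinM => -[h]; congr EFin; move: h; rewrite exprS invfM -mulrA => ->.
by rewrite mulrA mulVf ?mul1r.
Qed.

Lemma odd_cylinder_empty m g : ~ odd_cantor g -> odd_cylinder m.+2 g = set0.
Proof.
move=> og; rewrite -subset0 => T [[_ [p0 p1]] h]; apply: og.
by split; [rewrite -(h 0%N)|rewrite -(h 1%N)].
Qed.

Let coin_odd : {measure set bC -> \bar R} := mrestr (coin R) measurable_odd_cantor.

(** The factor [4] normalises the Haar measure on [odd_cantor], which prescribes two digits. Both
    sides are measures in [E], compared on cylinders. *)
Lemma odd_law (E : set bC) : measurable E ->
  nu (odd_tree `&` @psi R @^-1` E) = (nu odd_tree * (4%:E * coin R (E `&` odd_cantor)))%E.
Proof.
move=> mE; have mo := measurable_odd_tree.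
have fo := nu_fin mo.
pose r := 4 * fine (nu odd_tree).
have r0 : 0 <= r by rewrite mulr_ge0 // fine_ge0.
pose m1 : {measure set bT -> \bar R} := mrestr nu mo.
pose m2 : {measure set bC -> \bar R} := mscale (NngNum r0) coin_odd.
pose psi' (T : bT) : bC := if T \in odd_tree then psi (T : tspace R) else point.
have mpsi' : measurable_fun setT psi'.
  move=> _ A mA; rewrite setTI.
  have -> : psi' @^-1` A = (odd_tree `&` @psi R @^-1` A) `|` (~` odd_tree `&` [set _ | A point]).
    rewrite /psi'; apply/seteqP; split=> T /=.
      case: ifPn => [|]; rewrite ?inE ?notin_setE => TO h; [by left|by right].
    case=> -[TO h]; first by rewrite mem_set.
    by rewrite memNset.
  apply: measurableU.
    by apply: measurable_psi_preimage => // T [[]].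
  apply: measurableI; first exact: measurableC.
  have [h|h] := pselect (A point).
    by rewrite (_ : [set _ | _] = setT) //; apply/seteqP; split.
  by rewrite (_ : [set _ | _] = set0) //; apply/seteqP; split.
have pE A : psi' @^-1` A `&` odd_tree = odd_tree `&` @psi R @^-1` A.
  rewrite setIC; apply/seteqP; split=> T [TO /=]; by rewrite /psi' mem_set.
have m2E A : m2 A = (nu odd_tree * (4%:E * coin R (A `&` odd_cantor)))%E.
  rewrite -[LHS]/(r%:E * coin R (A `&` odd_cantor))%E /r EFinM (fineK fo).
  by rewrite -muleA muleCA.
rewrite -m2E -pE -[LHS]/(m1 (psi' @^-1` E)) -[E in RHS]preimage_id.
apply: (@cantor_law_unique R _ _ _ _ m1 m2 psi' id) => //.
  rewrite -[X in (X < _)%E]/(nu (setT `&` odd_tree)) setTI.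
  by rewrite -(fineK fo) ltry.
have big m g : m1 (psi' @^-1` cylinder m.+2 g) = m2 (id @^-1` cylinder m.+2 g).
  rewrite -[LHS]/(nu (psi' @^-1` cylinder m.+2 g `&` odd_tree)) pE.
  rewrite -/(odd_cylinder m.+2 g) preimage_id m2E.
  have [og|og] := pselect (odd_cantor g).
    rewrite odd_cylinderE // (setIidl _); last first.
      move=> h hg; case: og => g0 g1; split; [by rewrite (hg 0%N)|by rewrite (hg 1%N)].
    have -> := coin_cylinder R m.+2 g; rewrite muleC; congr (_ * _)%E.
    by rewrite -EFinM !exprS !invfM; congr EFin; rewrite mulrA mulrA -natrX; field.
  rewrite odd_cylinder_empty // measure0.
  have -> : cylinder m.+2 g `&` odd_cantor = set0.
    rewrite -subset0 => h [hg [h0 h1]]; apply: og.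
    by split; [rewrite -(hg 0%N)|rewrite -(hg 1%N)].
  by rewrite measure0 !mule0.
(* The equidistribution formula covers lengths at least 2; shorter cylinders are recovered by
   splitting them. *)
have down m : (forall g, m1 (psi' @^-1` cylinder m.+1 g) = m2 (id @^-1` cylinder m.+1 g)) ->
    forall g, m1 (psi' @^-1` cylinder m g) = m2 (id @^-1` cylinder m g).
  have mc n g : measurable (cylinder n g : set bC).
    by apply: measurable_open; exact: open_cylinder.
  have mp n g : measurable (psi' @^-1` cylinder n g) by rewrite -[X in measurable X]setTI; exact: mpsi'.
  move=> h g; rewrite cylinder_split !preimage_setU !measureU //.
  - by congr (_ + _)%E; exact: h.
  - exact: mc.
  - exact: mc.
  - by rewrite -preimage_setI cylinder_split_disj preimage_set0.
  - by rewrite -preimage_setI cylinder_split_disj preimage_set0.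
have big1 : forall g, m1 (psi' @^-1` cylinder 1 g) = m2 (id @^-1` cylinder 1 g).
  by apply: (down 1%N); exact: big.
by move=> [|[|n]] g; [exact: (down 0%N big1)|exact: big1|exact: big].
Qed.

(** Written without [nu]: together with [tree_law], it leaves the mass of [odd_tree] as the only
    quantity that could differ between two invariant probabilities. *)
Definition odd_part_law (A : set bT) : \bar R :=
  (4%:E * coin R ((gen_vertex `&` phi R @^-1` (A `&` odd_tree)) `&` odd_cantor))%E.

Lemma odd_part_lawE (A : set bT) : measurable A -> A `<=` odd_tree ->
  nu A = (nu odd_tree * odd_part_law A)%E.
Proof.
move=> mA AO; rewrite /odd_part_law -odd_law; last first.
  apply: measurable_phi_preimage; apply: measurableI => //; exact: measurable_odd_tree.
congr (nu _); apply/seteqP; split=> [T AT|T [OT [_ /= []]]].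
  have OT := AO _ AT; have [GT _] := OT; split=> //; split; first exact: psi_gen.
  by rewrite /= phi_psi.
by have [GT _] := OT; rewrite phi_psi.
Qed.

Definition tree_law (A : set bT) : \bar R :=
  (odd_part_law (A `&` odd_tree) +
   odd_part_law (shift (1, 0)%R @` (A `&` (gen_tree (R:=R) `\` odd_tree)) : set bT))%E.

Lemma odd_part_law_ge0 A : (0 <= odd_part_law A)%E.
Proof. by rewrite mule_ge0. Qed.

Lemma tree_lawE (A : set bT) : measurable A -> nu A = (nu odd_tree * tree_law A)%E.
Proof.
move=> mA; have mG := @measurable_gen_tree R; have mO := measurable_odd_tree.
rewrite (gen_tree_full mA).
have -> : A `&` gen_tree (R:=R) = (A `&` odd_tree) `|` (A `&` (gen_tree (R:=R) `\` odd_tree)).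
  rewrite -setIUr; congr (_ `&` _); rewrite setUC setDKU //.
  by move=> T [].
have mE : measurable (A `&` (gen_tree (R:=R) `\` odd_tree)).
  by apply: measurableI => //; exact: measurableD.
rewrite nu_add //; [|exact: measurableI|]; last first.
  by rewrite setIACA setDIK setI0.
have ev T : (gen_tree (R:=R) `\` odd_tree) T -> pdvd 1 (ph T false 1).
  by move=> [GT nO]; apply/negPn/negP => o; apply: nO; exact: ph_odd_tree o.
have Ev : A `&` (gen_tree (R:=R) `\` odd_tree) `<=` [set T | vertices (tgraph T) (1, 0)].
  by move=> T [_ GT]; apply: gk_even_neighbour (ev _ GT); case: GT => -[].
rewrite -(@nu_shift (1, 0) (A `&` (gen_tree (R:=R) `\` odd_tree))) //; last first.
  by move=> T [_ [[]]].
rewrite (odd_part_lawE (A := A `&` odd_tree)) ?(odd_part_lawE (A := shift _ @` _)).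
- by rewrite /tree_law ge0_muleDr // ?odd_part_law_ge0.
- exact: measurable_shift_image.
- move=> _ [T AT <-]; have [_ GO] := AT; have [[XT gT] nO] := GO.
  have Tv : vertices (tgraph (T : tspace R)) (1, 0) by exact: Ev.
  apply: (@ph_odd_tree _ false); first exact: (gen_tree_shift XT Tv).1.
  rewrite (pdvd_eqr (ph_shift XT Tv false 1)).
  have := ev _ GO; have -> : co false (1, 0) = 1 by [].
  by move: (ph _ _ _) => x; rewrite !pdvd1; lia.
- exact: measurableI.
- by move=> T [].
Qed.

End uniqueness.

Lemma gk_unique_invariant (R : realType) (nu nu' : probability (borel (tspace R)) R) :
  invariant_probability nu (@trel R) (ghys_kenyon R) ->
  invariant_probability nu' (@trel R) (ghys_kenyon R) ->
  forall A : set (borel (tspace R)), measurable A -> nu A = nu' A.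
Proof.
move=> [nuX nuI] [nuX' nuI'].
have e := tree_lawE (probability_setT nu) nuX nuI.
have e' := tree_lawE (probability_setT nu') nuX' nuI'.
(* Both masses multiplied by [tree_law setT] give 1, which determines them. *)
have o : nu (odd_tree (R:=R)) = nu' (odd_tree (R:=R)).
  have h := etrans (esym (probability_setT nu)) (e _ (@measurableT _ _)).
  have h' := etrans (esym (probability_setT nu')) (e' _ (@measurableT _ _)).
  by rewrite -[LHS]mule1 h' muleCA -h mule1.
move=> A mA; apply: etrans (e _ mA) _; apply: etrans _ (esym (e' _ mA)).
by congr (_ * _)%E.
Qed.

(** * Orbit equivalence with the adding machine *)

Section orbit_equivalence.
Variable R : realType.
Implicit Types (T : tspace R).
Local Notation X := (ghys_kenyon R).
Local Notation bT := (borel (tspace R)).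
Local Notation bC := (borel cantor_space).
Local Notation G := (gen_tree (R:=R)).

Lemma trel_refl T : trel T T.
Proof.
exists 0; first by have [] := svalP T.
apply: graph_eq => /=.
  by apply/seteqP; split=> [u Tu|_ [u Tu <-]]; [exists u; rewrite ?subr0|rewrite subr0].
move=> u v; split=> [e|[a [b [e <- <-]]]]; last by rewrite !subr0.
by exists u, v; rewrite !subr0.
Qed.

Lemma psi_class T : G T ->
  @psi R @` class_in (@trel R) G T = class_in (orbit_rel adding_machine) gen_vertex (psi T).
Proof.
move=> GT; have [XT gT] := GT; have [gg mg] := psi_gen GT.
apply/seteqP; split=> [_ [T' [GT' /trelP[v Tv ->]] <-]|g' [Vg' /(orbit_rel_dig _ gg)[a ha]]].
  split; first by apply: psi_gen; exact: (gen_tree_shift XT Tv).1.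
  apply/orbit_rel_dig => //; exists (fun b => co b v) => b n.
  by rewrite psi_shift // pdvd_opp dig_trans.
have [gg' mg'] := Vg'.
(* A pair of integers comes from a vertex only if its entries have the same parity; having the
   origin as a member on both sides guarantees this for [a]. *)
have par (h : cantor_space) : member (dig h) 0 -> pdvd 1 (dig h false 1 - dig h true 1).
  move=> /(_ 1%N); rewrite !co0 !add0r !pdvd1.
  by move: (dig h false 1%N) (dig h true 1%N) => x y; lia.
have [v vE] : exists v, forall b, co b v = a b.
  apply: co_onto; rewrite -pdvd1.
  move: (par _ mg) (par _ mg') (ha false 1%N) (ha true 1%N); rewrite !pdvd1.
  move: (dig _ false _) (dig _ true _) (dig g' false _) (dig g' true _) (a false) (a true).
  by move=> x y x' y' z t; lia.
have Tv : vertices (tgraph T) v.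
  rewrite generic_gk //= => n; have := mg' n; rewrite !co0 !add0r.
  have e b : pdvd n (co b v + ph T b n) = pdvd n (dig g' b n).
    apply: pdvd_eqr; rewrite vE; have := pdvdB (ha b n) (dig_psi XT b n).
    by congr pdvd; ring.
  by rewrite !e.
have aE : (fun b => co b v) = a by apply/funext.
exists (shift v T).
  split; first exact: (gen_tree_shift XT Tv).1.
  by apply/trelP; exists v.
by rewrite psi_shift // aE; exact: trans_eq.
Qed.

Lemma saturation_refl (S : Type) (E : S -> S -> Prop) (Z : set S) :
  (forall x, E x x) -> saturation E Z Z = Z.
Proof. by move=> rE; apply/seteqP; split=> [x []//|x Zx]; split=> //; exists x. Qed.

Lemma orbit_rel_refl (S : Type) (f : S -> S) x : orbit_rel f x x.
Proof. by exists 0%N; left. Qed.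

Lemma borel_iso_psi : @borel_iso _ _ bT bC G gen_vertex (@psi R).
Proof.
split.
- exact: measurable_gen_tree.
- exact: measurable_gen_vertex.
- split=> [T|T T'|g Vg]; first exact: psi_gen.
    by rewrite !inE; exact: psi_inj.
  by exists (phi R g); [exact: phi_gen|exact: psi_phi].
- apply: (@measurable_funS _ _ bT bC X G (@psi R) _ _ (@measurable_psi R)).
    exact: measurable_gk.
  exact: gen_tree_gk.
- by move=> C mC CG; rewrite psi_image //; exact: measurable_phi_preimage.
Qed.

Lemma gk_measure_psi (C : set bC) : C `<=` gen_vertex ->
  gk_measure R (G `&` @psi R @^-1` C) =
  (coin R C * ((fine (coin R gen_vertex))^-1)%:E)%E.
Proof.
move=> CV; rewrite gk_measureE; congr (coin R _ * _)%E.
apply/seteqP; split=> [g [Vg [_ /=]]|g Cg]; first by rewrite psi_phi.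
have Vg := CV _ Cg; split=> //; split; first exact: phi_gen.
by rewrite /= psi_phi.
Qed.

Lemma orbit_equivalent_gen :
  orbit_equivalent (gk_measure R) (@trel R) G (coin R) (orbit_rel adding_machine) gen_vertex.
Proof.
exists G, gen_vertex, (@psi R); split.
- by split.
- by split; apply: saturation_refl; [exact: trel_refl|exact: orbit_rel_refl].
- by rewrite !setDv; split; exact: negligible_set0.
- exact: borel_iso_psi.
split; first by apply: aeW => T GT; exact: psi_class.
move=> C mC CV; have e := gk_measure_psi CV.
have c0 : (0 < fine (coin R gen_vertex))%R.
  apply: fine_gt0; apply/andP; split; first exact: coin_gen_vertex_gt0.
  exact: le_lt_trans (probability_le1 (coin R) measurable_gen_vertex) (ltry 1).
split=> [h|h]; last by apply: etrans e _; rewrite h mul0e.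
have := etrans (esym e) h => /eqP; rewrite mule_eq0 => /orP[/eqP //|].
by rewrite eqe invr_eq0 gt_eqF.
Qed.

Lemma gk_measure_not_gen : gk_measure R (~` G) = 0%E.
Proof.
rewrite gk_measureE; have -> : gen_vertex `&` phi R @^-1` (~` G) = set0.
  by rewrite -subset0 => g [Vg /= ]; apply; exact: phi_gen.
by rewrite measure0 mul0e.
Qed.

(** The orbits of the adding machine allow every pair of integers, of equal parity or not, so some
    translate has both coordinates odd and thus codes a tree. *)
Lemma saturation_gen_vertex g : gen g ->
  saturation (orbit_rel adding_machine) setT gen_vertex g.
Proof.
move=> gg; split=> //; pose a b := 1 - dig g b 1.
have ga := (gen_trans a g).1 gg.
have oa : odd_cantor (trans a g).
  apply/odd_cantorE => b; rewrite (pdvd_eqr (dig_trans a g b 1)) /a.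
  by rewrite addrC subrK pdvd1.
exists (trans a g); first exact: odd_gen_vertex.
apply/orbit_rel_dig => //; exists (fun b => - a b) => b n.
by have := dig_trans a g b n; congr pdvd; ring.
Qed.

Lemma gk_stably_orbit_equivalent :
  stably_orbit_equivalent (gk_measure R) (@trel R) X (coin R) (orbit_rel adding_machine) setT.
Proof.
exists G, gen_vertex; split.
- by split; [exact: measurable_gen_tree|exact: measurable_gen_vertex].
- by split=> //; exact: gen_tree_gk.
- exists (~` G); split.
  + by apply: measurableC; exact: measurable_gen_tree.
  + exact: gk_measure_not_gen.
  + move=> T [XT nS] GT; apply: nS; split=> //; exists T => //; exact: trel_refl.
- exists (~` gen); split.
  + by apply: measurableC; exact: measurable_gen.
  + exact: coin_not_gen.
  + by move=> g [_ nS] gg; apply: nS; exact: saturation_gen_vertex.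
- exact: orbit_equivalent_gen.
Qed.

End orbit_equivalence.

Theorem mainTheorem9 (R : realType) :
  exists mu : probability (borel (tspace R)) R,
    [/\ invariant_probability mu (@trel R) (ghys_kenyon R),
        forall nu : probability (borel (tspace R)) R,
          invariant_probability nu (@trel R) (ghys_kenyon R) ->
          forall A : set (borel (tspace R)), measurable A -> nu A = mu A &
        exists lambda : probability (borel cantor_space) R,
          haar_probability lambda /\
          stably_orbit_equivalent mu (@trel R) (ghys_kenyon R)
            lambda (orbit_rel adding_machine) setT].
Proof.
have gkI : invariant_probability (gk_measure R) (@trel R) (ghys_kenyon R).
  by split; [exact: gk_measure_gk|exact: gk_measure_invariant].
exists (gk_measure R); split=> //.
  by move=> nu nuI A mA; exact: gk_unique_invariant nuI gkI A mA.
by exists (coin R); split; [exact: coin_haar|exact: gk_stably_orbit_equivalent].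
Qed.
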